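(* Let $m,n\ge1$, let $\mathbb K$ be a field, $q\in\mathbb K^*$, let $\mathcal A$ be a $\mathbb K$-algebra, and let $\mathcal A^*$ be the set of its invertible elements. Let $f_0:Pint_{m,n}\to\mathcal A^*$ satisfy the quasi-commutation relations on $Pint_{m,n}$, and let $f:\mathcal E^{m,n}\to\mathcal A$ be the function of $q$-minors of the path matrix associated with $f_0$. Suppose that: (i) the values of $f_0$ are algebraically independent; (ii) if an element $a\in\mathcal A^{f_0}$ is a zerodivisor in $\mathcal A$, then $a$ is a zerodivisor in $\mathcal A^{f_0}$. Let $g:\mathcal E^{m,n}\to\mathcal A$ be an RQI-function (normalized by $g(\emptyset|\emptyset)=1$) coinciding with $f_0$ on $Pint_{m,n}$. Then $g$ is a QI-function (and therefore $g=f$).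
   Context: Basic notation. Algebras are associative and unital, not necessarily commutative. $[n']=\{1,\dots,n'\}$; an interval in $[n']$ is a set $[a..b]=\{a,\dots,b\}$ with $1\le a\le b\le n'$. For a set $A$ and elements $a,\dots,b\notin A$, $Aa\ldots b$ denotes $A\cup\{a,\dots,b\}$. $\mathcal E^{m,n}$ is the set of pairs $(I|J)$ with $I\subseteq[m]$, $J\subseteq[n]$, $|I|=|J|$. $Pint_{m,n}$ is the set of $(I|J)\in\mathcal E^{m,n}$ such that $I,J$ are both intervals and at least one of $I=[|I|]$, $J=[|J|]$ holds. An element $a$ of a ring is a zerodivisor if $ax=0$ or $xa=0$ for some $x\ne0$. Quasi-commutation relations. For $(I|J),(I'|J')\in Pint_{m,n}$ with $|I|\ge|I'|$ put $c=c((I|J),(I'|J')):=\beta+\delta-\alpha-\gamma$, where $\alpha=|\{i'\in I': i'<\min I\}|$, $\beta=|\{i'\in I': i'>\max I\}|$, $\gamma=|\{j'\in J': j'<\min J\}|$, $\delta=|\{j'\in J': j'>\max J\}|$. $f_0$ satisfies the quasi-commutation relations if $f_0(I|J)f_0(I'|J')=q^{c}f_0(I'|J')f_0(I|J)$ for all such pairs. Algebraic independence. Let $\mathcal L_Y$ be the $\mathbb K$-algebra of quantized Laurent polynomials generated by indeterminates $y_{I|J}^{\pm1}$, $(I|J)\in Pint_{m,n}$, subject to $y_{I|J}y_{I'|J'}=q^{c}y_{I'|J'}y_{I|J}$ with the same exponents $c$ as for $f_0$. Let $\mathcal A^{f_0}$ be the $\mathbb K$-subalgebra of $\mathcal A$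 generated by the values of $f_0$ and their inverses. The values of $f_0$ are algebraically independent if $y_{I|J}\mapsto f_0(I|J)$ gives an isomorphism $\mathcal L_Y\to\mathcal A^{f_0}$. Fine $q$-matrices and $q$-minors. An $m\times n$ matrix $X=(x_{ij})$ over a $\mathbb K$-algebra is a fine $q$-matrix if for all $i<\ell\le m$, $j<k\le n$ (and, in the first two relations, all admissible values of the remaining index): $x_{ij}x_{ik}=q x_{ik}x_{ij}$, $x_{ij}x_{\ell j}=q x_{\ell j}x_{ij}$, $x_{ik}x_{\ell j}=x_{\ell j}x_{ik}$, $x_{ij}x_{\ell k}-x_{\ell k}x_{ij}=(q-q^{-1})x_{ik}x_{\ell j}$. For $I=\{i_1<\dots<i_k\}$, $J=\{j_1<\dots<j_k\}$, $\Delta_{X,q}(I|J)=\sum_{\sigma\in S_k}(-q)^{\ell(\sigma)}x_{i_1j_{\sigma(1)}}\cdots x_{i_kj_{\sigma(k)}}$, where $\ell(\sigma)$ is the number of inversions; $\Delta(\emptyset|\emptyset)=1$. QI-functions. A universal QI (for given $m,n$) is a formal expression $\sum_{i=1}^N \mathrm{sign}_i\,q^{\delta_i}\Delta(I_i|J_i)\Delta(I'_i|J'_i)=0$ with $\mathrm{sign}_i\in\{+,-\}$, $\delta_i\in\mathbb Z$, $(I_i|J_i),(I_i'|J_i')\in\mathcal E^{m,n}$ (repetitions allowed), such that each of $I_i\cup I'_i$, $I_i\cap I'_i$, $J_i\cup J'_i$, $J_i\cap J'_i$ does not depend on $i$, and which holds for the $q$-minors of every $m\times n$ fine $q$-matrix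 over every $\mathbb K$-algebra, for every field $\mathbb K$ and every $q\in\mathbb K^*$. A function $h:\mathcal E^{m,n}\to\mathcal A$ is a QI-function if for every universal QI the identity obtained by replacing each $\Delta(I|J)$ by $h(I|J)$ holds in $\mathcal A$ (with the given $q$). All functions on $\mathcal E^{m,n}$ are assumed normalized: $h(\emptyset|\emptyset)=1$. RQI-functions. $h:\mathcal E^{m,n}\to\mathcal A$ is an RQI-function if it satisfies: (P) for all $A\subset[m]$, $B\subset[n]$, $i<j<k$ in $[m]-A$, $\ell\in[n]-B$ with $|A|+1=|B|$: $h(Aj|B)h(Aik|B\ell)=h(Aij|B\ell)h(Ak|B)+h(Ajk|B\ell)h(Ai|B)$; (P* ) for all $A\subset[m]$, $B\subset[n]$, $\ell\in[m]-A$, $i<j<k$ in $[n]-B$ with $|A|=|B|+1$: $h(A|Bj)h(A\ell|Bik)=h(A\ell|Bij)h(A|Bk)+h(A\ell|Bjk)h(A|Bi)$; (D) for all $i,k\in[m]$, $j,\ell\in[n]$ with $k-i=\ell-j>0$, and $A:=\{i+1,\dots,k-1\}$, $B:=\{j+1,\dots,\ell-1\}$ (possibly empty): $h(Ai|Bj)h(Ak|B\ell)=h(Aik|Bj\ell)h(A|B)+q\,h(Ai|B\ell)h(Ak|Bj)$. The function $f$. For $(i,j)\in[m]\times[n]$ and $k:=\min\{i,j\}$ let $\pi(i,j):=([i-k+1..i]\,|\,[j-k+1..j])\in Pint_{m,n}$. Put $w(i,j):=f_0(\{i\}|\{j\})$ if $\min\{i,j\}=1$, and $w(i,j):=f_0(\pi(i-1,j-1))^{-1}f_0(\pi(i,j))$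 otherwise. Let $G$ be the directed graph with vertex set $(\{0,\dots,m\}\times\{0,\dots,n\})-\{(0,0)\}$ and edges $(i,j-1)\to(i,j)$ (horizontal) and $(i,j)\to(i-1,j)$ (vertical) for all $i\in[m]$, $j\in[n]$. The weight of a horizontal edge $(i,0)\to(i,1)$ is $w(i,1)$; that of a horizontal edge $(i,j-1)\to(i,j)$ with $j\ge2$ is $w(i,j-1)^{-1}w(i,j)$; that of a vertical edge is $1$. The weight of a directed path is the product of the weights of its edges, ordered from left to right along the path. The path matrix is the $m\times n$ matrix $\mathrm{Path}$ whose $(i,j)$ entry is the sum of the weights of all directed paths from $(i,0)$ to $(0,j)$ in $G$. Finally, $f(I|J):=\Delta_{\mathrm{Path},q}(I|J)$ for all $(I|J)\in\mathcal E^{m,n}$. *)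

(* Defs.v *)
From HB Require Import structures.
From mathcomp Require Import all_boot all_order perm all_algebra.
From mathcomp Require Import zify boolp.

Set Implicit Arguments.
Unset Strict Implicit.
Unset Printing Implicit Defensive.

Import GRing.Theory.
Local Open Scope ring_scope.
Local Open Scope quotient_scope.

(** Index sets are 0-based: an ordinal [i : 'I_m] stands for the element [i+1]
    of [m] = {1, ..., m}.  A function [h] on pairs (I|J) is a total function
    [{set 'I_m} -> {set 'I_n} -> A]; its values outside its mathematical domain
    ([#|I| = #|J|], or [Pint m n]) are never used. *)

Section PresentedAlgebra.

Inductive aterm (K : fieldType) (T : Type) : Type :=
| TGen of T
| TZero
| TOne
| TAdd of aterm K T & aterm K T
| TMul of aterm K T & aterm K T
| TScale of K & aterm K T.

Arguments TZero {K T}.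
Arguments TOne {K T}.

HB.instance Definition _ (K : fieldType) (T : Type) := gen_eqMixin (aterm K T).
HB.instance Definition _ (K : fieldType) (T : Type) :=
  gen_choiceMixin (aterm K T).

Variables (K : fieldType) (T : Type) (rel : aterm K T -> aterm K T -> Prop).

(** The least congruence containing [rel] and the laws of associative unital
    [K]-algebras (the opposite of [t] is [(-1) t]). *)
Inductive acong : aterm K T -> aterm K T -> Prop :=
| acong_rel s t : rel s t -> acong s t
| acong_refl t : acong t t
| acong_sym s t : acong s t -> acong t s
| acong_trans s t u : acong s t -> acong t u -> acong s u
| acong_add s s' t t' : acong s s' -> acong t t' ->
    acong (TAdd s t) (TAdd s' t')
| acong_mul s s' t t' : acong s s' -> acong t t' ->
    acong (TMul s t) (TMul s' t')
| acong_scale c t t' : acong t t' -> acong (TScale c t) (TScale c t')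
| acong_addA s t u : acong (TAdd s (TAdd t u)) (TAdd (TAdd s t) u)
| acong_addC s t : acong (TAdd s t) (TAdd t s)
| acong_add0 t : acong (TAdd TZero t) t
| acong_addN t : acong (TAdd (TScale (-1) t) t) TZero
| acong_mulA s t u : acong (TMul s (TMul t u)) (TMul (TMul s t) u)
| acong_mul1l t : acong (TMul TOne t) t
| acong_mul1r t : acong (TMul t TOne) t
| acong_mulDl s t u : acong (TMul (TAdd s t) u) (TAdd (TMul s u) (TMul t u))
| acong_mulDr s t u : acong (TMul s (TAdd t u)) (TAdd (TMul s t) (TMul s u))
| acong_scaleA c d t : acong (TScale c (TScale d t)) (TScale (c * d) t)
| acong_scale1 t : acong (TScale 1 t) t
| acong_scaleDr c s t : acong (TScale c (TAdd s t))
                              (TAdd (TScale c s) (TScale c t))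
| acong_scaleDl c d t : acong (TScale (c + d) t)
                              (TAdd (TScale c t) (TScale d t))
| acong_scaleAl c s t : acong (TScale c (TMul s t)) (TMul (TScale c s) t)
| acong_scaleAr c s t : acong (TScale c (TMul s t)) (TMul s (TScale c t)).

Definition acongb (s t : aterm K T) : bool := `[< acong s t >].

Lemma acongb_refl : reflexive acongb.
Proof. by move=> t; apply/asboolP; exact: acong_refl. Qed.

Lemma acongb_sym : symmetric acongb.
Proof.
by move=> s t; apply/idP/idP => /asboolP h; apply/asboolP; exact: acong_sym.
Qed.

Lemma acongb_trans : transitive acongb.
Proof.
move=> t s u /asboolP st /asboolP tu; apply/asboolP.
exact: acong_trans st tu.
Qed.

Canonical acong_equiv :=
  EquivRel acongb acongb_refl acongb_sym acongb_trans.

Definition palg : Type := {eq_quot acongb}.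

HB.instance Definition _ := Choice.on palg.
HB.instance Definition _ := EqQuotient.on palg.

Implicit Types x y z : palg.

Lemma palgP (s t : aterm K T) : \pi_palg s = \pi_palg t <-> acong s t.
Proof. by split=> [/eqmodP/asboolP | h]; last exact/eqmodP/asboolP. Qed.

Lemma repr_cong (t : aterm K T) : acong (repr (\pi_palg t)) t.
Proof. by apply/palgP; rewrite reprK. Qed.

Definition pgen (a : T) : palg := \pi_palg (TGen K a).
Definition padd x y : palg := \pi_palg (TAdd (repr x) (repr y)).
Definition pmul x y : palg := \pi_palg (TMul (repr x) (repr y)).
Definition pscale (c : K) x : palg := \pi_palg (TScale c (repr x)).
Definition popp x : palg := pscale (-1) x.

Lemma paddE s t : padd (\pi_palg s) (\pi_palg t) = \pi_palg (TAdd s t).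
Proof. by apply/palgP; apply: acong_add; exact: repr_cong. Qed.
Lemma pmulE s t : pmul (\pi_palg s) (\pi_palg t) = \pi_palg (TMul s t).
Proof. by apply/palgP; apply: acong_mul; exact: repr_cong. Qed.
Lemma pscaleE c t : pscale c (\pi_palg t) = \pi_palg (TScale c t).
Proof. by apply/palgP; apply: acong_scale; exact: repr_cong. Qed.

Let pE := (paddE, pmulE, pscaleE).

Lemma paddA : associative padd.
Proof.
elim/(@quotW _ palg)=> s; elim/(@quotW _ palg)=> t; elim/(@quotW _ palg)=> u; rewrite !pE.
by apply/palgP; constructor.
Qed.
Lemma paddC : commutative padd.
Proof.
by elim/(@quotW _ palg)=> s; elim/(@quotW _ palg)=> t; rewrite !pE; apply/palgP; constructor.
Qed.
Lemma padd0 : left_id (\pi_palg TZero) padd.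
Proof. by elim/(@quotW _ palg)=> t; rewrite !pE; apply/palgP; constructor. Qed.
Lemma paddN : left_inverse (\pi_palg TZero) popp padd.
Proof. by elim/(@quotW _ palg)=> t; rewrite /popp !pE; apply/palgP; constructor. Qed.

HB.instance Definition _ := GRing.isZmodule.Build palg paddA paddC padd0 paddN.

Lemma pmulA : associative pmul.
Proof.
elim/(@quotW _ palg)=> s; elim/(@quotW _ palg)=> t; elim/(@quotW _ palg)=> u; rewrite !pE.
by apply/palgP; constructor.
Qed.
Lemma pmul1l : left_id (\pi_palg TOne) pmul.
Proof. by elim/(@quotW _ palg)=> t; rewrite !pE; apply/palgP; constructor. Qed.
Lemma pmul1r : right_id (\pi_palg TOne) pmul.
Proof. by elim/(@quotW _ palg)=> t; rewrite !pE; apply/palgP; constructor. Qed.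
Lemma pmulDl : left_distributive pmul padd.
Proof.
elim/(@quotW _ palg)=> s; elim/(@quotW _ palg)=> t; elim/(@quotW _ palg)=> u; rewrite !pE.
by apply/palgP; constructor.
Qed.
Lemma pmulDr : right_distributive pmul padd.
Proof.
elim/(@quotW _ palg)=> s; elim/(@quotW _ palg)=> t; elim/(@quotW _ palg)=> u; rewrite !pE.
by apply/palgP; constructor.
Qed.

HB.instance Definition _ :=
  GRing.Zmodule_isPzRing.Build palg pmulA pmul1l pmul1r pmulDl pmulDr.

Lemma pscaleA c d x : pscale c (pscale d x) = pscale (c * d) x.
Proof. by elim/(@quotW _ palg): x => t; rewrite !pE; apply/palgP; constructor. Qed.
Lemma pscale1 : left_id 1 pscale.
Proof. by elim/(@quotW _ palg)=> t; rewrite !pE; apply/palgP; constructor. Qed.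
Lemma pscaleDr : right_distributive pscale padd.
Proof.
move=> c; elim/(@quotW _ palg)=> s; elim/(@quotW _ palg)=> t; rewrite !pE.
by apply/palgP; constructor.
Qed.
Lemma pscaleDl x : {morph pscale^~ x : c d / c + d >-> padd c d}.
Proof. by elim/(@quotW _ palg): x => t c d /=; rewrite !pE; apply/palgP; constructor. Qed.

HB.instance Definition _ :=
  GRing.Zmodule_isLmodule.Build K palg pscaleA pscale1 pscaleDr pscaleDl.

(** MathComp's [algType] requires [1 != 0], which fails for some [rel];
    the algebra laws are therefore recorded as lemmas. *)
Lemma pscaleAl (c : K) x y : c *: (x * y) = (c *: x) * y.
Proof.
elim/(@quotW _ palg): x => s; elim/(@quotW _ palg): y => t.
by rewrite /GRing.scale /GRing.mul /= !pE; apply/palgP; constructor.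
Qed.
Lemma pscaleAr (c : K) x y : c *: (x * y) = x * (c *: y).
Proof.
elim/(@quotW _ palg): x => s; elim/(@quotW _ palg): y => t.
by rewrite /GRing.scale /GRing.mul /= !pE; apply/palgP; constructor.
Qed.

End PresentedAlgebra.

Arguments TGen {K T}.
Arguments TZero {K T}.
Arguments TOne {K T}.

Definition is_interval (m : nat) (I : {set 'I_m}) : bool :=
  [exists a : 'I_m, exists b : 'I_m,
    (a <= b)%N && (I == [set i : 'I_m | (a <= i <= b)%N])].

Definition is_initial (m : nat) (I : {set 'I_m}) : bool :=
  I == [set i : 'I_m | (i < #|I|)%N].

Definition is_pint (m n : nat) (x : {set 'I_m} * {set 'I_n}) : bool :=
  [&& #|x.1| == #|x.2|, is_interval x.1, is_interval x.2
    & is_initial x.1 || is_initial x.2].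

Definition Pint (m n : nat) : finType :=
  {x : {set 'I_m} * {set 'I_n} | is_pint x}.

Notation rowset p := (val p).1.
Notation colset p := (val p).2.

(** On a nonempty [I], comparing with all of [I] is comparing with its
    minimum (resp. maximum). *)
Definition nb_before (m : nat) (I I' : {set 'I_m}) : nat :=
  #|[set i' in I' | [forall i in I, (i' < i)%N]]|.
Definition nb_after (m : nat) (I I' : {set 'I_m}) : nat :=
  #|[set i' in I' | [forall i in I, (i < i')%N]]|.

Definition qc_exp (m n : nat) (p p' : Pint m n) : int :=
  (nb_after (rowset p) (rowset p') + nb_after (colset p) (colset p'))%N%:Z
  - (nb_before (rowset p) (rowset p') + nb_before (colset p) (colset p'))%N%:Z.

Definition quasi_commuting (m n : nat) (K : fieldType) (q : K) (A : algType K)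
    (f0 : {set 'I_m} -> {set 'I_n} -> A) : Prop :=
  forall p p' : Pint m n, (#|rowset p'| <= #|rowset p|)%N ->
    f0 (rowset p) (colset p) * f0 (rowset p') (colset p')
    = q ^ qc_exp p p' *:
        (f0 (rowset p') (colset p') * f0 (rowset p) (colset p)).

(** The generator [(p, false)] is y_p and [(p, true)] is its inverse. *)
Inductive LY_rel (m n : nat) (K : fieldType) (q : K) :
    aterm K (Pint m n * bool) -> aterm K (Pint m n * bool) -> Prop :=
| LY_mulV (p : Pint m n) :
    LY_rel q (TMul (TGen (p, false)) (TGen (p, true))) TOne
| LY_Vmul (p : Pint m n) :
    LY_rel q (TMul (TGen (p, true)) (TGen (p, false))) TOne
| LY_qc (p p' : Pint m n) : (#|rowset p'| <= #|rowset p|)%N ->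
    LY_rel q (TMul (TGen (p, false)) (TGen (p', false)))
      (TScale (q ^ qc_exp p p') (TMul (TGen (p', false)) (TGen (p, false)))).

Definition LY (m n : nat) (K : fieldType) (q : K) := palg (@LY_rel m n K q).

Definition LY_y (m n : nat) (K : fieldType) (q : K) (p : Pint m n) : LY m n q :=
  pgen (@LY_rel m n K q) (p, false).

(** The generated subalgebra, as the intersection of all subalgebras containing
    the values of [f0] on [Pint] and their inverses. *)
Definition subalg_f0 (m n : nat) (K : fieldType) (A : unitAlgType K)
    (f0 : {set 'I_m} -> {set 'I_n} -> A) (a : A) : Prop :=
  forall D : {pred A}, GRing.subalg_closed D ->
    (forall p : Pint m n, f0 (rowset p) (colset p) \in D
                       /\ (f0 (rowset p) (colset p))^-1 \in D) ->
    a \in D.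

Definition alg_independent (m n : nat) (K : fieldType) (q : K)
    (A : unitAlgType K) (f0 : {set 'I_m} -> {set 'I_n} -> A) : Prop :=
  exists phi : {rmorphism LY m n q -> A},
    [/\ scalable phi,
        forall p : Pint m n, phi (LY_y q p) = f0 (rowset p) (colset p),
        injective phi
      & forall a : A, subalg_f0 f0 a <-> exists u, phi u = a].

Definition zerodivisor_in (R : pzRingType) (S : R -> Prop) (a : R) : Prop :=
  S a /\ exists x : R, [/\ S x, x <> 0 & a * x = 0 \/ x * a = 0].

Definition fine_qmatrix (K : fieldType) (q : K) (A : algType K) (m n : nat)
    (X : 'M[A]_(m, n)) : Prop :=
  [/\ forall (i : 'I_m) (j k : 'I_n), (j < k)%N ->
        X i j * X i k = q *: (X i k * X i j),
      forall (i l : 'I_m) (j : 'I_n), (i < l)%N ->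
        X i j * X l j = q *: (X l j * X i j),
      forall (i l : 'I_m) (j k : 'I_n), (i < l)%N -> (j < k)%N ->
        X i k * X l j = X l j * X i k
    & forall (i l : 'I_m) (j k : 'I_n), (i < l)%N -> (j < k)%N ->
        X i j * X l k - X l k * X i j = (q - q^-1) *: (X i k * X l j)].

Definition inversions (k : nat) (s : 'S_k) : nat :=
  #|[set u : 'I_k * 'I_k | (u.1 < u.2)%N && (s u.2 < s u.1)%N]|.

Definition qdet (K : fieldType) (q : K) (A : algType K) (k : nat)
    (X : 'M[A]_k) : A :=
  \sum_(s : 'S_k) (- q) ^+ inversions s *: \prod_(r < k) X r (s r).

(** [enum_val] lists the elements of a set of ordinals increasingly.  For
    [#|I| = #|J|], [conform_mx] only casts the submatrix of [X] with rows [I]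
    and columns [J] to a square matrix. *)
Definition qminor (K : fieldType) (q : K) (A : algType K) (m n : nat)
    (X : 'M[A]_(m, n)) (I : {set 'I_m}) (J : {set 'I_n}) : A :=
  qdet q (conform_mx (0 : 'M[A]_#|I|)
            (mxsub (@enum_val _ (mem I)) (@enum_val _ (mem J)) X)).

Record qi_term (m n : nat) := QITerm {
  qi_sign : bool;  (* [true] for the sign - *)
  qi_exp : int;
  qi_I : {set 'I_m};
  qi_J : {set 'I_n};
  qi_I' : {set 'I_m};
  qi_J' : {set 'I_n}
}.

Definition qi_holds (m n : nat) (K : fieldType) (q : K) (A : algType K)
    (h : {set 'I_m} -> {set 'I_n} -> A) (s : seq (qi_term m n)) : Prop :=
  \sum_(t <- s) ((-1) ^+ qi_sign t * q ^ qi_exp t) *: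
     (h (qi_I t) (qi_J t) * h (qi_I' t) (qi_J' t)) = 0.

Definition qi_homogeneous (m n : nat) (s : seq (qi_term m n)) : Prop :=
  exists (UI MI : {set 'I_m}) (UJ MJ : {set 'I_n}),
    forall t, List.In t s ->
      [/\ #|qi_I t| = #|qi_J t|, #|qi_I' t| = #|qi_J' t|,
          qi_I t :|: qi_I' t = UI /\ qi_I t :&: qi_I' t = MI
        & qi_J t :|: qi_J' t = UJ /\ qi_J t :&: qi_J' t = MJ].

(** The zero ring, which is not an [algType], satisfies every identity. *)
Definition universal_QI (m n : nat) (s : seq (qi_term m n)) : Prop :=
  qi_homogeneous s /\
  forall (K : fieldType) (q : K) (A : algType K) (X : 'M[A]_(m, n)),
    q != 0 -> fine_qmatrix q X -> qi_holds q (qminor q X) s.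

Definition QI_function (m n : nat) (K : fieldType) (q : K) (A : algType K)
    (h : {set 'I_m} -> {set 'I_n} -> A) : Prop :=
  forall s : seq (qi_term m n), universal_QI s -> qi_holds q h s.

Definition RQI_P (m n : nat) (K : fieldType) (A : algType K)
    (h : {set 'I_m} -> {set 'I_n} -> A) : Prop :=
  forall (X : {set 'I_m}) (Y : {set 'I_n}) (i j k : 'I_m) (l : 'I_n),
    i \notin X -> j \notin X -> k \notin X -> l \notin Y ->
    (i < j)%N -> (j < k)%N -> #|X|.+1 = #|Y| ->
    h (X :|: [set j]) Y * h (X :|: [set i; k]) (Y :|: [set l])
    = h (X :|: [set i; j]) (Y :|: [set l]) * h (X :|: [set k]) Y
    + h (X :|: [set j; k]) (Y :|: [set l]) * h (X :|: [set i]) Y.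

Definition RQI_Pstar (m n : nat) (K : fieldType) (A : algType K)
    (h : {set 'I_m} -> {set 'I_n} -> A) : Prop :=
  forall (X : {set 'I_m}) (Y : {set 'I_n}) (l : 'I_m) (i j k : 'I_n),
    l \notin X -> i \notin Y -> j \notin Y -> k \notin Y ->
    (i < j)%N -> (j < k)%N -> #|X| = #|Y|.+1 ->
    h X (Y :|: [set j]) * h (X :|: [set l]) (Y :|: [set i; k])
    = h (X :|: [set l]) (Y :|: [set i; j]) * h X (Y :|: [set k])
    + h (X :|: [set l]) (Y :|: [set j; k]) * h X (Y :|: [set i]).

Definition RQI_D (m n : nat) (K : fieldType) (q : K) (A : algType K)
    (h : {set 'I_m} -> {set 'I_n} -> A) : Prop :=
  forall (i k : 'I_m) (j l : 'I_n),
    (i < k)%N -> (j < l)%N -> (k - i = l - j)%N ->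
    let X := [set a : 'I_m | (i < a < k)%N] in
    let Y := [set b : 'I_n | (j < b < l)%N] in
    h (X :|: [set i]) (Y :|: [set j]) * h (X :|: [set k]) (Y :|: [set l])
    = h (X :|: [set i; k]) (Y :|: [set j; l]) * h X Y
    + q *: (h (X :|: [set i]) (Y :|: [set l]) * h (X :|: [set k]) (Y :|: [set j])).

Definition RQI_function (m n : nat) (K : fieldType) (q : K) (A : algType K)
    (h : {set 'I_m} -> {set 'I_n} -> A) : Prop :=
  [/\ RQI_P h, RQI_Pstar h & RQI_D q h].

Section PathMatrix.

Variables (m n : nat) (K : fieldType) (A : unitAlgType K).
Variable f0 : {set 'I_m} -> {set 'I_n} -> A.

(** In this section [i] and [j] are 1-based, as are the coordinates of the
    vertices of the graph; the ordinal [a] belongs to the interval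
    [i-k+1 .. i] iff [i - k <= a < i]. *)
Definition pi_row (i j : nat) : {set 'I_m} :=
  [set a : 'I_m | (i - minn i j <= a < i)%N].
Definition pi_col (i j : nat) : {set 'I_n} :=
  [set b : 'I_n | (j - minn i j <= b < j)%N].

(** If [minn i j = 1] then [pi_row i j = {i}] and [pi_col i j = {j}]. *)
Definition w (i j : nat) : A :=
  if minn i j == 1%N then f0 (pi_row i j) (pi_col i j)
  else (f0 (pi_row i.-1 j.-1) (pi_col i.-1 j.-1))^-1
       * f0 (pi_row i j) (pi_col i j).

(** The vertex (0,0) is excluded from the graph; here it is isolated. *)
Definition vertex : finType := ('I_m.+1 * 'I_n.+1)%type.

Definition hedge (u v : vertex) : bool :=
  [&& (0 < u.1)%N, v.1 == u.1 & v.2 == u.2.+1 :> nat].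
Definition vedge (u v : vertex) : bool :=
  [&& (0 < u.2)%N, v.2 == u.2 & u.1 == v.1.+1 :> nat].
Definition edge : rel vertex := [rel u v | hedge u v || vedge u v].

Definition edge_weight (u v : vertex) : A :=
  if hedge u v then
    if v.2 == 1%N :> nat then w u.1 1 else (w u.1 u.2)^-1 * w u.1 v.2
  else 1.

Definition path_weight (u : vertex) (p : seq vertex) : A :=
  \prod_(a <- pairmap edge_weight u p) a.

(** The graph is acyclic, so that its directed paths have fewer than
    [#|vertex|] edges (see [size_path_lt]). *)
Definition path_mx : 'M[A]_(m, n) :=
  \matrix_(i, j)
    \sum_(k < #|{: vertex}|)
      \sum_(p : k.-tuple vertex |
              path edge (lift ord0 i, ord0) p
              && (last (lift ord0 i, ord0) p == (ord0, lift ord0 j)))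
        path_weight (lift ord0 i, ord0) p.

Lemma edge_rank (u v : vertex) : edge u v -> (v.1 + u.2 < u.1 + v.2)%N.
Proof.
case/orP => /and3P[_ /eqP -> /eqP ->]; first by rewrite addnS.
by rewrite addSn.
Qed.

Lemma size_path_lt (u : vertex) (p : seq vertex) :
  path edge u p -> (size p < #|{: vertex}|)%N.
Proof.
move=> up; suff /card_uniqP sz : uniq (u :: p).
  by have := max_card (mem (u :: p)); rewrite sz.
pose r := [rel x y : vertex | (y.1 + x.2 < x.1 + y.2)%N].
apply: (@sorted_uniq _ r).
- move=> [y1 y2] [x1 x2] [z1 z2] /=.
  move: (nat_of_ord _) (nat_of_ord _) (nat_of_ord _).
  move: (nat_of_ord _) (nat_of_ord _) (nat_of_ord _); lia.
- by move=> x /=; rewrite ltnn.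
- by apply: sub_path up => x y; exact: edge_rank.
Qed.

End PathMatrix.

(* Main.v *)
Require Import Defs.
From mathcomp Require Import all_boot all_order all_algebra.
From mathcomp Require Import perm zify ring boolp.

Set Implicit Arguments.
Unset Strict Implicit.
Unset Printing Implicit Defensive.

Import Order.TTheory GRing.Theory Num.Theory.
Local Open Scope ring_scope.

(** A function satisfying (P), ([P*]) and (D) is determined by its values on
    [Pint], by induction on the size and then on the spread of [I] and [J], as
    long as the factors [h(Aj|B)], [h(A|Bj)] and [h(Ai|Bj)] can be cancelled.
    Hence it is enough that the [q]-minors of the path matrix satisfy these
    relations, extend [f0], and are not left zerodivisors.

    The weights [w(i,j)] inherit from [f0] the relations of a quantum affine
    space.  Peeling off the row of the graph that the paths cross last, the path
    matrix [X] is obtained from the path matrix [X'] of the other rows and the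
    weights [t_b] of the last one by [x_ij = \sum_(b <= j) x'_ib t_b^-1 t_j], and
    this operation preserves fine [q]-matrices; since it is a column operation,
    it also yields the minors on [Pint].  The relations between [q]-minors come
    from Laplace expansions, i.e. from products in the [q]-exterior algebra.

    For the cancellation, grade the quantum torus so that [w(i,j)] has degree
    [(i-j)^2].  By the Monge property of these degrees, the component of lowest
    degree of a minor is the product of the diagonal weights, which is
    invertible; such an element is regular in the quantum torus, hence in [A] by
    hypothesis (ii). *)

(** * Products in the [q]-exterior algebra *)

(** In (P), its transpose and (D) the unknown value is a right factor, so only left cancellation by
    minors of the path matrix is required. The induction on the spread meets (P) only with [i] and
    [k] the two ends of the row set, and only this case is proved for minors. A quadratic sum of
    Laplace expansions puts two of the three products of (P) in the wrong order; when [i] and [k]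
    are extreme, each can be reversed at the cost of a single power of [q].

    Regularity cannot be read off a basis of the quantum torus, which is given by generators and
    relations, and (i) says only that its map to [A] is injective. Its elements are therefore made
    to act on formal series [int -> A]. By (i) this action depends only on the value in [A], and
    comparing orders of series replaces comparing normal forms.

    Once [g] equals the minors of the path matrix, it is a QI-function because that matrix is a fine
    q-matrix. *)

Definition nlt n (J : {set 'I_n}) (c : 'I_n) : nat := #|[set b in J | (b < c)%N]|.
Definition ngt n (J : {set 'I_n}) (c : 'I_n) : nat := #|[set b in J | (c < b)%N]|.

Lemma nltD1 n (J : {set 'I_n}) c d : c \in J ->
  nlt J d = ((c < d) + nlt (J :\ c) d)%N.
Proof.
move=> cJ; rewrite /nlt; case: (ltnP c d) => cd /=.
  rewrite (cardsD1 c) !inE cJ cd; congr (_ + _)%N; apply: eq_card => b.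
  by rewrite !inE andbA.
rewrite add0n; apply: eq_card => b; rewrite !inE.
by case: eqP => [->|//]; rewrite ltnNge cd andbF.
Qed.

Lemma ngtD1 n (J : {set 'I_n}) c d : c \in J ->
  ngt J d = ((d < c) + ngt (J :\ c) d)%N.
Proof.
move=> cJ; rewrite /ngt; case: (ltnP d c) => cd /=.
  rewrite (cardsD1 c) !inE cJ cd; congr (_ + _)%N; apply: eq_card => b.
  by rewrite !inE andbA.
rewrite add0n; apply: eq_card => b; rewrite !inE.
by case: eqP => [->|//]; rewrite ltnNge cd andbF.
Qed.

(** Groups (c, d) with (d, c), the level at which the quadratic relations between entries act. It
    serves for products of two rows and again for products of prefix sums in [ccq]. *)
Lemma sum_pairs n (V : zmodType) (J : {set 'I_n}) (F : 'I_n -> 'I_n -> V) :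
  \sum_(c in J) \sum_(d in J :\ c) F c d
  = \sum_(c in J) \sum_(d in J | (c < d)%N) (F c d + F d c).
Proof.
under [RHS]eq_bigr do rewrite big_split.
rewrite big_split /= [X in _ = _ + X](exchange_big_dep (mem J)) /=; last by move=> ? ? ? /andP[].
rewrite -big_split; apply: eq_bigr => c cJ /=.
rewrite (bigID (fun d : 'I_n => (c < d)%N)) /=; congr (_ + _).
  apply: eq_bigl => d; rewrite !inE; case: eqP => [->|//].
  by rewrite ltnn !andbF.
apply: eq_bigl => d; rewrite !inE cJ /= -leqNgt leq_eqVlt -val_eqE /=.
by case: ltngtP; rewrite ?andbF ?andbT ?orbT.
Qed.

Section Wedge.

Variables (K : fieldType) (q : K) (A : algType K) (n : nat).
Hypothesis q0 : q != 0.

Implicit Types (r t : 'I_n -> A) (phi : {set 'I_n} -> A).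

(** [phi] stands for the element [\sum_J phi J e_J] of the [q]-exterior algebra
    with coefficients in [A]; [wedgel r] and [wedger r] are the multiplications
    by [\sum_c r c e_c] on the left and on the right. *)
Definition wedgel r phi (J : {set 'I_n}) :=
  \sum_(c in J) (- q) ^+ nlt J c *: (r c * phi (J :\ c)).
Definition wedger r phi (J : {set 'I_n}) :=
  \sum_(c in J) (- q) ^+ ngt J c *: (phi (J :\ c) * r c).
Definition wedge0 : {set 'I_n} -> A := fun J => (J == set0)%:R.

Definition qrow r := forall c d : 'I_n, (c < d)%N -> r c * r d = q *: (r d * r c).
Definition qrow2 r t :=
  (forall c d : 'I_n, (c < d)%N -> r d * t c = t c * r d) /\
  (forall c d : 'I_n, (c < d)%N -> r c * t d - t d * r c = (q - q^-1) *: (r d * t c)).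

(** Sorting e_d e_c into e_c e_d costs a factor -q, so the two rows enter only through the
    expressions r_c t_d - q r_d t_c. *)
Lemma wedgel2E r t phi J : wedgel r (wedgel t phi) J =
  \sum_(c in J) \sum_(d in J | (c < d)%N)
     (- q) ^+ (nlt J c + nlt (J :\ c) d) *: ((r c * t d - q *: (r d * t c)) * phi (J :\ c :\ d)).
Proof.
rewrite /wedgel.
transitivity (\sum_(c in J) \sum_(d in J :\ c)
     (- q) ^+ (nlt J c + nlt (J :\ c) d) *: (r c * t d * phi (J :\ c :\ d))).
  apply: eq_bigr => c cJ; rewrite mulr_sumr scaler_sumr; apply: eq_bigr => d dJ.
  by rewrite -scalerAr scalerA exprD mulrA.
rewrite sum_pairs; apply: eq_bigr => c cJ; apply: eq_bigr => d /andP[dJ cd].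
have dJc : d \in J :\ c by rewrite !inE dJ andbT; apply: contraTneq cd => ->; rewrite ltnn.
have -> : J :\ d :\ c = J :\ c :\ d by apply/setP=> x; rewrite !inE andbCA.
have := nltD1 d cJ; rewrite cd => ->.
have := nltD1 c dJ; rewrite ltnNge (ltnW cd) add0n => <-.
rewrite add1n addSn exprS addnC mulrBl scalerBr -[in RHS]scalerAl scalerA [_ * q]mulrC.
by rewrite mulNr scaleNr.
Qed.

Lemma wedgel_self r phi : qrow r -> wedgel r (wedgel r phi) = fun=> 0.
Proof.
move=> rr; apply/funext => J; rewrite wedgel2E.
rewrite big1 // => c _; rewrite big1 // => d /andP[_ cd].
by rewrite rr // subrr mul0r scaler0.
Qed.

Lemma wedgelZ r a phi : wedgel r (fun J => a *: phi J) = fun J => a *: wedgel r phi J.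
Proof.
apply/funext => J; rewrite /wedgel scaler_sumr; apply: eq_bigr => c _.
by rewrite -scalerAr !scalerA mulrC.
Qed.

Lemma wedgel0 r : wedgel r (fun=> 0) = fun=> 0.
Proof.
by apply/funext => J; rewrite /wedgel big1 // => c _; rewrite mulr0 scaler0.
Qed.

(** With x = r_d t_c and y = r_c t_d, the relations turn t_c r_d - q t_d r_c into q^2 x - q y = -q
    (y - q x). *)
Lemma wedgel_swap r t phi : qrow2 r t ->
  wedgel t (wedgel r phi) = fun J => (- q) *: wedgel r (wedgel t phi) J.
Proof.
move=> [rt1 rt2]; apply/funext => J; rewrite !wedgel2E scaler_sumr.
apply: eq_bigr => c cJ; rewrite scaler_sumr; apply: eq_bigr => d /andP[dJ cd].
rewrite [RHS]scalerA [- q * _]mulrC -[RHS]scalerA; congr (_ *: _); rewrite [RHS]scalerAl; congr (_ * _).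
rewrite -rt1 //; have -> : t d * r c = r c * t d - (q - q^-1) *: (r d * t c) by rewrite -rt2 // subKr.
move: (r d * t c) (r c * t d) => x y; transitivity (q * q *: x - q *: y).
  rewrite scalerBr scalerA opprB addrA; congr (_ - _).
  by rewrite -{1}[x]scale1r -scalerDl; congr (_ *: _); field.
by rewrite scalerBr !scaleNr opprK scalerA addrC.
Qed.

(** This is associativity: the coefficients of [r] stay on the left and those of [t] on the right,
    so only the exponents of -q have to be compared. *)
Lemma wedgelr r t phi : wedgel r (wedger t phi) = wedger t (wedgel r phi).
Proof.
apply/funext => J; rewrite /wedgel /wedger.
transitivity (\sum_(c in J) \sum_(d in J :\ c)
     (- q) ^+ (nlt J c + ngt (J :\ c) d) *: (r c * phi (J :\ c :\ d) * t d)).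
  apply: eq_bigr => c cJ; rewrite mulr_sumr scaler_sumr; apply: eq_bigr => d dJ.
  by rewrite -scalerAr scalerA exprD mulrA.
rewrite (exchange_big_dep (mem J)) /=; last by move=> ? ? ?; rewrite inE => /andP[].
apply: eq_bigr => d dJ; rewrite mulr_suml scaler_sumr; apply: eq_big => [c|c].
  by rewrite !inE dJ andbT andbC eq_sym.
move=> /andP[cJ dJc].
have -> : J :\ d :\ c = J :\ c :\ d by apply/setP=> x; rewrite !inE andbCA.
rewrite -scalerAl scalerA -exprD; congr (_ ^+ _ *: _).
have := nltD1 c dJ; have := ngtD1 d cJ => -> ->.
by move: dJc; rewrite !inE => /andP[dc _]; lia.
Qed.

Lemma wedge0lr r : wedgel r wedge0 = wedger r wedge0.
Proof.
apply/funext => J; rewrite /wedgel /wedger; apply: eq_bigr => c cJ; rewrite /wedge0.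
case: eqP => [Jc|_]; last by rewrite mulr0 mul0r !scaler0.
have -> : nlt J c = 0%N.
  by rewrite (nltD1 _ cJ) ltnn add0n Jc; apply: eq_card0 => b; rewrite !inE.
have -> : ngt J c = 0%N.
  by rewrite (ngtD1 _ cJ) ltnn add0n Jc; apply: eq_card0 => b; rewrite !inE.
by rewrite mulr1 mul1r.
Qed.

End Wedge.

Lemma enum_split m (t : 'I_m) : exists e1 e2 : seq 'I_m,
  [/\ enum 'I_m = e1 ++ t :: e2, {in e1, forall i : 'I_m, (i < t)%N}
    & {in e2, forall i : 'I_m, (t < i)%N}].
Proof.
have [e1 [e2 eE]] : exists e1 e2, enum 'I_m = e1 ++ t :: e2.
  have tm : t \in enum 'I_m by rewrite mem_enum.
  by case/splitPr: tm => e1 e2; exists e1, e2.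
have := iota_ltn_sorted 0 m; rewrite -val_enum_ord eE map_cat /=.
rewrite (sorted_pairwise ltn_trans) pairwise_cat => /and3P[/allrelP lt1 _].
rewrite pairwise_cons => /andP[/allP lt2 _].
exists e1, e2; split=> // i ie.
  by apply: lt1; rewrite ?map_f ?inE ?eqxx.
by apply: lt2; rewrite map_f.
Qed.

Lemma enum_setE m (I : {set 'I_m}) : enum I = filter (mem I) (enum 'I_m).
Proof. by rewrite {1}enumT. Qed.

(** The lengths of the two pieces are recorded because moving row [t] across them in a product of
    rows costs one factor -q per row crossed. *)
Lemma enum_insert m (I : {set 'I_m}) (t : 'I_m) : t \notin I ->
  exists s1 s2 : seq 'I_m,
  [/\ enum I = s1 ++ s2, enum (t |: I) = s1 ++ t :: s2, {in s1, forall i : 'I_m, (i < t)%N},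
      {in s2, forall i : 'I_m, (t < i)%N} & (size s1 = nlt I t) /\ (size s2 = ngt I t)].
Proof.
move=> tI; have [e1 [e2 [eE le1 le2]]] := enum_split t.
have sub e : t \notin e -> filter (mem (t |: I)) e = filter (mem I) e.
  move=> te; apply: eq_in_filter => i ie; rewrite !inE.
  by case: eqP => // it; rewrite -it ie in te.
have t1 : t \notin e1 by apply/negP => /le1; rewrite ltnn.
have t2 : t \notin e2 by apply/negP => /le2; rewrite ltnn.
have EI : enum I = filter (mem I) e1 ++ filter (mem I) e2.
  by rewrite enum_setE eE filter_cat /= (negPf tI).
exists (filter (mem I) e1), (filter (mem I) e2); split=> //.
- by rewrite enum_setE eE filter_cat /= !sub // !inE eqxx.
- by move=> i; rewrite mem_filter => /andP[_ /le1].
- by move=> i; rewrite mem_filter => /andP[_ /le2].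
have cnt (P : pred 'I_m) : #|[set i in I | P i]| = count P (enum I).
  rewrite -sum1_card -sum1_count big_enum_cond /=.
  by apply: eq_bigl => i; rewrite !inE.
have all1 (P : pred 'I_m) e : {in e, forall i, P i} -> count P (filter (mem I) e) = size (filter (mem I) e).
  move=> Pe; apply/eqP; rewrite -all_count; apply/allP => i; rewrite mem_filter => /andP[_]; exact: Pe.
have all0 (P : pred 'I_m) e : {in e, forall i, ~~ P i} -> count P (filter (mem I) e) = 0%N.
  move=> Pe; apply/eqP; rewrite -leqn0 leqNgt -has_count; apply/hasP => -[i].
  by rewrite mem_filter => /andP[_ /Pe /negPf ->].
rewrite /nlt /ngt !cnt EI !count_cat; split.
  rewrite all1 // all0 ?addn0 // => i /le2; lia.
rewrite all0 ?add0n ?all1 // => i /le1; lia.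
Qed.

Lemma enum_mem_split m (I : {set 'I_m}) (t : 'I_m) : t \in I ->
  exists s1 s2 : seq 'I_m,
  [/\ enum (I :\ t) = s1 ++ s2, enum I = s1 ++ t :: s2, {in s1, forall i : 'I_m, (i < t)%N},
      {in s2, forall i : 'I_m, (t < i)%N} & (size s1 = nlt (I :\ t) t) /\ (size s2 = ngt (I :\ t) t)].
Proof.
move=> tI; have := @enum_insert m (I :\ t) t; rewrite setD1K // !inE eqxx; exact.
Qed.

(** * Quantum minors as products of rows *)

Section Minor.

Variables (K : fieldType) (q : K) (A : algType K) (m n : nat).
Hypothesis q0 : q != 0.
Variable X : 'M[A]_(m, n).

Definition wedges (s : seq 'I_m) : {set 'I_n} -> A :=
  foldr (fun i => wedgel q (X i)) (@wedge0 K A n) s.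

(** The coefficient of e_J in the ordered product of the rows of [I]. It replaces the sum over
    permutations, with which it agrees when #|I| = #|J| ([qminorE]). *)
Definition minor (I : {set 'I_m}) : {set 'I_n} -> A := wedges (enum I).

Hypothesis Xf : fine_qmatrix q X.

Lemma fine_qrow i : qrow q (X i).
Proof. by case: Xf => H _ _ _ c d; exact: H. Qed.

Lemma fine_qrow2 (i l : 'I_m) : (i < l)%N -> qrow2 q (X i) (X l).
Proof. by case: Xf => _ _ H1 H2 il; split=> c d cd; [exact: H1 | exact: H2]. Qed.

Lemma wedges_cat s1 s2 : wedges (s1 ++ s2) = foldr (fun i => wedgel q (X i)) (wedges s2) s1.
Proof. by rewrite /wedges foldr_cat. Qed.

Lemma foldr_wedge0 s : foldr (fun i => wedgel q (X i)) (fun=> 0) s = fun=> 0.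
Proof. by elim: s => //= i s ->; exact: wedgel0. Qed.

Lemma foldr_wedgeZ s a phi : foldr (fun i => wedgel q (X i)) (fun J => a *: phi J) s =
  fun J => a *: foldr (fun i => wedgel q (X i)) phi s J.
Proof. by elim: s => //= i s ->; exact: wedgelZ. Qed.

Lemma wedgel_past (s : seq 'I_m) (t : 'I_m) phi : {in s, forall i : 'I_m, (i < t)%N} ->
  wedgel q (X t) (foldr (fun i => wedgel q (X i)) phi s)
  = fun J => (- q) ^+ size s *: foldr (fun i => wedgel q (X i)) (wedgel q (X t) phi) s J.
Proof.
elim: s => [_|i s IH lt] /=; first by apply/funext => J; rewrite expr0 scale1r.
rewrite (wedgel_swap q0 _ (fine_qrow2 (lt i _))) ?inE ?eqxx //.
rewrite IH ?wedgelZ; last by move=> x xs; apply: lt; rewrite inE xs orbT.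
by apply/funext => J; rewrite scalerA -exprS.
Qed.

Lemma wedges_past (s : seq 'I_m) (t : 'I_m) phi : {in s, forall i : 'I_m, (t < i)%N} ->
  foldr (fun i => wedgel q (X i)) (wedgel q (X t) phi) s
  = fun J => (- q) ^+ size s *: wedgel q (X t) (foldr (fun i => wedgel q (X i)) phi s) J.
Proof.
elim: s => [_|i s IH lt] /=; first by apply/funext => J; rewrite expr0 scale1r.
rewrite IH ?wedgelZ; last by move=> x xs; apply: lt; rewrite inE xs orbT.
rewrite (wedgel_swap q0 _ (fine_qrow2 (lt i _))) ?inE ?eqxx //.
by apply/funext => J; rewrite scalerA -exprSr.
Qed.

Lemma wedger_fold s t phi :
  wedger q (X t) (foldr (fun i => wedgel q (X i)) phi s)
  = foldr (fun i => wedgel q (X i)) (wedger q (X t) phi) s.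
Proof. by elim: s => //= i s <-; rewrite wedgelr. Qed.

(** The new row is moved across the smaller rows to its place. If [t] already lies in [I], it meets
    its own copy and [wedgel_self] gives 0. *)
Lemma wedgel_minor t I :
  wedgel q (X t) (minor I)
  = fun J => if t \in I then 0 else (- q) ^+ nlt I t *: minor (t |: I) J.
Proof.
apply/funext => J; case: ifP => [|/negbT] tI.
  have [s1 [s2 [_ eI lt1 lt2 _]]] := enum_mem_split tI.
  rewrite /minor eI wedges_cat /= wedgel_past // wedgel_self; last exact: fine_qrow.
  by rewrite foldr_wedge0 scaler0.
have [s1 [s2 [eI eI' lt1 lt2 [sz _]]]] := enum_insert tI.
by rewrite /minor eI eI' !wedges_cat /= wedgel_past // sz.
Qed.

(** Left and right multiplications commute and agree on 1, so multiplying on the right by row [t]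
    inserts it as the innermost left factor; it then travels across the larger rows. *)
Lemma wedger_minor t I :
  wedger q (X t) (minor I)
  = fun J => if t \in I then 0 else (- q) ^+ ngt I t *: minor (t |: I) J.
Proof.
apply/funext => J; rewrite /minor /wedges wedger_fold -wedge0lr.
case: ifP => [|/negbT] tI.
  have [s1 [s2 [_ -> lt1 lt2 _]]] := enum_mem_split tI.
  rewrite foldr_cat /= (wedges_past _ lt2) wedgelZ wedgel_self; last exact: fine_qrow.
  by rewrite foldr_wedgeZ foldr_wedge0 !scaler0.
have [s1 [s2 [eI eI' lt1 lt2 [_ sz]]]] := enum_insert tI.
by rewrite eI eI' !foldr_cat /= (wedges_past _ lt2) foldr_wedgeZ sz.
Qed.

Lemma minor0 J : minor set0 J = (J == set0)%:R.
Proof. by rewrite /minor enum_set0. Qed.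

End Minor.

(** * Transposition and the determinant formula *)

Lemma fine_tr (K : fieldType) (q : K) (A : algType K) m n (X : 'M[A]_(m, n)) :
  fine_qmatrix q X -> fine_qmatrix q X^T.
Proof.
case=> H1 H2 H3 H4; split=> [i j k jk|i l j il|i l j k il jk|i l j k il jk].
- by rewrite !mxE H2.
- by rewrite !mxE H1.
- by rewrite !mxE (H3 j k i l).
- by rewrite !mxE H4 // (H3 j k i l).
Qed.

Lemma nlt_below m (I : {set 'I_m}) (t : 'I_m) : (forall i, i \in I -> (t <= i)%N) ->
  nlt I t = 0%N.
Proof.
by move=> tI; apply: eq_card0 => i; rewrite !inE; case: (boolP (i \in I)) => // /tI; rewrite ltnNge => ->.
Qed.

Lemma ngt_above m (I : {set 'I_m}) (t : 'I_m) : (forall i, i \in I -> (i <= t)%N) ->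
  ngt I t = 0%N.
Proof.
by move=> tI; apply: eq_card0 => i; rewrite !inE; case: (boolP (i \in I)) => // /tI; rewrite ltnNge => ->.
Qed.

Lemma nlt_above m (I : {set 'I_m}) (t : 'I_m) : (forall i, i \in I -> (i < t)%N) ->
  nlt I t = #|I|.
Proof.
by move=> tI; apply: eq_card => i; rewrite !inE; case: (boolP (i \in I)) => // /tI.
Qed.

Lemma ngt_below m (I : {set 'I_m}) (t : 'I_m) : (forall i, i \in I -> (t < i)%N) ->
  ngt I t = #|I|.
Proof.
by move=> tI; apply: eq_card => i; rewrite !inE; case: (boolP (i \in I)) => // /tI.
Qed.

Lemma setmin m (I : {set 'I_m}) : I != set0 ->
  exists2 i0, i0 \in I & forall i, i \in I -> (i0 <= i)%N.
Proof.
by case/set0Pn => i iI; case: (arg_minnP (fun i : 'I_m => i : nat) iI) => i0 ? ?; exists i0.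
Qed.

Lemma setmax m (I : {set 'I_m}) : I != set0 ->
  exists2 i0, i0 \in I & forall i, i \in I -> (i <= i0)%N.
Proof.
by case/set0Pn => i iI; case: (arg_maxnP (fun i : 'I_m => i : nat) iI) => i0 ? ?; exists i0.
Qed.

Section MinorTr.

Variables (K : fieldType) (q : K) (A : algType K).
Hypothesis q0 : q != 0.

Lemma minor_first m n (X : 'M[A]_(m, n)) (i0 : 'I_m) (I : {set 'I_m}) : fine_qmatrix q X ->
  i0 \in I -> (forall i, i \in I -> (i0 <= i)%N) ->
  minor q X I = wedgel q (X i0) (minor q X (I :\ i0)).
Proof.
move=> Xf iI le; rewrite wedgel_minor // !inE eqxx /= setD1K //; apply/funext => J.
by rewrite nlt_below ?scale1r // => i; rewrite !inE => /andP[_ /le].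
Qed.

(** Expanding along the first row and then the first column, or in the opposite order, gives the
    same double sum up to the order of [X i0 c] and [X t j0]. These two entries commute by the third
    fine relation, and the remaining minors agree by induction. *)
Lemma minor_tr m n (X : 'M[A]_(m, n)) (I : {set 'I_m}) (J : {set 'I_n}) : fine_qmatrix q X ->
  #|I| = #|J| -> minor q X I J = minor q X^T J I.
Proof.
move=> Xf; have [N] := ubnP #|I|; elim: N I J => // N IH I J leN cIJ.
have [I0|I0] := eqVneq I set0.
  by move: cIJ; rewrite I0 cards0 => /esym/eqP; rewrite cards_eq0 => /eqP ->; rewrite !minor0 !eqxx.
have J0 : J != set0 by rewrite -card_gt0 -cIJ card_gt0.
have [i0 i0I i0le] := setmin I0.
have [j0 j0J j0le] := setmin J0.
have lt0 t : t \in I -> t != i0 -> (i0 < t)%N.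
  by move=> tI ne; rewrite ltn_neqAle i0le // andbT eq_sym.
have lt0' t : t \in J -> t != j0 -> (j0 < t)%N.
  by move=> tI ne; rewrite ltn_neqAle j0le // andbT eq_sym.
have cD p (S : {set 'I_p}) x : x \in S -> #|S :\ x| = #|S|.-1.
  by move=> xS; rewrite (cardsD1 x S) xS.
have I1 : (#|I|.-1 < N)%N by rewrite prednK ?card_gt0.
rewrite (minor_first Xf i0I i0le) (minor_first (fine_tr Xf) j0J j0le) /wedgel.
rewrite (bigD1 j0) // [RHS](bigD1 i0) //=; congr (_ + _).
  by rewrite !nlt_below // !expr0 !scale1r mxE IH // ?cD ?cIJ // -cIJ.
have nlt1 p (S : {set 'I_p}) (x t : 'I_p) : x \in S -> (x < t)%N -> nlt S t = (nlt (S :\ x) t).+1.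
  by move=> xS xt; rewrite (nltD1 _ xS) xt.
transitivity (\sum_(c in J | c != j0) \sum_(t in I | t != i0)
   (- q) ^+ (nlt J c + nlt (I :\ i0) t) *:
     (X i0 c * X t j0 * minor q X (I :\ i0 :\ t) (J :\ j0 :\ c))).
  apply: eq_bigr => c /andP[cJ' cj0].
  rewrite IH ?cD ?cIJ // -?cIJ // (@minor_first _ _ _ j0 _ (fine_tr Xf)); first last.
  - by move=> i; rewrite inE => /andP[_ /j0le].
  - by rewrite !inE eq_sym cj0.
  rewrite /wedgel mulr_sumr scaler_sumr; apply: eq_big => [t|t].
    by rewrite !inE andbC.
  rewrite !inE => /andP[ti0 tI].
  have -> : J :\ c :\ j0 = J :\ j0 :\ c by apply/setP=> x; rewrite !inE andbCA.
  have tI' : t \in I :\ i0 by rewrite !inE ti0.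
  have cJ'' : c \in J :\ j0 by rewrite !inE cj0.
  have e1 : #|I :\ i0 :\ t| = #|I|.-2 by rewrite !cD.
  have e2 : #|J :\ j0 :\ c| = #|I|.-2 by rewrite !cD // cIJ.
  rewrite -(IH (I :\ i0 :\ t)) ?mxE ?e1 ?e2 //; last by rewrite (leq_ltn_trans (leq_pred _)).
  by rewrite -scalerAr scalerA exprD mulrA.
rewrite exchange_big /=; apply: eq_bigr => t /andP[tI ti0].
rewrite -(IH (I :\ t)) ?cD ?I1 // -?cIJ // (@minor_first _ _ _ i0 (I :\ t) Xf); first last.
- by move=> i; rewrite inE => /andP[_ /i0le].
- by rewrite !inE eq_sym ti0.
rewrite /wedgel mulr_sumr scaler_sumr; apply: eq_big => [c|c].
  by rewrite !inE andbC.
move=> /andP[cJ' cj0].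
have -> : I :\ t :\ i0 = I :\ i0 :\ t by apply/setP=> x; rewrite !inE andbCA.
rewrite -scalerAr scalerA -exprD mulrA !mxE (nlt1 _ J j0) ?(nlt1 _ I i0) ?lt0 ?lt0' //.
rewrite addSn addnC -addSn; congr (_ *: (_ * _)).
by case: Xf => _ _ H3 _; rewrite H3 // ?lt0 ?lt0'.
Qed.

End MinorTr.

(** * Expansion of the permutation sum along its first row *)

Lemma lift_perm0_bij k :
  bijective (fun p : 'I_k.+1 * 'S_k => lift_perm ord0 p.1 p.2).
Proof.
apply: inj_card_bij; last by rewrite card_prod !card_Sn card_ord factS.
move=> [c s] [d t] /= e; have cd : c = d by rewrite -(lift_perm_id ord0 c s) e lift_perm_id.
rewrite -{}cd in e *; congr (_, _); apply/permP => x; apply: (@lift_inj _ c).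
by rewrite -!(lift_perm_lift ord0) e.
Qed.

Lemma inversionsE k (s : 'S_k) :
  inversions s = (\sum_(u < k) \sum_(v < k) ((u < v) && (s v < s u)))%N.
Proof.
rewrite /inversions -sum1dep_card pair_big_dep big_mkcond /=.
by apply: eq_bigr => u _; case: (_ && _).
Qed.

Lemma sum_ltn_ord k (c : nat) : (c <= k)%N -> (\sum_(v < k) (v < c))%N = c.
Proof.
move=> ck; rewrite (eq_bigr (fun v : 'I_k => if (v < c)%N then 1%N else 0%N)); last by move=> v _; case: ltnP.
by rewrite -big_mkcond /= -(big_ord_widen k (fun=> 1%N) ck) sum_nat_const card_ord muln1.
Qed.

(** The [c] additional inversions pair position 0 with the positions whose image is less than
    [c]. *)
Lemma inversions_lift0 k (c : 'I_k.+1) (s : 'S_k) :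
  inversions (lift_perm ord0 c s) = (c + inversions s)%N.
Proof.
rewrite !inversionsE big_ord_recl big_ord_recl /= add0n; congr addn.
  rewrite -[RHS](@sum_ltn_ord k c) -1?ltnS // [RHS](reindex_inj (@perm_inj _ s)) /=.
  apply: eq_bigr => v _; rewrite lift_perm_lift lift_perm_id /= /bump.
  by case: (leqP c (s v)); lia.
apply: eq_bigr => u _; rewrite big_ord_recl /= add0n; apply: eq_bigr => v _.
rewrite !lift_perm_lift /= /bump !add1n ltnS; congr (nat_of_bool (_ && _)).
by case: leqP; case: leqP; lia.
Qed.

Section QDet.

Variables (K : fieldType) (q : K) (A : algType K).

Lemma qdet_row0 k (X : 'M[A]_k.+1) :
  qdet q X = \sum_(c < k.+1) (- q) ^+ c *: (X ord0 c * qdet q (row' ord0 (col' c X))).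
Proof.
rewrite /qdet (reindex _ (onW_bij _ (lift_perm0_bij k))) /=.
rewrite -(pair_bigA _ (fun c s => (- q) ^+ inversions (lift_perm ord0 c s) *:
  \prod_r X r (lift_perm ord0 c s r))) /=; apply: eq_bigr => c _.
rewrite mulr_sumr scaler_sumr; apply: eq_bigr => s _.
rewrite inversions_lift0 exprD -scalerA -scalerAr big_ord_recl lift_perm_id.
congr (_ *: (_ *: (_ * _))); apply: eq_bigr => r _.
by rewrite lift_perm_lift !mxE.
Qed.

Variables (m n : nat) (X : 'M[A]_(m, n)).

(** Since [b] is increasing, exactly [c] columns precede the c-th one, so the exponent in
    [qdet_row0] is the [nlt] of the exterior product. *)
Lemma qdet_wedges k (a : 'I_k -> 'I_m) (b : 'I_k -> 'I_n) :
  {mono b : i j / (i < j)%N} ->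
  qdet q (mxsub a b X) = wedges q X (map a (enum 'I_k)) [set b j | j : 'I_k].
Proof.
elim: k a b => [|k IH] a b bm.
  rewrite enum_ord0 /= /wedge0 (_ : _ == _); last first.
    by apply/eqP/setP => x; rewrite !inE; apply/imsetP => -[[]].
  rewrite /qdet (big_pred1 (1%g : 'S_0)) ?big_ord0.
    rewrite inversionsE big_ord0 expr0 scale1r //.
  by move=> s; apply/esym/eqP/permP => -[].
have binj : injective b.
  move=> i j e; apply: val_inj; case: (ltngtP i j) => //=.
    by rewrite -bm e ltnn.
  by rewrite -bm e ltnn.
rewrite qdet_row0 enum_ordSl /= /wedgel big_imset /=; last by move=> ? ? _ _; exact: binj.
apply: eq_bigr => c _; rewrite mxE; congr (_ ^+ _ *: (_ * _)).
  rewrite /nlt -[LHS](@sum_ltn_ord k.+1) 1?ltnW //.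
  rewrite -sum1dep_card big_mkcondr /= big_imset /=; last by move=> ? ? _ _; exact: binj.
  by apply: eq_bigr => d _; rewrite bm; case: ltnP.
have -> : row' ord0 (col' c (mxsub a b X)) = mxsub (a \o lift ord0) (b \o lift c) X.
  by apply/matrixP => i j; rewrite !mxE.
rewrite IH; last first.
  move=> i j /=; rewrite bm /= /bump; case: leqP; case: leqP; lia.
rewrite -map_comp; congr (wedges _ _ _ _); apply/setP => x; rewrite !inE.
apply/imsetP/andP => [[j _ ->]|[xc /imsetP[j _ xE]]].
  split; last exact: imset_f.
  by rewrite /= (inj_eq binj) eq_sym neq_lift.
have : j != c by apply: contraNneq xc => <-; rewrite xE.
by rewrite eq_sym => /unlift_some[j' jE _]; exists j'; rewrite // xE /= jE.
Qed.

Lemma enum_val_mono p (J : {set 'I_p}) : {mono @enum_val _ (mem J) : i j / (i < j)%N}.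
Proof.
have homo (i j : 'I_#|mem J|) : (i < j)%N -> (@enum_val _ (mem J) i < @enum_val _ (mem J) j)%N.
  move=> ij; have x0 := enum_val i; rewrite !(enum_val_nth x0).
  have srt : sorted (relpre val ltn) (enum J).
    rewrite -sorted_map enum_setE sorted_map; apply: sorted_filter.
      by move=> ? ? ?; apply: ltn_trans.
    by rewrite -sorted_map val_enum_ord iota_ltn_sorted.
  apply: (sorted_ltn_nth _ _ srt) => //; rewrite ?inE -?cardE //.
  by move=> ? ? ?; apply: ltn_trans.
move=> i j; apply/idP/idP; last exact: homo.
by apply: contraTT; rewrite -!leqNgt leq_eqVlt => /predU1P[/val_inj ->//|/homo/ltnW].
Qed.

Lemma map_enum_val p (I : {set 'I_p}) : map (@enum_val _ (mem I)) (enum 'I_#|I|) = enum I.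
Proof.
case eI : (enum I) => [|x0 s]; last rewrite -eI.
  by apply: size0nil; rewrite size_map size_enum_ord cardE eI.
apply: (@eq_from_nth _ x0) => [|i]; rewrite size_map size_enum_ord -?cardE // => ilt.
by rewrite (nth_map (Ordinal ilt)) ?size_enum_ord // (enum_val_nth x0) nth_enum_ord.
Qed.

Lemma qminorE (I : {set 'I_m}) (J : {set 'I_n}) : #|I| = #|J| ->
  qminor q X I J = minor q X I J.
Proof.
move=> cIJ; rewrite /qminor.
(* The common cardinality is abstracted to [k], so that substituting it removes the casts hidden in
   [conform_mx]. *)
have [k [kI [b [bm [bJ mE]]]]] : exists k (kI : k = #|I|) (b : 'I_k -> 'I_n),
  {mono b : i j / (i < j)%N} /\ [set b j | j : 'I_k] = J /\
  conform_mx (0 : 'M[A]_#|I|) (mxsub (@enum_val _ (mem I)) (@enum_val _ (mem J)) X)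
   = castmx (kI, kI) (mxsub (fun i => @enum_val _ (mem I) (cast_ord kI i)) b X).
  exists #|I|, erefl, (fun i => @enum_val _ (mem J) (cast_ord cIJ i)); split.
    by move=> i j; rewrite enum_val_mono.
  split.
    apply/setP=> x; apply/imsetP/idP => [[j _ ->]|xJ]; first exact: enum_valP.
    exists (cast_ord (esym cIJ) (enum_rank_in xJ x)) => //.
    by rewrite cast_ordKV enum_rankK_in.
  rewrite castmx_id /conform_mx; case: (#|I| =P #|I|) => // e1; case: eqP => [e2|]; last by case; rewrite -cIJ.
  apply/matrixP => i j; rewrite castmxE !mxE; congr (X _ _).
    by congr enum_val; apply/val_inj.
  by congr enum_val; apply/val_inj.
subst k; rewrite mE castmx_id qdet_wedges // bJ /minor; congr (wedges _ _ _ _).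
by rewrite -[RHS]map_enum_val; apply: eq_map => i; rewrite cast_ord_id.
Qed.

End QDet.

(** * Relations between minors *)

Lemma nltU1 n (J : {set 'I_n}) c d : c \notin J ->
  nlt (c |: J) d = ((c < d) + nlt J d)%N.
Proof. by move=> cJ; rewrite (@nltD1 _ _ c) ?setU1K // !inE eqxx. Qed.

Lemma ngtU1 n (J : {set 'I_n}) c d : c \notin J ->
  ngt (c |: J) d = ((d < c) + ngt J d)%N.
Proof. by move=> cJ; rewrite (@ngtD1 _ _ c) ?setU1K // !inE eqxx. Qed.

Lemma nlt_ngt n (J : {set 'I_n}) c : c \notin J -> (nlt J c + ngt J c)%N = #|J|.
Proof.
move=> cJ; rewrite -(cardsID [set b : 'I_n | (b < c)%N] J) /nlt /ngt; congr addn; apply: eq_card => b.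
  by rewrite !inE.
rewrite !inE; case: (boolP (b \in J)) => bJ; rewrite ?andbF ?andbT //=.
have : b != c by apply: contraNneq cJ => <-.
by rewrite -val_eqE /=; lia.
Qed.

Section Laplace.

Variables (K : fieldType) (q : K) (A : algType K) (m n : nat).
Hypothesis q0 : q != 0.
Variable X : 'M[A]_(m, n).
Hypothesis Xf : fine_qmatrix q X.

Local Notation M := (minor q X).
Implicit Types (I S R : {set 'I_m}) (J C L : {set 'I_n}).

Lemma laplace_rowl (t : 'I_m) S J :
  \sum_(c in J) (- q) ^+ nlt J c *: (X t c * M S (J :\ c))
  = if t \in S then 0 else (- q) ^+ nlt S t *: M (t |: S) J.
Proof. by have /(congr1 (@^~ J)) := wedgel_minor q0 Xf t S. Qed.

Lemma laplace_rowr (t : 'I_m) S J :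
  \sum_(c in J) (- q) ^+ ngt J c *: (M S (J :\ c) * X t c)
  = if t \in S then 0 else (- q) ^+ ngt S t *: M (t |: S) J.
Proof. by have /(congr1 (@^~ J)) := wedger_minor q0 Xf t S. Qed.

End Laplace.

Section Relations.

Variables (K : fieldType) (q : K) (A : algType K) (m n : nat).
Hypothesis q0 : q != 0.
Variable X : 'M[A]_(m, n).
Hypothesis Xf : fine_qmatrix q X.

Local Notation M := (minor q X).
Implicit Types (I S R : {set 'I_m}) (J C L : {set 'I_n}).

Lemma laplace_coll (c : 'I_n) L I : #|I| = #|L|.+1 ->
  \sum_(t in I) (- q) ^+ nlt I t *: (X t c * M (I :\ t) L)
  = if c \in L then 0 else (- q) ^+ nlt L c *: M I (c |: L).
Proof.
move=> cIL; have := laplace_rowl q0 (fine_tr Xf) c L I.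
rewrite (eq_bigr (fun t => (- q) ^+ nlt I t *: (X t c * M (I :\ t) L))).
  by move=> ->; case: ifP => // /negbT cL; rewrite -minor_tr // cardsU1 cL.
move=> t tI; rewrite mxE -minor_tr //.
by apply/eqP; rewrite -eqSS -cIL (cardsD1 t I) tI.
Qed.

Lemma laplace_colr (c : 'I_n) L I : #|I| = #|L|.+1 ->
  \sum_(t in I) (- q) ^+ ngt I t *: (M (I :\ t) L * X t c)
  = if c \in L then 0 else (- q) ^+ ngt L c *: M I (c |: L).
Proof.
move=> cIL; have := laplace_rowr q0 (fine_tr Xf) c L I.
rewrite (eq_bigr (fun t => (- q) ^+ ngt I t *: (M (I :\ t) L * X t c))).
  by move=> ->; case: ifP => // /negbT cL; rewrite -minor_tr // cardsU1 cL.
move=> t tI; rewrite mxE -minor_tr //.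
by apply/eqP; rewrite -eqSS -cIL (cardsD1 t I) tI.
Qed.

(** Both sides evaluate the sum over [t] and [c] of M(R - t | L) x_tc M(S | C - c): attaching the
    entry to the right factor is a row expansion, attaching it to the left factor is a column
    expansion. *)
Lemma plucker_r R L S C : #|R| = #|L|.+1 ->
  \sum_(t in R) (- q) ^+ ngt R t *:
     (M (R :\ t) L * (if t \in S then 0 else (- q) ^+ nlt S t *: M (t |: S) C))
  = \sum_(c in C) (- q) ^+ nlt C c *:
     ((if c \in L then 0 else (- q) ^+ ngt L c *: M R (c |: L)) * M S (C :\ c)).
Proof.
move=> cRL.
transitivity (\sum_(t in R) \sum_(c in C)
   (- q) ^+ (ngt R t + nlt C c) *: (M (R :\ t) L * X t c * M S (C :\ c))).
  apply: eq_bigr => t tR; rewrite -(laplace_rowl q0 Xf) mulr_sumr scaler_sumr.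
  by apply: eq_bigr => c _; rewrite -scalerAr scalerA exprD mulrA.
rewrite exchange_big; apply: eq_bigr => c cC; rewrite -laplace_colr // mulr_suml scaler_sumr.
by apply: eq_bigr => t _; rewrite -scalerAl scalerA -exprD addnC.
Qed.

Lemma plucker_l R L S C : #|R| = #|L|.+1 ->
  \sum_(t in R) (- q) ^+ nlt R t *:
     ((if t \in S then 0 else (- q) ^+ ngt S t *: M (t |: S) C) * M (R :\ t) L)
  = \sum_(c in C) (- q) ^+ ngt C c *:
     (M S (C :\ c) * (if c \in L then 0 else (- q) ^+ nlt L c *: M R (c |: L))).
Proof.
move=> cRL.
transitivity (\sum_(t in R) \sum_(c in C)
   (- q) ^+ (nlt R t + ngt C c) *: (M S (C :\ c) * X t c * M (R :\ t) L)).
  apply: eq_bigr => t tR; rewrite -(laplace_rowr q0 Xf) mulr_suml scaler_sumr.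
  by apply: eq_bigr => c _; rewrite -scalerAl scalerA exprD.
rewrite exchange_big; apply: eq_bigr => c cC; rewrite -laplace_coll // mulr_sumr scaler_sumr.
by apply: eq_bigr => t _; rewrite -scalerAr scalerA -exprD addnC mulrA.
Qed.

(** The matrix of signed cofactors of [(S|C)] is a two-sided inverse of the
    submatrix up to the factor [M S C]; this moves [M S C] across the row [i]. *)
Lemma entry_minor (i : 'I_m) (c : 'I_n) S C : #|S| = #|C| -> c \in C ->
  (- q) ^+ #|C|.-1 *: (X i c * M S C)
  = \sum_(r in S) (- q) ^+ ngt S r *:
      ((if i \in S :\ r then 0 else (- q) ^+ nlt (S :\ r) i *: M (i |: (S :\ r)) C) * X r c).
Proof.
move=> cSC cC; transitivity (\sum_(r in S) \sum_(d in C)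
   (- q) ^+ (ngt S r + nlt C d) *: (X i d * M (S :\ r) (C :\ d) * X r c)); last first.
  apply: eq_bigr => r rS; rewrite -(laplace_rowl q0 Xf) mulr_suml scaler_sumr.
  by apply: eq_bigr => d _; rewrite -scalerAl scalerA exprD.
rewrite exchange_big /=.
have cD (d : 'I_n) : d \in C -> #|S| = #|C :\ d|.+1 by rewrite cSC (cardsD1 d C) => ->.
transitivity (\sum_(d in C) (- q) ^+ nlt C d *: (X i d *
    (if c \in C :\ d then 0 else (- q) ^+ ngt (C :\ d) c *: M S (c |: (C :\ d))))); last first.
  apply: eq_bigr => d dC; rewrite -(laplace_colr c (cD d dC)) mulr_sumr scaler_sumr.
  by apply: eq_bigr => r _; rewrite -scalerAr scalerA -exprD addnC mulrA.
rewrite (bigD1 c) //= !inE eqxx /= big1 => [|d /andP[dC dc]]; last first.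
  by rewrite !inE cC eq_sym dc mulr0 scaler0.
rewrite addr0 -scalerAr scalerA -exprD setD1K //; congr (_ ^+ _ *: _).
have := @nlt_ngt _ (C :\ c) c; rewrite !inE eqxx => /(_ isT).
by rewrite (@nltD1 _ C c c) // ltnn add0n => ->; rewrite (cardsD1 c C) cC.
Qed.

Lemma expq_neq0 k : (- q) ^+ k != 0.
Proof. by rewrite expf_neq0 // oppr_eq0. Qed.

Lemma entry_minor_in (i : 'I_m) (c : 'I_n) S C : #|S| = #|C| -> c \in C -> i \in S ->
  X i c * M S C = M S C * X i c.
Proof.
move=> cSC cC iS; apply: (scalerI (expq_neq0 #|C|.-1)); rewrite entry_minor //.
rewrite (bigD1 i) //= !inE eqxx /= big1 => [|r /andP[rS ri]]; last first.
  by rewrite !inE iS eq_sym ri mul0r scaler0.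
rewrite addr0 -scalerAl scalerA -exprD setD1K // (ngtD1 i iS) ltnn add0n addnC nlt_ngt ?inE ?eqxx //.
by rewrite -cSC (cardsD1 i S) iS.
Qed.

(** Column [c] already occurs in [C], so the expansion of the rows [i |: S] along it vanishes; the
    identity isolates its term for row [i]. *)
Lemma entry_minor_out (i : 'I_m) (c : 'I_n) S C : #|S| = #|C| -> c \in C -> i \notin S ->
  \sum_(r in S) (- q) ^+ ngt (i |: S) r *: (M (i |: (S :\ r)) C * X r c)
  = - ((- q) ^+ ngt S i *: (M S C * X i c)).
Proof.
move=> cSC cC iS; have := @laplace_colr c C (i |: S); rewrite cardsU1 iS cSC cC => /(_ erefl).
rewrite big_setU1 //= setU1K // ngtU1 // ltnn add0n addrC => /eqP.
rewrite addr_eq0 => /eqP <-; apply: eq_bigr => r rS; congr (_ *: (M _ _ * _)).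
apply/setP => x; rewrite !inE; case: (x =P i) => [->|]; rewrite ?orbF //=.
by rewrite andbT; apply/esym; apply: contraNneq iS => ->.
Qed.

(** When [i] precedes all of [S], the signs in [entry_minor] become those of [entry_minor_out], and
    the whole sum collapses to one product. The same happens in [entry_minor_below], up to a
    constant factor. *)
Lemma entry_minor_above (i : 'I_m) (c : 'I_n) S C : #|S| = #|C| -> c \in C ->
  (forall a, a \in S -> (i < a)%N) ->
  X i c * M S C = q *: (M S C * X i c).
Proof.
move=> cSC cC iS; have iNS : i \notin S by apply/negP => /iS; rewrite ltnn.
apply: (scalerI (expq_neq0 #|C|.-1)); rewrite entry_minor //.
transitivity (- ((- q) ^+ ngt S i *: (M S C * X i c))).
  rewrite -entry_minor_out //; apply: eq_bigr => r rS.
  rewrite ngtU1 // ltnNge (ltnW (iS _ rS)) add0n !inE (negPf iNS) andbF.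
  by rewrite nlt_below ?scale1r // => a; rewrite !inE => /andP[_ /iS/ltnW].
have [p pE] : exists p, #|C| = p.+1 by exists #|C|.-1; rewrite (cardsD1 c C) cC.
by rewrite ngt_below // cSC pE /= scalerA -scaleNr exprS; congr (_ *: _); ring.
Qed.

Lemma entry_minor_below (i : 'I_m) (c : 'I_n) S C : #|S| = #|C| -> c \in C ->
  (forall a, a \in S -> (a < i)%N) ->
  X i c * M S C = q^-1 *: (M S C * X i c).
Proof.
move=> cSC cC iS; have iNS : i \notin S by apply/negP => /iS; rewrite ltnn.
apply: (scalerI (expq_neq0 #|C|.-1)); rewrite entry_minor //.
transitivity (((- q) ^+ #|C|.-1 * (- q)^-1) *: (- ((- q) ^+ ngt S i *: (M S C * X i c)))).
  rewrite -entry_minor_out // scaler_sumr; apply: eq_bigr => r rS.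
  rewrite ngtU1 // iS // !inE (negPf iNS) andbF nlt_above => [|a]; last first.
    by rewrite !inE => /andP[_ /iS].
  rewrite -scalerAl !scalerA; congr (_ *: _).
  have -> : #|S :\ r| = #|C|.-1 by rewrite -cSC (cardsD1 r S) rS.
  rewrite add1n exprS; have : - q != 0 by rewrite oppr_eq0.
  by move: (- q) (_ ^+ _) (_ ^+ _) => p x y p0; field.
rewrite ngt_above => [|a /iS/ltnW //]; rewrite expr0 scale1r scalerN -scaleNr scalerA; congr (_ *: _).
by rewrite invrN mulrN opprK.
Qed.

(** A quantum determinant commutes with the entries of its own submatrix ([entry_minor_in]), hence
    with products of its rows. *)
Lemma minor_comm_in s S C J : #|S| = #|C| -> {subset s <= S} -> J \subset C ->
  wedges q X s J * M S C = M S C * wedges q X s J.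
Proof.
move=> cSC; elim: s J => [|i s IH] J sS JC /=.
  by rewrite /wedge0; case: eqP => _; rewrite ?mul1r ?mulr1 ?mul0r ?mulr0.
rewrite /wedgel mulr_suml mulr_sumr; apply: eq_bigr => c cJ.
rewrite -scalerAl -scalerAr; congr (_ *: _).
have iS : i \in S by apply: sS; rewrite inE eqxx.
rewrite -mulrA IH; first last.
- by apply: subset_trans JC; rewrite subD1set.
- by move=> x xs; apply: sS; rewrite inE xs orbT.
by rewrite !mulrA entry_minor_in // (subsetP JC).
Qed.

(** Expand along row [t]: all other entries lie inside S x C and commute with [M S C], so the factor
    [e] comes from row [t] alone. *)
Lemma minor_qcomm (e : K) (t : 'I_m) I S J C : #|S| = #|C| -> I \subset S -> J \subset C ->
  t \notin I -> (forall c, c \in C -> X t c * M S C = e *: (M S C * X t c)) ->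
  M (t |: I) J * M S C = e *: (M S C * M (t |: I) J).
Proof.
move=> cSC IS JC tI tC; apply: (scalerI (expq_neq0 (nlt I t))).
have := laplace_rowl q0 Xf t I J; rewrite (negPf tI) => E.
rewrite scalerAl -E [in RHS]scalerA mulrC -scalerA scalerAr -E.
rewrite mulr_suml mulr_sumr scaler_sumr; apply: eq_bigr => c cJ.
rewrite -scalerAl -scalerAr scalerA mulrC -scalerA; congr (_ *: _).
rewrite -mulrA minor_comm_in //; first last.
- by apply: subset_trans JC; rewrite subD1set.
- by move=> x; rewrite mem_enum; apply: (subsetP IS).
by rewrite mulrA tC ?(subsetP JC) // -scalerAl mulrA.
Qed.

(** The instance of (P) in which [i] and [k] are the extreme rows. *)
Lemma minor_P S J (i j k : 'I_m) (l : 'I_n) :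
  (forall a, a \in S -> (i < a < k)%N) -> j \notin S -> (i < j < k)%N -> l \notin J ->
  #|S|.+1 = #|J| ->
  M (j |: S) J * M (i |: (k |: S)) (l |: J)
  = M (i |: (j |: S)) (l |: J) * M (k |: S) J
  + M (j |: (k |: S)) (l |: J) * M (i |: S) J.
Proof.
move=> ikS jS /andP[ij jk] lJ cSJ; have ik := ltn_trans ij jk.
have iS : i \notin S by apply/negP => /ikS; rewrite ltnn.
have kS : k \notin S by apply/negP => /ikS; rewrite ltnn andbF.
have neq (x y : 'I_m) : (x < y)%N -> (x == y = false) * (y == x = false).
  by move=> xy; split; apply: contraTF xy => /eqP ->; rewrite ltnn.
set C := l |: J; have cC : #|C| = #|S|.+2 by rewrite cardsU1 lJ cSJ.
have jkS : j \notin k |: S by rewrite !inE (negPf jS) (neq j k).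
have ijkS : i \notin j |: (k |: S) by rewrite !inE (negPf iS) !(neq i _).
have cR : #|i |: (j |: (k |: S))| = #|C|.+1 by rewrite cC !cardsU1 ijkS jkS kS.
(* Every column of [J] lies in [C], so the column side vanishes; on the row side the rows of [S] are
   repeated, and only [i], [j], [k] remain. *)
have := plucker_l S J cR; rewrite [RHS]big1 => [|c cJ]; last first.
  by rewrite !inE cJ orbT mulr0 scaler0.
rewrite !big_setU1 //= (negPf iS) (negPf jS) (negPf kS) [X in _ + (_ + (_ + X))]big1 => [|t tS]; last first.
  by rewrite tS mul0r scaler0.
have RI : (i |: (j |: (k |: S))) :\ i = j |: (k |: S) by rewrite setU1K.
have RJ : (i |: (j |: (k |: S))) :\ j = i |: (k |: S).
  by rewrite setUCA setU1K // !inE (negPf jS) !(neq i j) // (neq j k).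
have RK : (i |: (j |: (k |: S))) :\ k = i |: (j |: S).
  by rewrite [j |: _]setUCA setUCA setU1K // !inE (negPf kS) !(neq i k) // (neq j k).
rewrite RI RJ RK addr0.
have S1 a : a \in S -> (i < a)%N by case/ikS/andP.
have S2 a : a \in S -> (a < k)%N by case/ikS/andP.
have nI : nlt (i |: (j |: (k |: S))) i = 0%N.
  by rewrite nlt_below // => a; rewrite !inE => /or4P[/eqP->|/eqP->|/eqP->|/S1] //; apply: ltnW.
have nJ : nlt (i |: (j |: (k |: S))) j = (nlt S j).+1.
  by rewrite !nltU1 // ij ltnn [(k < j)%N]ltnNge (ltnW jk).
have nK : nlt (i |: (j |: (k |: S))) k = #|S|.+2.
  by rewrite !nltU1 // ik ltnn jk (nlt_above S2).
rewrite nI nJ nK ngt_below // (ngt_above (t := k)) => [|a /S2/ltnW //].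
rewrite expr0 scale1r -!scalerAl !scalerA mulr1 -exprD addSn nlt_ngt // !exprS !mulNr.
(* In the terms of [i] and [k] the small minor stands first, opposite to (P). Row [i] precedes all
   rows of its large minor and row [k] follows all rows of its own, so reversing the products costs
   [q] and [q^-1]. *)
rewrite (@minor_qcomm q i S (j |: (k |: S)) J C); first last.
- move=> c cC'; apply: entry_minor_above => [| |a] //.
    by rewrite !cardsU1 jkS kS lJ -cSJ.
  by rewrite !inE => /or3P[/eqP->|/eqP->|/S1].
- exact: iS.
- by apply/subsetP => x xJ; rewrite !inE xJ orbT.
- by apply/subsetP => x xS; rewrite !inE xS !orbT.
- by rewrite !cardsU1 jkS kS lJ -cSJ.
rewrite (@minor_qcomm q^-1 k S (i |: (j |: S)) J C); first last.
- move=> c cC'; apply: entry_minor_below => [| |a] //.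
    by rewrite !cardsU1 !inE (negPf iS) (neq i j) // jS lJ -cSJ.
  by rewrite !inE => /or3P[/eqP->|/eqP->|/S2].
- exact: kS.
- by apply/subsetP => x xJ; rewrite !inE xJ orbT.
- by apply/subsetP => x xS; rewrite !inE xS !orbT.
- by rewrite !cardsU1 !inE (negPf iS) (neq i j) // jS lJ -cSJ.
have p0 := expq_neq0 #|S|; rewrite -/C.
set u := M (j |: (k |: S)) C * M (i |: S) J; set v := M (j |: S) J * _.
set w := M (i |: (j |: S)) C * M (k |: S) J => /eqP E.
apply: (scalerI (_ : q * (- q) ^+ #|S| != 0)); first by rewrite mulf_neq0.
move: E; rewrite addrCA scaleNr addrC subr_eq0 => /eqP <-; rewrite !scalerA scalerDr addrC.
by congr (_ *: _ + _ *: _); field.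
Qed.

(** (D) up to the order of the factors in the product with coefficient [q];
    (D) itself is the transpose of this identity. *)
Lemma minor_dodgson_swap S J (i k : 'I_m) (j l : 'I_n) :
  (forall a, a \in S -> (i < a < k)%N) -> (i < k)%N ->
  (forall b, b \in J -> (j < b < l)%N) -> (j < l)%N -> #|S| = #|J| ->
  M (i |: S) (j |: J) * M (k |: S) (l |: J) - q *: (M (k |: S) (j |: J) * M (i |: S) (l |: J))
  = M (i |: (k |: S)) (j |: (l |: J)) * M S J.
Proof.
move=> ikS ik jlJ jl cSJ.
have S1 a : a \in S -> (i < a)%N by case/ikS/andP.
have S2 a : a \in S -> (a < k)%N by case/ikS/andP.
have J1 a : a \in J -> (j < a)%N by case/jlJ/andP.
have J2 a : a \in J -> (a < l)%N by case/jlJ/andP.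
have iS : i \notin S by apply/negP => /S1; rewrite ltnn.
have kS : k \notin S by apply/negP => /S2; rewrite ltnn.
have jJ : j \notin J by apply/negP => /J1; rewrite ltnn.
have lJ : l \notin J by apply/negP => /J2; rewrite ltnn.
have ik' : (i == k) = false by apply: contraTF ik => /eqP ->; rewrite ltnn.
have jl' : (j == l) = false by apply: contraTF jl => /eqP ->; rewrite ltnn.
have ikS' : i \notin k |: S by rewrite !inE ik' iS.
have cR : #|i |: (k |: S)| = #|j |: J|.+1 by rewrite !cardsU1 ikS' kS jJ cSJ.
(* Repeated rows and columns vanish: the rows [i] and [k] remain on one side, the column [l] on the
   other. *)
have := plucker_r S (l |: J) cR.
rewrite !big_setU1 //= (negPf iS) (negPf kS) [X in _ + (_ + X) = _]big1 => [|t tS]; last first.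
  by rewrite tS mulr0 scaler0.
rewrite [X in _ = _ + X]big1 => [|c cJ]; last by rewrite !inE cJ orbT mul0r scaler0.
rewrite !inE (negPf lJ) [l == j]eq_sym jl' /= !addr0 setU1K //.
have -> : (i |: (k |: S)) :\ k = i |: S.
  by rewrite setUCA setU1K // !inE eq_sym ik' kS.
rewrite setU1K // !ngtU1 // ik ltnn [(k < i)%N]ltnNge (ltnW ik) !add0n.
rewrite nltU1 // !ltnn [(l < j)%N]ltnNge (ltnW jl) !add0n (nlt_above J2) (nlt_above S2).
rewrite (ngt_below S1) nlt_below => [|a /S1/ltnW //].
rewrite (ngt_above (t := k)) => [|a /S2/ltnW //]; rewrite (ngt_above (t := l)) => [|a /J2/ltnW //].
rewrite expr0 !scale1r add1n exprS -cSJ [l |: (_ |: _)]setUCA -scalerAr -[- q * _]mulrC -scalerA -scalerDr.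
by move/(scalerI (expq_neq0 _)) <-; rewrite scaleNr addrC.
Qed.

End Relations.

Section Transposed.

Variables (K : fieldType) (q : K) (A : algType K) (m n : nat).
Hypothesis q0 : q != 0.
Variable X : 'M[A]_(m, n).
Hypothesis Xf : fine_qmatrix q X.

Local Notation M := (minor q X).
Implicit Types (S : {set 'I_m}) (J : {set 'I_n}).

Lemma minor_Pstar S J (i j k : 'I_n) (l : 'I_m) :
  (forall a, a \in J -> (i < a < k)%N) -> j \notin J -> (i < j < k)%N -> l \notin S ->
  #|S| = #|J|.+1 ->
  M S (j |: J) * M (l |: S) (i |: (k |: J))
  = M (l |: S) (i |: (j |: J)) * M S (k |: J)
  + M (l |: S) (j |: (k |: J)) * M S (i |: J).
Proof.
move=> ikJ jJ ijk lS cSJ; have [ij jk] := andP ijk.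
have ik := ltn_trans ij jk.
have iJ : i \notin J by apply/negP => /ikJ; rewrite ltnn.
have kJ : k \notin J by apply/negP => /ikJ; rewrite ltnn andbF.
have neq (x y : 'I_n) : (x < y)%N -> (x == y = false) * (y == x = false).
  by move=> xy; split; apply: contraTF xy => /eqP ->; rewrite ltnn.
have := minor_P q0 (fine_tr Xf) ikJ jJ ijk lS (esym cSJ).
by rewrite -!minor_tr // !cardsU1 ?lS ?iJ ?kJ ?jJ ?inE ?(neq i j) ?(neq i k) ?(neq j k) //= ?iJ ?jJ ?kJ ?cSJ.
Qed.

Lemma minor_dodgson S J (i k : 'I_m) (j l : 'I_n) :
  (forall a, a \in S -> (i < a < k)%N) -> (i < k)%N ->
  (forall b, b \in J -> (j < b < l)%N) -> (j < l)%N -> #|S| = #|J| ->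
  M (i |: S) (j |: J) * M (k |: S) (l |: J)
  = M (i |: (k |: S)) (j |: (l |: J)) * M S J + q *: (M (i |: S) (l |: J) * M (k |: S) (j |: J)).
Proof.
move=> ikS ik jlJ jl cSJ.
have iS : i \notin S by apply/negP => /ikS; rewrite ltnn.
have kS : k \notin S by apply/negP => /ikS; rewrite ltnn andbF.
have jJ : j \notin J by apply/negP => /jlJ; rewrite ltnn.
have lJ : l \notin J by apply/negP => /jlJ; rewrite ltnn andbF.
have ik' : (i == k) = false by apply: contraTF ik => /eqP ->; rewrite ltnn.
have jl' : (j == l) = false by apply: contraTF jl => /eqP ->; rewrite ltnn.
have := minor_dodgson_swap q0 (fine_tr Xf) jlJ jl ikS ik (esym cSJ).
rewrite -!minor_tr ?cardsU1 ?inE ?iS ?kS ?jJ ?lJ ?ik' ?jl' ?cSJ //= ?iS ?jJ ?cSJ //.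
by move=> <-; rewrite subrK.
Qed.

End Transposed.

(** * The path matrix *)

Section QComm.

Variables (K : fieldType) (A : unitAlgType K).
Implicit Types (e : K) (x y z : A).

Definition qcomm e x y := x * y = e *: (y * x).

Lemma qcommMr e e' x y z : qcomm e x y -> qcomm e' x z -> qcomm (e * e') x (y * z).
Proof.
by move=> xy xz; rewrite /qcomm mulrA xy -scalerAl -(mulrA y x z) xz -scalerAr scalerA mulrA.
Qed.

Lemma qcomm_sym e x y : e != 0 -> qcomm e x y -> qcomm e^-1 y x.
Proof. by move=> e0 xy; rewrite /qcomm xy scalerA mulVf // scale1r. Qed.

Lemma qcommVr e x y : e != 0 -> y \is a GRing.unit -> qcomm e x y -> qcomm e^-1 x y^-1.
Proof.
move=> e0 uy xy; apply: (mulrI uy); rewrite -scalerAr mulVKr //.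
by apply: (mulIr uy); rewrite mulrA mulrVK // -scalerAl xy scalerA mulVf // scale1r.
Qed.

Lemma qcommMl e e' x y z : e != 0 -> e' != 0 -> qcomm e x z -> qcomm e' y z ->
  qcomm (e * e') (x * y) z.
Proof.
move=> e0 e'0 /(qcomm_sym e0) xz /(qcomm_sym e'0) yz.
have := qcomm_sym _ (qcommMr xz yz); rewrite invfM !invrK; apply.
by rewrite mulf_neq0 ?invr_neq0.
Qed.

Lemma qcommVl e x y : e != 0 -> x \is a GRing.unit -> qcomm e x y -> qcomm e^-1 x^-1 y.
Proof.
move=> e0 ux /(qcomm_sym e0) xy; have := qcommVr (invr_neq0 e0) ux xy.
by rewrite invrK => /(qcomm_sym e0).
Qed.

Lemma qcomm_suml (I : finType) (P : pred I) e (F : I -> A) y :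
  (forall i, P i -> qcomm e (F i) y) -> qcomm e (\sum_(i | P i) F i) y.
Proof.
by move=> H; rewrite /qcomm mulr_suml mulr_sumr scaler_sumr; apply: eq_bigr => i /H.
Qed.

Lemma qcomm_sumr (I : finType) (P : pred I) e (F : I -> A) y :
  (forall i, P i -> qcomm e y (F i)) -> qcomm e y (\sum_(i | P i) F i).
Proof.
by move=> H; rewrite /qcomm mulr_suml mulr_sumr scaler_sumr; apply: eq_bigr => i /H.
Qed.

End QComm.

(** * Adding a row to a fine q-matrix *)

Section AddRow.

Variables (K : fieldType) (q : K) (A : unitAlgType K) (k n : nat).
Hypothesis q0 : q != 0.
Variables (X' : 'M[A]_(k, n)) (t : 'I_n -> A) (X : 'M[A]_(k.+1, n)).
Hypothesis X'f : fine_qmatrix q X'.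
Hypothesis tU : forall j, t j \is a GRing.unit.
Hypothesis tt : forall j l : 'I_n, (j < l)%N -> qcomm q (t j) (t l).
Hypothesis tX : forall j i b, qcomm (if j == b then q else 1) (t j) (X' i b).
Hypothesis X0 : forall j, X ord0 j = t j.
Hypothesis XS : forall i j,
  X (lift ord0 i) j = \sum_(b : 'I_n | (b <= j)%N) X' i b * ((t b)^-1 * t j).

(** Each lower entry is [c i j * t j], with [c] a prefix sum of [y]. For j < l the prefix sum splits
    as c_l = c_j + d, and [t j] commutes with the two pieces up to [q] and [q^-1] respectively; the
    fine relations thus reduce to relations between [c] and [d]. *)
Let y i b := X' i b * (t b)^-1.
Let c i (j : 'I_n) := \sum_(b : 'I_n | (b <= j)%N) y i b.
Let d i (j l : 'I_n) := \sum_(b : 'I_n | (j < b <= l)%N) y i b.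

Let cd i (j l : 'I_n) : (j < l)%N -> c i l = c i j + d i j l.
Proof.
move=> jl; rewrite /c (bigID (fun b : 'I_n => (b <= j)%N)) /=; congr (_ + _).
  by apply: eq_bigl => b; lia.
by apply: eq_bigl => b; lia.
Qed.

Let XE i j : X (lift ord0 i) j = c i j * t j.
Proof. by rewrite XS mulr_suml; apply: eq_bigr => b _; rewrite mulrA. Qed.

Let sX i b j : qcomm (if j == b then q^-1 else 1) (t j)^-1 (X' i b).
Proof.
have e0 : (if j == b then q else 1) != 0 by case: ifP; rewrite ?oner_neq0.
by have := qcommVl e0 (tU j) (tX j i b); case: eqP => _; rewrite ?invr1.
Qed.

Let ty (j : 'I_n) i (b : 'I_n) : qcomm (if (b <= j)%N then q else q^-1) (t j) (y i b).
Proof.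
have := tX j i b; case: (ltngtP b j) => bj.
- have -> : (j == b) = false by apply: contraTF bj => /eqP ->; rewrite ltnn.
  move=> H; have := qcommMr H (qcommVr (invr_neq0 q0) (tU b) (qcomm_sym q0 (tt bj))).
  by rewrite invrK mul1r.
- have -> : (j == b) = false by apply: contraTF bj => /eqP ->; rewrite ltnn.
  move=> H; have := qcommMr H (qcommVr q0 (tU b) (tt bj)).
  by rewrite mul1r.
rewrite (val_inj bj) eqxx => H; rewrite -[q]mulr1; apply: (qcommMr H).
by rewrite /qcomm scale1r mulrV ?mulVr.
Qed.

Let tc (j l : 'I_n) i : (l <= j)%N -> qcomm q (t j) (c i l).
Proof.
move=> lj; apply: qcomm_sumr => b bl; have := ty j i b.
by rewrite (leq_trans bl lj).
Qed.

Let td j i l : qcomm q^-1 (t j) (d i j l).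
Proof.
apply: qcomm_sumr => b /andP[jb _]; have := ty j i b.
by rewrite leqNgt jb.
Qed.

Let ss (j l : 'I_n) : (j < l)%N -> qcomm q (t j)^-1 (t l)^-1.
Proof.
move=> jl; have := qcommVl (invr_neq0 q0) (tU j) (qcommVr q0 (tU l) (tt jl)).
by rewrite invrK.
Qed.

Let yE i b l b' : b != b' -> y i b * y l b' = X' i b * X' l b' * ((t b)^-1 * (t b')^-1).
Proof.
move=> bb'; have := sX l b' b; rewrite (negPf bb') /qcomm scale1r => H.
by rewrite /y -mulrA (mulrA (t b)^-1) H !mulrA.
Qed.

Let yEd i l b : y i b * y l b = q^-1 *: (X' i b * X' l b * ((t b)^-1 * (t b)^-1)).
Proof.
have := sX l b b; rewrite eqxx /qcomm => H.
by rewrite /y -mulrA (mulrA (t b)^-1) H -!scalerAl -scalerAr !mulrA.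
Qed.

Let neqb (b b' : 'I_n) : (b < b')%N -> (b != b') * (b' != b).
Proof. by move=> H; split; apply: contraTneq H => ->; rewrite ltnn. Qed.

Let yy1 i (b b' : 'I_n) : (b < b')%N -> qcomm (q * q) (y i b) (y i b').
Proof.
move=> bb'; have [H1 _ _ _] := X'f; rewrite /qcomm !yE ?(neqb bb') //.
by rewrite (H1 i b b') // (ss bb') -scalerAl -scalerAr scalerA.
Qed.

Let yy2 (i l : 'I_k) b : (i < l)%N -> qcomm q (y i b) (y l b).
Proof.
move=> il; have [_ H2 _ _] := X'f; rewrite /qcomm !yEd (H2 i l) //.
by rewrite -scalerAl !scalerA mulrC.
Qed.

Let yy3 (i l : 'I_k) (b b' : 'I_n) : (i < l)%N -> (b < b')%N ->
  qcomm q^-1 (y i b') (y l b).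
Proof.
move=> il bb'; have [_ _ H3 _] := X'f; rewrite /qcomm !yE ?(neqb bb') //.
by rewrite (ss bb') -scalerAr scalerA mulVf // scale1r H3.
Qed.

Let yy4 (i l : 'I_k) (b b' : 'I_n) : (i < l)%N -> (b < b')%N ->
  q^-1 *: (y i b * y l b') - y l b' * y i b = (q - q^-1) *: (y i b' * y l b).
Proof.
move=> il bb'; have [_ _ _ H4] := X'f; rewrite !yE ?(neqb bb') // (ss bb').
by rewrite -scalerAr scalerA mulVf // scale1r -mulrBl H4 // -scalerAl.
Qed.

Let cdq i j l : qcomm (q * q) (c i j) (d i j l).
Proof.
apply: qcomm_suml => b bj; apply: qcomm_sumr => b' /andP[jb' _].
by apply: yy1; apply: leq_ltn_trans bj jb'.
Qed.

Let dcq (i l : 'I_k) j r : (i < l)%N -> qcomm q^-1 (d i j r) (c l j).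
Proof.
move=> il; apply: qcomm_suml => b /andP[jb _]; apply: qcomm_sumr => b' b'j.
by apply: yy3 => //; apply: leq_ltn_trans b'j jb.
Qed.

Let cd4 (i l : 'I_k) j r : (i < l)%N ->
  q^-1 *: (c i j * d l j r) - d l j r * c i j = (q - q^-1) *: (d i j r * c l j).
Proof.
move=> il; rewrite /c /d !mulr_suml !scaler_sumr.
under eq_bigr do rewrite mulr_sumr scaler_sumr.
under [X in _ - X]eq_bigr do rewrite mulr_sumr.
under [RHS]eq_bigr do rewrite mulr_sumr scaler_sumr.
rewrite [X in _ - X]exchange_big [RHS]exchange_big -sumrB; apply: eq_bigr => b bj.
rewrite -sumrB; apply: eq_bigr => b' /andP[jb' _].
by apply: yy4 => //; apply: leq_ltn_trans bj jb'.
Qed.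

(** The products do not q-commute term by term: for b < b' the terms (b, b') and (b', b) mix through
    [yy4], and only their sum does. *)
Let ccq (i l : 'I_k) j : (i < l)%N -> qcomm q (c i j) (c l j).
Proof.
move=> il; pose J := [set b : 'I_n | (b <= j)%N].
have E (F : 'I_n -> 'I_n -> A) : \sum_(b : 'I_n | (b <= j)%N) \sum_(b' : 'I_n | (b' <= j)%N) F b b'
   = \sum_(b in J) F b b + \sum_(b in J) \sum_(b' in J | (b < b')%N) (F b b' + F b' b) :> A.
  rewrite -sum_pairs -big_split; apply: eq_big => b; first by rewrite inE.
  move=> bj; rewrite (bigD1 b) //=; congr (_ + _); apply: eq_bigl => b'.
  by rewrite !inE andbC.
rewrite /qcomm /c !mulr_suml scaler_sumr.
under eq_bigr do rewrite mulr_sumr.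
under [RHS]eq_bigr do rewrite mulr_sumr scaler_sumr.
rewrite !E; congr (_ + _); first by apply: eq_bigr => b _; rewrite (yy2 b il).
apply: eq_bigr => b _; apply: eq_bigr => b' /andP[_ bb'].
have -> : y l b * y i b' = q *: (y i b' * y l b) by rewrite (yy3 il bb') scalerA mulfV ?scale1r.
have -> : y l b' * y i b = q^-1 *: (y i b * y l b') - (q - q^-1) *: (y i b' * y l b).
  by rewrite -yy4 // subKr.
rewrite scalerBr !scalerA mulfV // scale1r addrCA -scalerBl -[X in _ + X = _]scale1r.
by congr (_ + _ *: _); field.
Qed.

Let ttE (j l : 'I_n) : (j < l)%N -> t j * t l = q *: (t l * t j).
Proof. exact: tt. Qed.

Let tcd i (j l : 'I_n) : (j < l)%N ->
  t j * c i l = (q *: c i j + q^-1 *: d i j l) * t j.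
Proof.
by move=> jl; rewrite (cd _ jl) mulrDr (tc i (leqnn j)) (td j i l) mulrDl !scalerAl.
Qed.

(** Normal forms: [N1] and [N2] write the two orders of a product from columns j < r with the same
    right factor [t r * t j], so only the left factors need comparing. *)
Let N1 i l (j r : 'I_n) : (j < r)%N -> X (lift ord0 i) j * X (lift ord0 l) r
  = (q * q *: (c i j * c l j) + c i j * d l j r) * (t r * t j).
Proof.
move=> jr; rewrite !XE mulrA -[c i j * _ * _]mulrA (tcd _ jr) -!mulrA ttE //.
rewrite mulrDl mulrDr [in RHS]mulrDl -!scalerAl -!scalerAr !scalerA mulVf // scale1r.
by rewrite -!mulrA.
Qed.

Let N2 i l (j r : 'I_n) : (j < r)%N -> X (lift ord0 l) r * X (lift ord0 i) j
  = (q *: (c l j * c i j) + q *: (d l j r * c i j)) * (t r * t j).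
Proof.
move=> jr; rewrite !XE mulrA -[c l r * _ * _]mulrA (tc i (ltnW jr)) (cd _ jr).
by rewrite -scalerDr -mulrDl -!scalerAl -scalerAr -scalerAl !mulrA.
Qed.

Lemma fine_add_row : fine_qmatrix q X.
Proof.
split.
- move=> i j l jl; case: (unliftP ord0 i) => [i'|] ->; last by rewrite !X0 ttE.
  rewrite N1 // N2 // [RHS]scalerAl scalerDr !scalerA; congr ((_ + _) * _).
  exact: cdq.
- move=> i l j il; case: (unliftP ord0 l) il => [l'|] ->; last by rewrite ltn0.
  case: (unliftP ord0 i) => [i'|] -> il.
    have {}il : (i' < l')%N by move: il; rewrite /= /bump.
    rewrite !XE -mulrA [t j * _]mulrA (tc _ (leqnn j)) -!scalerAl -!scalerAr.
    rewrite [in RHS]mulrA -[in RHS](mulrA (c l' j)) (tc _ (leqnn j)) -scalerAr -scalerAl.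
    by rewrite !mulrA (ccq _ il) -!scalerAl.
  by rewrite X0 XE mulrA (tc _ (leqnn j)) -!scalerAl.
- move=> i l j r il jr; case: (unliftP ord0 l) il => [l'|] ->; last by rewrite ltn0.
  case: (unliftP ord0 i) => [i'|] -> il.
    have {}il : (i' < l')%N by move: il; rewrite /= /bump.
    rewrite (N1 l' i' jr) (N2 l' i' jr); congr (_ * _).
    by rewrite (ccq _ il) (dcq _ _ il) !scalerA mulfV // scale1r.
  by rewrite X0 XE mulrA (tc _ (ltnW jr)) -mulrA ttE // -scalerAl -scalerAr mulrA.
move=> i l j r il jr; case: (unliftP ord0 l) il => [l'|] ->; last by rewrite ltn0.
case: (unliftP ord0 i) => [i'|] -> il.
  have {}il : (i' < l')%N by move: il; rewrite /= /bump.
  rewrite (N1 i' l' jr) (N2 i' l' jr) (N2 l' i' jr) -mulrBl [RHS]scalerAl; congr (_ * _).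
  rewrite -(ccq j il) opprD addrACA scalerDr; congr (_ + _).
    by rewrite -[X in _ - X]scale1r -scalerBl scalerA; congr (_ *: _); field.
  have -> : c i' j * d l' j r = q *: (q^-1 *: (c i' j * d l' j r)) by rewrite scalerA mulfV ?scale1r.
  by rewrite -scalerBr (cd4 _ _ il) !scalerA mulrC.
rewrite !X0 !XE mulrA (tcd _ jr) -!mulrA ttE // (cd _ jr).
rewrite (mulrA (t r)) (tc _ (ltnW jr)) -!scalerAr -!scalerAl -mulrA [RHS]scalerA [RHS]scalerAl [LHS]addrC.
rewrite [X in - _ + X]scalerAl -mulNr -mulrDl; congr (_ * _).
rewrite scalerDr !scalerA mulfV // scale1r opprD addrACA addNr addr0.
by rewrite -[X in - X]scale1r -scaleNr -scalerDl; congr (_ *: _); field.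
Qed.

End AddRow.

Definition itv p (a b : nat) : {set 'I_p} := [set i : 'I_p | (a <= i < b)%N].

Lemma card_itv p a b : (b <= p)%N -> #|itv p a b| = (b - a)%N.
Proof.
move=> bp; have card_lt c : (c <= p)%N -> #|[set i : 'I_p | (i < c)%N]| = c.
  move=> cp; rewrite -sum1dep_card -[RHS](@sum_ltn_ord p) // big_mkcond /=.
  by apply: eq_bigr => i _; case: ltnP.
have [ab|ba] := leqP a b; last first.
  by rewrite (eqnP (ltnW ba)); apply: eq_card0 => i; rewrite !inE; lia.
have := cardsID [set i : 'I_p | (i < a)%N] [set i : 'I_p | (i < b)%N].
rewrite card_lt // (_ : _ :&: _ = [set i : 'I_p | (i < a)%N]) ?card_lt ?(leq_trans ab) //.
  rewrite (_ : _ :\: _ = itv p a b); first by move=> /(congr1 (subn^~ a)); rewrite addKn.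
  by apply/setP => i; rewrite !inE; lia.
by apply/setP => i; rewrite !inE; lia.
Qed.

Lemma itv_recr p a b (c : 'I_p) : c = b :> nat -> (a <= b)%N -> itv p a b.+1 = c |: itv p a b.
Proof. by move=> cb ab; apply/setP => i; rewrite !inE -val_eqE /= cb; lia. Qed.

Lemma itv_empty p a : itv p a a = set0.
Proof. by apply/setP => i; rewrite !inE; lia. Qed.

(** * Path matrices of grids of weights, one row at a time *)

Section Grid.

Variables (K : fieldType) (q : K) (A : unitAlgType K) (n : nat).
Hypothesis q0 : q != 0.
Implicit Types v : nat -> 'I_n -> A.

(** Only the first [k] rows are constrained, so that the property passes to [v \o S] when row 0, the
    one crossed last, is removed. *)
Definition qgrid k v : Prop :=
  [/\ forall i j, (i < k)%N -> v i j \is a GRing.unit,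
      forall i (j l : 'I_n), (i < k)%N -> (j < l)%N -> qcomm q (v i j) (v i l)
    & forall i l j c, (i < l)%N -> (l < k)%N ->
        qcomm (if j == c then q else 1) (v i j) (v l c)].

(** [path_row v i] is the sum over paths from the left end of row [i], rows being
    numbered from 0; a path crosses row 0 last, and it moves there from its entry
    column to its exit column by the factor [descend (v 0)]. *)
Definition descend (t : 'I_n -> A) : 'M[A]_n :=
  \matrix_(b, j) if (b <= j)%N then (t b)^-1 * t j else 0.

Fixpoint path_row v (i : nat) : 'rV[A]_n :=
  if i is i'.+1 then path_row (v \o S) i' *m descend (v 0%N) else \row_j v 0%N j.

Definition path_grid k v : 'M[A]_(k, n) := \matrix_(i, j) path_row v i 0 j.

Lemma path_gridE k v i j : path_grid k v i j = path_row v i 0 j.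
Proof. by rewrite mxE. Qed.

Lemma qgridS k v : qgrid k.+1 v -> qgrid k (v \o S).
Proof. by case=> U R C; split=> [i j ik|i j l ik jl|i l j c il lk]; [exact: U | exact: R | exact: C]. Qed.

Lemma path_rowS v i j : path_row v i.+1 0 j
  = \sum_(b : 'I_n | (b <= j)%N) path_row (v \o S) i 0 b * ((v 0%N b)^-1 * v 0%N j).
Proof.
rewrite /= mxE [RHS]big_mkcond; apply: eq_bigr => b _; rewrite mxE.
by case: ifP; rewrite ?mulr0.
Qed.

(** Along a path the column weights telescope. *)
Lemma path_row_qcomm k v i (x : A) (c j : 'I_n) :
  (forall r b, (r < k)%N -> v r b \is a GRing.unit) ->
  (forall r b, (r < k)%N -> qcomm (if c == b then q else 1) x (v r b)) -> (i < k)%N ->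
  qcomm (if c == j then q else 1) x (path_row v i 0 j).
Proof.
have e0 (b : bool) : (if b then q else 1) != 0 by case: b; rewrite ?oner_neq0.
elim: i k v j => [|i IH] k v j U C ik; first by rewrite /= mxE; apply: C.
rewrite path_rowS; apply: qcomm_sumr => b _.
have k0 : (0 < k)%N by case: (k) ik.
have H : qcomm (if c == b then q else 1) x (path_row (v \o S) i 0 b).
  by apply: (IH k.-1) => [r b' rk|r b' rk|]; [apply: U => /= | apply: C => /= |]; lia.
have := qcommMr H (qcommMr (qcommVr (e0 _) (U _ _ k0) (C 0%N b k0)) (C 0%N j k0)).
by rewrite mulrA mulfV // mul1r.
Qed.

Lemma path_grid_fine k v : qgrid k v -> fine_qmatrix q (path_grid k v).
Proof.
elim: k v => [|k IH] v gv; first by split=> [[]|[]|[]|[]].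
have [U R C] := gv; apply: (fine_add_row q0 (IH _ (qgridS gv)) (t := v 0%N)).
- by move=> j; apply: U.
- by move=> j l jl; apply: R.
- move=> j i b; rewrite mxE; apply: (@path_row_qcomm k) => [r c rk|r c rk|//].
    by apply: U.
  by apply: C.
- by move=> j; rewrite !mxE.
by move=> i j; rewrite mxE lift0 path_rowS; apply: eq_bigr => b _; rewrite mxE.
Qed.

(** The part of column [c] proportional to column [c'] contributes an expansion with a repeated
    column, hence 0. The factor [e] stands on the right of the entries, which is why the expansion
    is the right one. *)
Lemma column_step k (X : 'M[A]_(k, n)) (R : {set 'I_k}) (L : {set 'I_n}) (c c' : 'I_n)
    (e : A) (Z : 'I_k -> A) : fine_qmatrix q X ->
  #|R| = #|L|.+1 -> c' \in L -> (forall b, b \in L -> (b < c)%N) ->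
  (forall t, t \in R -> X t c = X t c' * e + Z t) ->
  minor q X R (c |: L)
  = \sum_(t in R) (- q) ^+ ngt R t *: (minor q X (R :\ t) L * Z t).
Proof.
move=> Xf cRL cL' Lc XZ.
have cL : c \notin L by apply/negP => /Lc; rewrite ltnn.
have := laplace_colr q0 Xf c cRL; rewrite (negPf cL) ngt_above => [|b /Lc/ltnW //].
rewrite expr0 scale1r => <-.
have := laplace_colr q0 Xf c' cRL; rewrite cL' => E.
have {}E : 0 = \sum_(t in R) (- q) ^+ ngt R t *: (minor q X (R :\ t) L * X t c') * e.
  by rewrite -mulr_suml E mul0r.
rewrite -[RHS]add0r [X in _ = X + _]E -big_split.
apply: eq_bigr => t tR; rewrite /= -scalerAl -scalerDr; congr (_ *: _).
by rewrite XZ // mulrDr mulrA.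
Qed.

Section OneStep.

Variables (k : nat) (v : nat -> 'I_n -> A).
Hypothesis gv : qgrid k.+1 v.

Let X := path_grid k.+1 v.
Let X' := path_grid k (v \o S).

Lemma path_grid0 c : X ord0 c = v 0%N c.
Proof. by rewrite !mxE. Qed.

(** A path leaving row 0 at column [c] either moves there from the previous column or enters row 0
    at [c] itself. *)
Lemma path_grid_lift (i : 'I_k) (c c' : 'I_n) : c = c'.+1 :> nat ->
  X (lift ord0 i) c = X (lift ord0 i) c' * ((v 0%N c')^-1 * v 0%N c) + X' i c.
Proof.
have [U _ _] := gv; move=> cc'; rewrite !path_gridE lift0 !path_rowS (bigD1 c) //= addrC; congr (_ + _); last first.
  by rewrite mulVr ?mulr1 ?U.
rewrite mulr_suml; apply: eq_big => [b|b _]; first by rewrite -val_eqE /= cc'; lia.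
by rewrite -!mulrA mulVKr ?U.
Qed.

Lemma path_grid_lift0 (i : 'I_k) (c : 'I_n) : c = 0%N :> nat -> X (lift ord0 i) c = X' i c.
Proof.
have [U _ _] := gv; move=> c0; rewrite !path_gridE lift0 path_rowS (big_pred1 c) => [|b].
  by rewrite mulVr ?mulr1 ?U.
by rewrite /= -val_eqE /= c0 leqn0.
Qed.

Lemma lift_setD1 (I : {set 'I_k}) i : (lift ord0 @: I) :\ lift ord0 i = lift ord0 @: (I :\ i).
Proof.
apply/setP => x; rewrite !inE; case: (unliftP ord0 x) => [y ->|->].
  by rewrite (inj_eq lift_inj) !mem_imset ?inE //; apply: lift_inj.
have E (B : {set 'I_k}) : (ord0 \in lift ord0 @: B) = false.
  by apply/negP => /imsetP[z _ /eqP]; rewrite eq_liftF.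
by rewrite !E andbF.
Qed.

Lemma ord0_notin_lift (I : {set 'I_k}) : ord0 \notin lift ord0 @: I.
Proof. by apply/negP => /imsetP[z _ /eqP]; rewrite eq_liftF. Qed.

Lemma ngt_lift (I : {set 'I_k}) i : ngt (lift ord0 @: I) (lift ord0 i) = ngt I i.
Proof.
rewrite /ngt -[RHS](card_imset _ (@lift_inj _ ord0)); apply: eq_card => x; rewrite !inE.
case: (unliftP ord0 x) => [y ->|->].
  by rewrite !mem_imset ?inE //; apply: lift_inj.
by rewrite !(negPf (ord0_notin_lift _)).
Qed.

(** On initial columns the passage through row 0 is a unitriangular column operation, once the
    column factors are cancelled, and does not change minors that avoid row 0. *)
Lemma minor_drop_row s (I : {set 'I_k}) : (s <= n)%N -> #|I| = s ->
  minor q X (lift ord0 @: I) (itv n 0 s) = minor q X' I (itv n 0 s).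
Proof.
have Xf := path_grid_fine gv; have X'f := path_grid_fine (qgridS gv).
elim: s I => [|s IH] I sn cI.
  by move/eqP: cI; rewrite cards_eq0 => /eqP ->; rewrite imset0 itv_empty !minor0.
pose c := Ordinal sn; rewrite (itv_recr (c := c)) //.
have cL : #|itv n 0 s| = s by rewrite (card_itv _ (ltnW sn)) subn0.
have cR : #|lift ord0 @: I| = #|itv n 0 s|.+1.
  by rewrite card_imset ?cL //; apply: lift_inj.
have Lc b : b \in itv n 0 s -> (b < c)%N by rewrite inE.
have cNL : c \notin itv n 0 s by rewrite inE ltnn andbF.
have cI' : #|I| = #|itv n 0 s|.+1 by rewrite cL.
have := laplace_colr q0 X'f c cI'; rewrite (negPf cNL) ngt_above => [|b /Lc/ltnW //].
rewrite expr0 scale1r => <-.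
transitivity (\sum_(t in lift ord0 @: I) (- q) ^+ ngt (lift ord0 @: I) t *:
    (minor q X (lift ord0 @: I :\ t) (itv n 0 s) * (if unlift ord0 t is Some i then X' i c else 0))).
  (* Column 0 has no left neighbour: there the entries already coincide with those of [X']. *)
  case: s {IH} => [|s] in sn c cI cL cR Lc cNL cI' *.
    have := laplace_colr q0 Xf c cR; rewrite (negPf cNL) ngt_above => [|b /Lc/ltnW //].
    rewrite expr0 scale1r => <-; apply: eq_bigr => t /imsetP[i _ ->].
    by rewrite liftK path_grid_lift0.
  pose c' := Ordinal (ltnW sn).
  apply: (column_step (c' := c') (e := (v 0%N c')^-1 * v 0%N c)) => //; first by rewrite inE /=.
  by move=> t /imsetP[i _ ->]; rewrite liftK (path_grid_lift _ (c' := c')).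
rewrite big_imset /=; last by move=> ? ? _ _; apply: lift_inj.
apply: eq_bigr => i iI; rewrite liftK ngt_lift lift_setD1 IH ?(ltnW sn) //.
by move: cI; rewrite (cardsD1 i) iI => -[].
Qed.

(** The column operations that turn the lower rows into those of [X'] clear row 0 outside its first
    selected column, since v_c' (v_c'^-1 v_c) = v_c. What remains is one weight times a smaller
    minor. *)
Lemma minor_peel_row s a (a' : 'I_n) (I : {set 'I_k}) : a = a' :> nat -> (a + s < n)%N -> #|I| = s ->
  minor q X (ord0 |: lift ord0 @: I) (itv n a (a + s).+1)
  = v 0%N a' * minor q X' I (itv n a.+1 (a + s).+1).
Proof.
have Xf := path_grid_fine gv; have X'f := path_grid_fine (qgridS gv).
move=> aa'; elim: s I => [|s IH] I sn cI.
  move/eqP: cI; rewrite cards_eq0 => /eqP ->; rewrite imset0 addn0 itv_empty minor0 eqxx mulr1.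
  rewrite (itv_recr (c := a')) // itv_empty.
  have := laplace_rowl q0 Xf ord0 set0 (a' |: set0); rewrite inE nlt_below => [|i]; last by rewrite inE.
  rewrite expr0 scale1r => <-.
  rewrite setU0 big_set1 setDv minor0 eqxx mulr1 nlt_below => [|i]; last by rewrite inE => /eqP ->.
  by rewrite expr0 scale1r path_grid0.
pose c := Ordinal sn; rewrite !(itv_recr (c := c)) //=; [|lia|lia].
have cL : #|itv n a (a + s.+1)| = s.+1 by rewrite (card_itv _ (ltnW sn)) addKn.
have cL' : #|itv n a.+1 (a + s.+1)| = s by rewrite (card_itv _ (ltnW sn)); lia.
set R := ord0 |: lift ord0 @: I.
have cR : #|R| = #|itv n a (a + s.+1)|.+1.
  rewrite cardsU1 ord0_notin_lift card_imset ?cL ?cI //; apply: lift_inj.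
have Lc b : b \in itv n a (a + s.+1) -> (b < c)%N by rewrite inE => /andP[].
have Lc' b : b \in itv n a.+1 (a + s.+1) -> (b < c)%N by rewrite inE => /andP[].
have c'n : (a + s < n)%N by lia.
pose c' := Ordinal c'n.
rewrite (column_step (c' := c') (e := (v 0%N c')^-1 * v 0%N c)
   (Z := fun t => if unlift ord0 t is Some i then X' i c else 0)) //; first last.
- move=> t; case: (unliftP ord0 t) => [i ->|->] _.
    by rewrite (path_grid_lift _ (c' := c')) //= addnS.
  have [U _ _] := gv; by rewrite !path_grid0 mulVKr ?addr0 ?U.
- by rewrite inE /=; lia.
rewrite big_setU1 ?ord0_notin_lift //= unlift_none mulr0 scaler0 add0r.
rewrite big_imset /=; last by move=> ? ? _ _; apply: lift_inj.
have cI' : #|I| = #|itv n a.+1 (a + s.+1)|.+1 by rewrite cL'.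
have cNL : c \notin itv n a.+1 (a + s.+1) by rewrite inE ltnn andbF.
have := laplace_colr q0 X'f c cI'; rewrite (negPf cNL) ngt_above => [|b /Lc'/ltnW //].
rewrite expr0 scale1r => <-; rewrite mulr_sumr; apply: eq_bigr => i iI.
rewrite liftK /R.
have -> : (ord0 |: lift ord0 @: I) :\ lift ord0 i = ord0 |: lift ord0 @: (I :\ i).
  rewrite -lift_setD1; apply/setP => x; rewrite !inE; case: (x =P ord0) => [->|//].
  by rewrite /= ?andbT ?orbT // eq_sym eq_liftF.
rewrite ngtU1 ?ord0_notin_lift // ltn0 add0n ngt_lift addnS IH.
- by rewrite -scalerAr mulrA.
- by lia.
by move: cI; rewrite (cardsD1 i) iI => -[].
Qed.

End OneStep.
End Grid.

Section IntervalMinors.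

Variables (K : fieldType) (q : K) (A : unitAlgType K) (n : nat).
Hypothesis q0 : q != 0.
Implicit Types W : nat -> nat -> A.

Definition colw W : nat -> 'I_n -> A := fun r b => W r b.

Lemma itv_lift k a b : itv k.+1 a.+1 b.+1 = lift ord0 @: itv k a b.
Proof.
apply/setP => x; case: (unliftP ord0 x) => [y ->|->].
  by rewrite mem_imset ?inE ?lift0 //; apply: lift_inj.
by rewrite !inE; apply/esym/negP => /imsetP[z _ /eqP]; rewrite eq_liftF.
Qed.

Lemma itv_lift0 k b : itv k.+1 0 b.+1 = ord0 |: lift ord0 @: itv k 0 b.
Proof. by rewrite -itv_lift; apply/setP => x; rewrite !inE -val_eqE /=; lia. Qed.

Lemma minor_initial_rows s k W a : qgrid q k (colw W) -> (s <= k)%N -> (a + s <= n)%N ->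
  minor q (path_grid k (colw W)) (itv k 0 s) (itv n a (a + s)) = \prod_(r < s) W r (a + r)%N.
Proof.
elim: s k W a => [|s IH] k W a gW sk an.
  by rewrite addn0 !itv_empty minor0 eqxx big_ord0.
case: k gW sk => // k gW sk; have an' : (a < n)%N by lia.
rewrite itv_lift0 addnS (minor_peel_row q0 gW (a' := Ordinal an')) //; first last.
- by rewrite card_itv ?subn0.
- by lia.
rewrite big_ord_recl /= addn0; congr (_ * _).
rewrite -addSn (IH k (W \o S)) //; first last.
- by lia.
- exact: qgridS gW.
by apply: eq_bigr => r _; rewrite addnS addSn.
Qed.

(** Initial columns allow the rows before [d] to be dropped one by one, which leaves the case of
    [minor_initial_rows]. *)
Lemma minor_initial_cols d s k W : qgrid q k (colw W) -> (d + s <= k)%N -> (s <= n)%N ->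
  minor q (path_grid k (colw W)) (itv k d (d + s)) (itv n 0 s) = \prod_(r < s) W (d + r)%N r.
Proof.
elim: d k W => [|d IH] k W gW dk sn.
  by rewrite add0n -{2}[s]add0n minor_initial_rows.
case: k gW dk => // k gW dk; rewrite addSn itv_lift minor_drop_row //; last first.
  by rewrite card_itv // addKn.
rewrite (IH k (W \o S)) //; exact: qgridS gW.
Qed.

End IntervalMinors.

(** * Comparison with the sum over directed paths *)

Section Descents.

Variables (K : fieldType) (A : unitAlgType K) (n : nat).
Implicit Types v : nat -> 'I_n -> A.

(** [path_row] splits off the row crossed last, whereas walks are unfolded at their first edge. Here
    the rows i-1, ..., 0 are composed in the order of crossing, and [descentsSr] passes between the
    two recursions. *)
Fixpoint descents v i : 'M[A]_n :=
  if i is i'.+1 then descend (v i') *m descents v i' else 1%:M.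

Lemma descentsSr v i : descents v i.+1 = descents (v \o S) i *m descend (v 0%N).
Proof.
elim: i => [|i IH]; first by rewrite /= mulmx1 mul1mx.
by rewrite -[LHS]/(descend (v i.+1) *m descents v i.+1) IH mulmxA.
Qed.

Lemma path_row_descents v i : path_row v i = (\row_j v i j) *m descents v i.
Proof.
elim: i v => [|i IH] v; first by rewrite /= mulmx1.
by rewrite descentsSr mulmxA -(IH (v \o S)).
Qed.

End Descents.

Section PathMatrix.

Variables (m n : nat) (K : fieldType) (A : unitAlgType K).
Variable f0 : {set 'I_m} -> {set 'I_n} -> A.
Hypothesis n0 : (0 < n)%N.

Local Notation wt := (w f0).
Hypothesis wU : forall i j, (0 < i <= m)%N -> (0 < j <= n)%N -> wt i j \is a GRing.unit.

Definition walks k (z u : vertex m n) : A :=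
  \sum_(p : k.-tuple (vertex m n) | path (@edge m n) u p && (last u p == z)) path_weight f0 u p.

Lemma walks0 z u : walks 0 z u = (u == z)%:R.
Proof.
rewrite /walks (eq_bigl (fun=> u == z)) => [|p]; last by rewrite tuple0.
case: eqP => _; last by rewrite big_pred0_eq.
rewrite (big_pred1 [tuple]) => [|p]; first by rewrite /path_weight big_nil.
by apply/esym/eqP; rewrite tuple0.
Qed.

Lemma walksS k z u :
  walks k.+1 z u = \sum_(v | edge u v) edge_weight f0 u v * walks k z v.
Proof.
rewrite /walks (reindex (fun vp : vertex m n * k.-tuple (vertex m n) => [tuple of vp.1 :: vp.2])) /=; last first.
  exists (fun p => (thead p, [tuple of behead p])) => [[v p] _|p _] /=.
    by congr (_, _); apply/val_inj.
  by rewrite [RHS]tuple_eta.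
under [RHS]eq_bigr do rewrite mulr_sumr.
rewrite pair_big_dep /=; apply: eq_big => [[v p]|[v p] _] /=; first by rewrite andbA.
by rewrite /path_weight /= big_cons.
Qed.

Definition walk_sum z u : A := \sum_(k < #|{: vertex m n}|) walks k z u.

Lemma walk_sumE z u :
  walk_sum z u = (u == z)%:R + \sum_(v | edge u v) edge_weight f0 u v * walk_sum z v.
Proof.
rewrite /walk_sum; have : (0 < #|{: vertex m n}|)%N by apply/card_gt0P; exists u.
case Nv : #|{: vertex m n}| => [//|N] _; rewrite big_ord_recl walks0; congr (_ + _).
transitivity (\sum_(k < N) walks k.+1 z u + walks N.+1 z u).
  (* By acyclicity no path has as many edges as there are vertices, so a zero term may be added to
     restore the range of lengths. *)
  rewrite -[LHS]addr0; congr (_ + _); apply/esym; rewrite /walks big_pred0 // => p.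
  by apply/negP => /andP[/size_path_lt]; rewrite size_tuple Nv ltnn.
rewrite -(big_ord_recr _ (fun k : 'I_N.+1 => walks k.+1 z u)) /=.
under eq_bigr do rewrite walksS.
by rewrite exchange_big; apply: eq_bigr => v _; rewrite mulr_sumr.
Qed.

Lemma path_mxE i j : path_mx f0 i j = walk_sum (ord0, lift ord0 j) (lift ord0 i, ord0).
Proof. by rewrite mxE. Qed.

Variable j : 'I_n.

(** The target is fixed in row 0 below column [j.+1]. [inord] is faithful only for i <= m and a <=
    n, the range of the lemmas that follow. *)
Let P (i a : nat) : A := walk_sum (ord0, lift ord0 j) (inord i, inord a).

Lemma walk_ground a : (a <= n)%N -> P 0 a = (a == j.+1)%:R.
Proof.
move=> an; rewrite /P walk_sumE big_pred0 ?addr0 => [|[x y]].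
  by rewrite xpair_eqE -!val_eqE /= !inordK.
by rewrite /edge /= /hedge /vedge /= -!val_eqE /= !inordK // !andbF.
Qed.

Lemma walk_left i : (i < m)%N -> P i.+1 0 = wt i.+1 1 * P i.+1 1.
Proof.
move=> im; rewrite /P walk_sumE xpair_eqE -!val_eqE /= !inordK // add0r.
rewrite (big_pred1 (inord i.+1, inord 1)) => [|[x y]]; last first.
  rewrite /edge /= /hedge /vedge /= xpair_eqE -!val_eqE /= !inordK ?ltnS //.
  by lia.
by rewrite /edge_weight /hedge /= !inordK ?ltnS // !eqxx.
Qed.

Lemma walk_step i a : (i < m)%N -> (0 < a <= n)%N ->
  P i.+1 a = P i a + (if (a < n)%N then (wt i.+1 a)^-1 * wt i.+1 a.+1 * P i.+1 a.+1 else 0).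
Proof.
move=> im /andP[a0 an]; rewrite /P walk_sumE xpair_eqE -!val_eqE /= !inordK ?ltnS // add0r.
have im' : (i <= m)%N by apply: ltnW.
rewrite (bigD1 (inord i, inord a)) /=; last first.
  by rewrite /edge /= /hedge /vedge /= !inordK ?ltnS // a0 !eqxx orbT.
rewrite {1}/edge_weight /hedge /= -!val_eqE /= !inordK ?ltnS // (ltn_eqF (ltnSn i)) mul1r.
case: ltnP => an'; last first.
  rewrite big_pred0 // => -[x y]; rewrite /edge /= /hedge /vedge /= xpair_eqE -!val_eqE /= !inordK ?ltnS //.
  by have := ltn_ord y; lia.
rewrite (big_pred1 (inord i.+1, inord a.+1)) => [|[x y]]; last first.
  rewrite /edge /= /hedge /vedge /= !xpair_eqE -!val_eqE /= !inordK ?ltnS //.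
  by lia.
congr (_ + _).
rewrite /edge_weight /hedge /= !inordK ?ltnS // !eqxx /=.
by case: a a0 {an an'} => // a _.
Qed.

(** The edge weights of a row telescope; the left factor [wt i.+1 a] absorbs the remaining inverse.
    The ordinal [b] is the 0-based column at which the walk leaves the row. *)
Lemma walk_row i a : (i < m)%N -> (0 < a <= n)%N ->
  wt i.+1 a * P i.+1 a = \sum_(b : 'I_n | (a.-1 <= b)%N) wt i.+1 b.+1 * P i b.+1.
Proof.
move=> im /andP[a0 an]; have [d] := ubnP (n - a); elim: d a a0 an => // d IH a a0 an lt.
have an1 : (a.-1 < n)%N by lia.
rewrite walk_step ?a0 // mulrDr (bigD1 (Ordinal an1)) //= prednK //; congr (_ + _).
case: ltnP => an'; last first.
  rewrite mulr0 big_pred0 // => b; rewrite -val_eqE /=; have := ltn_ord b; lia.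
rewrite !mulrA divrr ?wU ?a0 ?an // mul1r IH //; last by lia.
by apply: eq_bigl => b; rewrite -val_eqE /=; lia.
Qed.

Let v : nat -> 'I_n -> A := @colw K A n (fun r b => wt r.+1 b.+1).

Lemma walk_descents i (b : 'I_n) : (i <= m)%N -> P i b.+1 = descents v i b j.
Proof.
elim: i b => [|i IH] b im; first by rewrite walk_ground // mxE eqSS.
have bn := ltn_ord b.
have U : v i b \is a GRing.unit by apply: wU.
apply: (mulrI U); rewrite /v /colw walk_row // mxE mulr_sumr big_mkcond /=.
apply: eq_bigr => c _; rewrite mxE IH ?(ltnW im) //; case: ifP => _; last by rewrite mul0r mulr0.
by rewrite mulrA mulVKr.
Qed.

End PathMatrix.

Lemma path_mx_grid (m n : nat) (K : fieldType) (A : unitAlgType K)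
    (f0 : {set 'I_m} -> {set 'I_n} -> A) : (0 < n)%N ->
  (forall i j, (0 < i <= m)%N -> (0 < j <= n)%N -> w f0 i j \is a GRing.unit) ->
  path_mx f0 = path_grid m (@colw K A n (fun r b => w f0 r.+1 b.+1)).
Proof.
move=> n0 wU; apply/matrixP => i j; rewrite path_mxE path_gridE path_row_descents.
have -> : (lift ord0 i, ord0) = (inord i.+1, inord 0) :> vertex m n.
  by congr (_, _); apply/val_inj; rewrite /= inordK ?lift0 // ltnS.
rewrite walk_left // walk_row //= mxE; apply: eq_bigr => b _.
by rewrite mxE walk_descents // ltnW.
Qed.

(** * Commutation of the weights *)

(** The exponent [c] for the pairs [pi(i,j)] and [pi(i',j')]. *)
Definition pi_exp (i j i' j' : nat) : int :=
  let k := minn i j in let k' := minn i' j' in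
  (minn k' (i' - i) + minn k' (j' - j))%N%:Z
  - (minn k' ((i - k) - (i' - k')) + minn k' ((j - k) - (j' - k')))%N%:Z.

Lemma pi_exp_eq0 i j i' j' : minn i' j' = 0%N -> pi_exp i j i' j' = 0.
Proof. by rewrite /pi_exp /= => ->; rewrite !min0n. Qed.

(** Quasi-commutation is given only with the larger pair first; reversing the pairs negates the
    exponent. *)
Definition pi_exp_anti (i j i' j' : nat) : int :=
  if (minn i' j' <= minn i j)%N then pi_exp i j i' j' else - pi_exp i' j' i j.

(** The exponent for [w(i+1,j+1)] and [w(i'+1,j'+1)], from
    [w(i+1,j+1) = f0(pi(i,j))^-1 * f0(pi(i+1,j+1))]. *)
Definition w_exp (i j i' j' : nat) : int :=
  (pi_exp_anti i.+1 j.+1 i'.+1 j'.+1 - pi_exp_anti i.+1 j.+1 i' j')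
  - (pi_exp_anti i j i'.+1 j'.+1 - pi_exp_anti i j i' j').

Lemma pi_expC i j i' j' : pi_exp i j i' j' = pi_exp j i j' i'.
Proof.
by rewrite /pi_exp /= ![minn j i]minnC ![minn j' i']minnC; congr (Posz _ - Posz _); apply: addnC.
Qed.

Lemma pi_exp_antiC i j i' j' : pi_exp_anti i j i' j' = pi_exp_anti j i j' i'.
Proof.
by rewrite /pi_exp_anti ![minn j i]minnC ![minn j' i']minnC [pi_exp j _ _ _]pi_expC [pi_exp j' _ _ _]pi_expC.
Qed.

(** From here on, suffix 1 means that both row intervals are initial, and suffix 2 that the second
    pair has an initial column interval instead; [ge] and [le] compare the sizes. Transposition
    ([w_expC]) covers the remaining cases. *)
Lemma pi_exp1 i j i' j' : (i <= j)%N -> (i' <= j')%N -> (i' <= i)%N ->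
  pi_exp i j i' j' = (minn i' (j' - j))%N%:Z - (minn i' ((j - i) - (j' - i')))%N%:Z.
Proof.
move=> ij ij' ii; rewrite /pi_exp /= (minn_idPl ij) (minn_idPl ij').
by rewrite (eqnP ii) !subnn minn0 !add0n.
Qed.

Lemma pi_exp2 i j i' j' : (i <= j)%N -> (j' <= i')%N -> (j' <= i)%N ->
  pi_exp i j i' j' = (minn j' (i' - i))%N%:Z - (minn j' (j - i))%N%:Z.
Proof.
move=> ij ij' ii; rewrite /pi_exp /= (minn_idPl ij) (minn_idPr ij').
by rewrite (eqnP (leq_trans ii ij)) !subnn sub0n minn0 addn0 subn0.
Qed.

Lemma pi_exp_anti1ge i j i' j' : (i <= j)%N -> (i' <= j')%N -> (i' <= i)%N ->
  pi_exp_anti i j i' j' = (minn i' (j' - j))%N%:Z - (minn i' ((j - i) - (j' - i')))%N%:Z.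
Proof.
by move=> ij ij' ii; rewrite /pi_exp_anti (minn_idPl ij) (minn_idPl ij') ii pi_exp1.
Qed.

Lemma pi_exp_anti1le i j i' j' : (i <= j)%N -> (i' <= j')%N -> (i <= i')%N ->
  pi_exp_anti i j i' j' = (minn i ((j' - i') - (j - i)))%N%:Z - (minn i (j - j'))%N%:Z.
Proof.
move=> ij ij' ii; case: (ltngtP i i') ii => // [ii _|ii _].
  by rewrite /pi_exp_anti (minn_idPl ij) (minn_idPl ij') leqNgt ii /= pi_exp1 ?opprB // ltnW.
by rewrite pi_exp_anti1ge // ii; lia.
Qed.

Lemma pi_exp_anti2ge i j i' j' : (i <= j)%N -> (j' <= i')%N -> (j' <= i)%N ->
  pi_exp_anti i j i' j' = (minn j' (i' - i))%N%:Z - (minn j' (j - i))%N%:Z.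
Proof.
by move=> ij ij' ii; rewrite /pi_exp_anti (minn_idPl ij) (minn_idPr ij') ii pi_exp2.
Qed.

Lemma pi_exp_anti2le i j i' j' : (i <= j)%N -> (j' <= i')%N -> (i <= j')%N ->
  pi_exp_anti i j i' j' = (minn i (i' - j'))%N%:Z - (minn i (j - j'))%N%:Z.
Proof.
move=> ij ij' ii; case: (ltngtP i j') ii => // [ii _|ii _].
  by rewrite /pi_exp_anti (minn_idPl ij) (minn_idPr ij') leqNgt ii /= pi_expC pi_exp2 ?opprB // ltnW.
by rewrite pi_exp_anti2ge // ii.
Qed.

(** The generalized minima depend on the second pair only through its diagonal, which the shift
    preserves; they cancel in the double difference. *)
Lemma w_exp1lt i j i' j' : (i <= j)%N -> (i' <= j')%N -> (i < i')%N ->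
  w_exp i j i' j' = (j == j')%:Z.
Proof.
move=> ij ij' ii; rewrite /w_exp !pi_exp_anti1le; [|lia..].
rewrite !subSS; move: (minn i.+1 (_ - _ - _)) (minn i (_ - _ - _)) => a b; lia.
Qed.

Lemma w_exp1gt i j i' j' : (i <= j)%N -> (i' <= j')%N -> (i' < i)%N ->
  w_exp i j i' j' = - (j == j')%:Z.
Proof.
move=> ij ij' ii; rewrite /w_exp !pi_exp_anti1ge; [|lia..].
rewrite !subSS; move: (minn i'.+1 (_ - _ - _)) (minn i' (_ - _ - _)) => a b; lia.
Qed.

Lemma w_exp1eq i j j' : (i <= j)%N -> (i <= j')%N -> (j < j')%N -> w_exp i j i j' = 1.
Proof.
move=> ij ij' jj; rewrite /w_exp !(@pi_exp_anti1ge i.+1) ?(@pi_exp_anti1le i); [|lia..].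
have z : (j - i - (j' - i) = 0)%N by lia.
have d : (j' - i - (j - i) = j' - j)%N by lia.
have z0 : (j - j' = 0)%N by lia.
have z1 : (j - j'.+1 = 0)%N by lia.
rewrite !subSS ?z ?z0 ?z1 ?d !minn0; have [e ->] : exists e, j' = (j + e.+1)%N.
  by exists (j' - j).-1; lia.
by rewrite addnS subSS -addnS !addKn; lia.
Qed.

Lemma w_exp2lt i j i' j' : (i <= j)%N -> (j' <= i')%N -> (i < j')%N ->
  w_exp i j i' j' = (j == j')%:Z.
Proof.
move=> ij ij' ii; rewrite /w_exp !pi_exp_anti2le; [|lia..].
rewrite !subSS; move: (i' - j')%N => a; lia.
Qed.

Lemma w_exp2ge i j i' j' : (i <= j)%N -> (j' <= i')%N -> (j' <= i)%N -> (i < i')%N ->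
  w_exp i j i' j' = (j == j')%:Z.
Proof.
move=> ij ij' + ii; rewrite leq_eqVlt => /predU1P[e|lt].
  (* For j' = i the pairs in the double difference compare differently in size, so both forms of
     [pi_exp_anti] occur. *)
  rewrite e /w_exp !(@pi_exp_anti2ge i.+1) ?(@pi_exp_anti2le i); [|lia..].
  rewrite !subSS; lia.
rewrite /w_exp !pi_exp_anti2ge; [|lia..].
rewrite !subSS; move: (minn _ (j - i)) (minn _ (j - i)) => a b; lia.
Qed.

Lemma w_expC i j i' j' : w_exp i j i' j' = w_exp j i j' i'.
Proof. by rewrite /w_exp; congr (_ - _ - (_ - _)); apply: pi_exp_antiC. Qed.

Lemma w_exp_row i j l : (j < l)%N -> w_exp i j i l = 1.
Proof.
move=> jl; have [ij|ji] := leqP i j; first by rewrite w_exp1eq //; lia.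
have [il|li] := leqP l i; first by rewrite w_expC w_exp1lt ?eqxx // ltnW.
by rewrite w_expC w_exp2lt ?eqxx // ltnW.
Qed.

Lemma w_exp_below i l j c : (i < l)%N -> w_exp i j l c = (j == c)%:Z.
Proof.
move=> il; have [ij|ji] := leqP i j.
  have [lc|cl] := leqP l c; first by rewrite w_exp1lt.
  have [ci|ic] := leqP c i; first by rewrite w_exp2ge // ltnW.
  by rewrite w_exp2lt // ltnW.
rewrite w_expC; have [lc|cl] := leqP l c.
  by rewrite w_exp2lt ?(ltnW ji) // ?(ltn_trans ji) // (ltn_eqF il) (ltn_eqF (leq_trans ji (leq_trans (ltnW il) lc))).
have [jc|cj|<-] := ltngtP j c; last by rewrite w_exp1eq ?(ltnW ji) ?(ltnW (ltn_trans ji il)).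
  by rewrite w_exp1lt ?(ltnW ji) ?(ltnW cl) // (ltn_eqF il).
by rewrite w_exp1gt ?(ltnW ji) ?(ltnW cl) // (ltn_eqF il).
Qed.

Lemma itv_is_interval p a b : (a < b)%N -> (b <= p)%N -> is_interval (itv p a b).
Proof.
move=> ab bp; have ap : (a < p)%N by lia.
have bp' : (b.-1 < p)%N by lia.
apply/existsP; exists (Ordinal ap); apply/existsP; exists (Ordinal bp') => /=.
apply/andP; split; first by lia.
by apply/eqP/setP => i; rewrite !inE; lia.
Qed.

Lemma itv0_is_initial p b : (b <= p)%N -> is_initial (itv p 0 b).
Proof. by move=> bp; rewrite /is_initial card_itv // subn0; apply/eqP/setP => i; rewrite !inE. Qed.

Lemma pi_rowE m i j : pi_row m i j = itv m (i - minn i j) i. Proof. by []. Qed.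
Lemma pi_colE n i j : pi_col n i j = itv n (j - minn i j) j. Proof. by []. Qed.

Lemma pi_pint m n i j : (0 < i <= m)%N -> (0 < j <= n)%N ->
  exists p : Pint m n, rowset p = pi_row m i j /\ colset p = pi_col n i j.
Proof.
move=> /andP[i0 im] /andP[j0 jn].
have H : is_pint (pi_row m i j, pi_col n i j).
  rewrite /is_pint /= pi_rowE pi_colE !card_itv // !subKn ?geq_minl ?geq_minr // eqxx /=.
  rewrite !itv_is_interval //=; [|lia..].
  case: (leqP i j) => ij; apply/orP; [left|right].
    by rewrite subnn itv0_is_initial.
  by rewrite subnn itv0_is_initial.
by exists (Sub (pi_row m i j, pi_col n i j) H); rewrite SubK.
Qed.

Lemma nb_after_itv p a b a' b' : (a < b)%N -> (b <= p)%N -> (b' <= p)%N ->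
  nb_after (itv p a b) (itv p a' b') = (b' - maxn a' b)%N.
Proof.
move=> ab bp bp'; rewrite /nb_after -(card_itv _ bp'); apply: eq_card => x.
have bp1 : (b.-1 < p)%N by lia.
have -> : (x \in [set x in itv p a' b' | [forall y in itv p a b, (y < x)%N]])
    = (x \in itv p a' b') && (b <= x)%N.
  rewrite inE; congr (_ && _); apply/forall_inP/idP => [/(_ (Ordinal bp1))|bx y].
    by rewrite inE /=; lia.
  by rewrite inE; lia.
by rewrite !inE; lia.
Qed.

Lemma nb_before_itv p a b a' b' : (a < b)%N -> (b <= p)%N -> (b' <= p)%N ->
  nb_before (itv p a b) (itv p a' b') = (minn b' a - a')%N.
Proof.
move=> ab bp bp'; rewrite /nb_before.
have ap : (a < p)%N by lia.
have bp1 : (minn b' a <= p)%N by lia.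
rewrite -(card_itv _ bp1); apply: eq_card => x.
have -> : (x \in [set x in itv p a' b' | [forall y in itv p a b, (x < y)%N]])
    = (x \in itv p a' b') && (x < a)%N.
  rewrite inE; congr (_ && _); apply/forall_inP/idP => [/(_ (Ordinal ap))|bx y].
    by rewrite inE /=; lia.
  by rewrite inE; lia.
by rewrite !inE; lia.
Qed.

(** * From the values of f0 to the weights and back *)

Section WeightRelations.

Variables (m n : nat) (K : fieldType) (q : K) (A : unitAlgType K).
Variable f0 : {set 'I_m} -> {set 'I_n} -> A.
Hypothesis f0_unit : forall p : Pint m n, f0 (rowset p) (colset p) \is a GRing.unit.

(** The default 1 on empty pairs makes [wE] uniform, including the first row and column. *)
Definition pi_val i j : A :=
  if (0 < minn i j)%N then f0 (pi_row m i j) (pi_col n i j) else 1.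

Lemma pi_val_unit i j : (i <= m)%N -> (j <= n)%N -> pi_val i j \is a GRing.unit.
Proof.
move=> im jn; rewrite /pi_val; case: ifP => ij; last exact: unitr1.
have [||p [<- <-]] := @pi_pint m n i j; [lia|lia|exact: f0_unit].
Qed.

Lemma wE i j : w f0 i.+1 j.+1 = (pi_val i j)^-1 * pi_val i.+1 j.+1.
Proof.
rewrite /w /pi_val /= minnSS eqSS; case: posnP => [->|ij].
  by rewrite invr1 mul1r.
by [].
Qed.

Lemma w_unit i j : (0 < i <= m)%N -> (0 < j <= n)%N -> w f0 i j \is a GRing.unit.
Proof.
case: i j => [|i] [|j] //= im jn; rewrite wE.
by rewrite unitrMl ?unitrV ?pi_val_unit // ltnW.
Qed.

(** The quotients defining the weights telescope along a diagonal. *)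
Lemma pi_valE i j : (i <= m)%N -> (j <= n)%N ->
  pi_val i j = \prod_(r < minn i j) w f0 (i - minn i j + r).+1 (j - minn i j + r).+1.
Proof.
have [N] := ubnP (minn i j); elim: N i j => // N IH [|i] [|j] lt im jn; rewrite ?minn0 ?min0n ?big_ord0 //.
rewrite minnSS big_ord_recr /= -[LHS](mulVKr (pi_val_unit (ltnW im) (ltnW jn))) -wE !subSS.
rewrite !subnK ?geq_minl ?geq_minr //; congr (_ * _).
by rewrite IH ?(ltnW im) ?(ltnW jn) //; move: lt; rewrite minnSS.
Qed.

Lemma pint_pi (p : Pint m n) : exists i j,
  [/\ (0 < i <= m)%N, (0 < j <= n)%N, rowset p = pi_row m i j & colset p = pi_col n i j].
Proof.
case: p => -[I J] /= /and4P[/= /eqP cIJ /existsP[a /existsP[b /andP[ab /eqP IE]]]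
  /existsP[c /existsP[d /andP[cd /eqP JE]]]] ini.
have {}IE : I = itv m a b.+1 by rewrite IE; apply/setP => x; rewrite !inE.
have {}JE : J = itv n c d.+1 by rewrite JE; apply/setP => x; rewrite !inE.
have cI : #|I| = (b.+1 - a)%N by rewrite IE card_itv.
have cJ : #|J| = (d.+1 - c)%N by rewrite JE card_itv.
have e : (b.+1 - a = d.+1 - c)%N by rewrite -cI -cJ.
(* Testing initiality at the element 0 shows that one of the two intervals starts there; equal
   lengths then force the form pi(i,j). *)
have ac : minn a c = 0%N.
  case/orP: ini => /eqP/setP => [/(_ (Ordinal (leq_ltn_trans (leq0n a) (ltn_ord a))))
    |/(_ (Ordinal (leq_ltn_trans (leq0n c) (ltn_ord c))))]; rewrite !inE ?cI ?cJ ?IE ?JE ?inE /=; lia.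
exists b.+1, d.+1; rewrite !ltn_ord pi_rowE pi_colE IE JE; split=> //; congr itv; move: ab cd ac e; clear; lia.
Qed.

Hypothesis q0 : q != 0.
Hypothesis f0_qc : quasi_commuting q f0.

Lemma pi_val_qcomm0 i j i' j' : (i <= m)%N -> (j <= n)%N -> (i' <= m)%N -> (j' <= n)%N ->
  (minn i' j' <= minn i j)%N ->
  qcomm (q ^ pi_exp i j i' j') (pi_val i j) (pi_val i' j').
Proof.
move=> im jn im' jn' kk; rewrite {2}/pi_val; case: ifP => ij'; last first.
  rewrite /qcomm mulr1 mul1r pi_exp_eq0 ?expr0z ?scale1r //.
  by apply/eqP; rewrite -leqn0 leqNgt ij'.
rewrite /pi_val ifT; last by apply: leq_trans ij' kk.
have [||p [rp cp]] := @pi_pint m n i j; [lia|lia|].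
have [||p' [rp' cp']] := @pi_pint m n i' j'; [lia|lia|].
have := f0_qc (p := p) (p' := p'); rewrite /qc_exp rp cp rp' cp' !pi_rowE !pi_colE.
have lt a k : (0 < k <= a)%N -> (a - k < a)%N by lia.
have kij : (0 < minn i j)%N by apply: leq_trans ij' kk.
have li := lt i _ (introT andP (conj kij (geq_minl i j))).
have lj := lt j _ (introT andP (conj kij (geq_minr i j))).
rewrite !nb_after_itv ?nb_before_itv ?card_itv // !subKn ?geq_minl ?geq_minr //.
have E1 a b c : (c <= a)%N -> (a - maxn (a - c) b = minn c (a - b))%N by lia.
have E2 a b c : (c <= a)%N -> (minn a b - (a - c) = minn c (b - (a - c)))%N by lia.
by rewrite !E1 ?E2 ?geq_minl ?geq_minr //; apply.
Qed.

Lemma pi_val_qcomm i j i' j' : (i <= m)%N -> (j <= n)%N -> (i' <= m)%N -> (j' <= n)%N ->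
  qcomm (q ^ pi_exp_anti i j i' j') (pi_val i j) (pi_val i' j').
Proof.
move=> im jn im' jn'; rewrite /pi_exp_anti; case: leqP => kk; first exact: pi_val_qcomm0.
rewrite -invr_expz; apply: qcomm_sym; first exact: expfz_neq0.
by apply: pi_val_qcomm0 => //; apply: ltnW.
Qed.

Lemma w_qcomm i j i' j' : (i < m)%N -> (j < n)%N -> (i' < m)%N -> (j' < n)%N ->
  qcomm (q ^ w_exp i j i' j') (w f0 i.+1 j.+1) (w f0 i'.+1 j'.+1).
Proof.
move=> im jn im' jn'.
have ne e : q ^ e != 0 by apply: expfz_neq0.
have H a b : (a <= m)%N -> (b <= n)%N ->
   qcomm (q ^ (pi_exp_anti a b i'.+1 j'.+1 - pi_exp_anti a b i' j')) (pi_val a b) (w f0 i'.+1 j'.+1).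
  move=> am bn; rewrite wE addrC expfzDr // -invr_expz.
  by apply: qcommMr; [apply: qcommVr => //; [exact: pi_val_unit (ltnW _) (ltnW _) |] |]; apply: pi_val_qcomm => //; apply: ltnW.
rewrite /w_exp addrC expfzDr // -invr_expz [X in qcomm _ X _]wE.
by apply: qcommMl; rewrite ?invr_neq0 //; [apply: qcommVl => //; [exact: pi_val_unit (ltnW _) (ltnW _) |] |]; apply: H => //; apply: ltnW.
Qed.

Lemma w_qgrid : qgrid q m (@colw K A n (fun r b => w f0 r.+1 b.+1)).
Proof.
split=> [i j im|i j l im jl|i l j c il lm].
- by apply: w_unit => /=.
- by have := @w_qcomm i j i l im (ltn_ord _) im (ltn_ord _); rewrite w_exp_row // expr1z.
have := @w_qcomm i j l c (ltn_trans il lm) (ltn_ord _) lm (ltn_ord _).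
rewrite w_exp_below // -val_eqE; case: (_ == _); last by rewrite expr0z.
by rewrite expr1z.
Qed.

Lemma minor_pi i j : (0 < i <= m)%N -> (0 < j <= n)%N ->
  minor q (path_mx f0) (pi_row m i j) (pi_col n i j) = f0 (pi_row m i j) (pi_col n i j).
Proof.
move=> /andP[i0 im] /andP[j0 jn]; have n0 : (0 < n)%N by apply: leq_trans jn.
transitivity (pi_val i j); last by rewrite /pi_val leq_min i0 j0.
rewrite path_mx_grid //; last exact: w_unit.
rewrite pi_valE // pi_rowE pi_colE; have gW := w_qgrid.
case: (leqP i j) => ij.
  rewrite subnn -{2}(subnK ij) minor_initial_rows ?subnK //.
rewrite subnn -{2}(subnK (ltnW ij)) minor_initial_cols ?(subnK (ltnW ij)) //.
Qed.

Lemma qminor_pint (p : Pint m n) :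
  qminor q (path_mx f0) (rowset p) (colset p) = f0 (rowset p) (colset p).
Proof.
rewrite qminorE; last by case: p => -[I J] /= /and4P[/eqP].
by have [i [j [im jn -> ->]]] := pint_pi p; apply: minor_pi.
Qed.

Lemma path_mx_fine : (0 < n)%N -> fine_qmatrix q (path_mx f0).
Proof.
by move=> n0; rewrite path_mx_grid //; [apply: path_grid_fine => //; apply: w_qgrid | exact: w_unit].
Qed.

End WeightRelations.

(** * Lowest degree components *)

Section Grading.

Local Open Scope quotient_scope.

Variables (m n : nat) (K : fieldType) (q : K) (A : unitAlgType K).
Variable f0 : {set 'I_m} -> {set 'I_n} -> A.
Hypothesis f0_unit : forall p : Pint m n, f0 (rowset p) (colset p) \is a GRing.unit.
Hypothesis f0_qc : quasi_commuting q f0.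
Variable dg : Pint m n -> int.

Local Notation term := (aterm K (Pint m n * bool)).
Local Notation fv p := (f0 (rowset p) (colset p)).

(** [v : int -> A] stands for a formal series [\sum_e v e z^e], and [act]
    substitutes [f0 p z^(dg p)] for the generator [y_p]. *)
Fixpoint act (s : term) (v : int -> A) : int -> A :=
  match s with
  | TGen (p, false) => fun e => fv p * v (e - dg p)
  | TGen (p, true) => fun e => (fv p)^-1 * v (e + dg p)
  | TZero => fun=> 0
  | TOne => v
  | TAdd s t => fun e => act s v e + act t v e
  | TMul s t => act s (act t v)
  | TScale c t => fun e => c *: act t v e
  end.

Fixpoint teval (s : term) : A :=
  match s with
  | TGen (p, b) => if b then (fv p)^-1 else fv p
  | TZero => 0
  | TOne => 1
  | TAdd s t => teval s + teval t
  | TMul s t => teval s * teval t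
  | TScale c t => c *: teval t
  end.

Lemma actD s v v' : act s (fun e => v e + v' e) = fun e => act s v e + act s v' e.
Proof.
elim: s v v' => [[p []]||| s IHs t IHt|s IHs t IHt|c t IHt] v v' //=; apply/funext => e.
- by rewrite mulrDr.
- by rewrite mulrDr.
- by rewrite addr0.
- by rewrite IHs IHt addrACA.
- by rewrite IHt IHs.
- by rewrite IHt scalerDr.
Qed.

Lemma actZ s c v : act s (fun e => c *: v e) = fun e => c *: act s v e.
Proof.
elim: s v => [[p []]||| s IHs t IHt|s IHs t IHt|d t IHt] v //=; apply/funext => e.
- by rewrite scalerAr.
- by rewrite scalerAr.
- by rewrite scaler0.
- by rewrite IHs IHt scalerDr.
- by rewrite IHt IHs.
- by rewrite IHt !scalerA mulrC.
Qed.

(** The action factors through the quantum torus: the relations hold for the [f0 p] and are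
    homogeneous, so the shifts match as well. *)
Lemma act_cong s t : acong (@LY_rel m n K q) s t -> act s = act t.
Proof.
elim=> {s t} [_ _ [p|p|p p' le]|t|s t _ ->|s t u _ -> _ ->|s s' t t' _ es _ et
  |s s' t t' _ es _ et|c t t' _ et|s t u|s t|t|t|s t u|t|t|s t u|s t u|c d t|t
  |c s t|c d t|c s t|c s t] //=; apply/funext => v; rewrite ?es ?et //; apply/funext => e /=.
- by rewrite mulVKr ?f0_unit // subrK.
- by rewrite mulKr ?f0_unit // addrK.
- rewrite !mulrA f0_qc // -!scalerAl; congr (_ *: (_ * v _)).
  by rewrite addrAC.
- by rewrite addrA.
- by rewrite addrC.
- by rewrite add0r.
- by rewrite scaleN1r addNr.
- by rewrite actD.
- by rewrite scalerA.
- by rewrite scale1r.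
- by rewrite scalerDr.
- by rewrite scalerDl.
- by rewrite actZ.
Qed.

(** Quantifying over all series makes the property multiplicative by composition, with no
    convolution of components. *)
Definition low (s : term) (d : int) (u : A) : Prop :=
  forall v e, (forall e', e' < e -> v e' = 0) ->
    (forall e', e' < e + d -> act s v e' = 0) /\ act s v (e + d) = u * v e.

(** [a] is the value of a Laurent polynomial in the generators all of whose
    terms have degree at least [d], with component [u] (possibly 0) in degree [d]. *)
Definition lead (d : int) (u a : A) : Prop := exists2 s, teval s = a & low s d u.

Lemma lead1 : lead 0 1 1.
Proof. by exists TOne => // v e v0 /=; rewrite addr0 mul1r. Qed.

Lemma lead0 d : lead d 0 0.
Proof. by exists TZero => // v e v0 /=; rewrite mul0r. Qed.

Lemma low_mul s t d d' u u' : low s d u -> low t d' u' -> low (TMul s t) (d + d') (u * u').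
Proof.
move=> ls lt v e v0 /=; have [t0 tE] := lt v e v0; have [s0 sE] := ls _ _ t0.
rewrite addrA [e + d + d']addrAC; split; first exact: s0.
by rewrite sE tE mulrA.
Qed.

Lemma leadM d d' u u' a a' : lead d u a -> lead d' u' a' -> lead (d + d') (u * u') (a * a').
Proof. by move=> [s <- ls] [t <- lt]; exists (TMul s t) => //; apply: low_mul. Qed.

Lemma leadD d u u' a a' : lead d u a -> lead d u' a' -> lead d (u + u') (a + a').
Proof.
move=> [s <- ls] [t <- lt]; exists (TAdd s t) => // v e v0 /=.
have [t0 tE] := lt v e v0; have [s0 sE] := ls v e v0.
split; last by rewrite sE tE mulrDl.
by move=> e' lte; rewrite s0 ?t0 ?addr0.
Qed.

Lemma leadZ c d u a : lead d u a -> lead d (c *: u) (c *: a).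
Proof.
move=> [s <- ls]; exists (TScale c s) => // v e v0 /=; have [s0 sE] := ls v e v0.
split; last by rewrite sE scalerAl.
by move=> e' lte; rewrite s0 ?scaler0.
Qed.

Lemma lead_weak d d' u a : d' < d -> lead d u a -> lead d' 0 a.
Proof.
move=> dd [s <- ls]; exists s => // v e v0; have [s0 _] := ls v e v0.
split; last by rewrite s0 ?mul0r // ltrD2l.
by move=> e' lte; rewrite s0 // (lt_trans lte) // ltrD2l.
Qed.

Lemma lead_sum0 (I : finType) (P : pred I) d (F : I -> A) :
  (forall i, P i -> lead d 0 (F i)) -> lead d 0 (\sum_(i | P i) F i).
Proof.
move=> H; elim/big_rec: _ => [|i x Pi xL]; first exact: lead0.
by rewrite -[0]addr0; apply: leadD => //; apply: H.
Qed.

Lemma lead_gen p : lead (dg p) (fv p) (fv p).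
Proof.
exists (TGen (p, false)) => // v e v0 /=; split; last by rewrite addrK.
by move=> e' lte; rewrite v0 ?mulr0 // ltrBlDr.
Qed.

Lemma lead_genV p : lead (- dg p) (fv p)^-1 (fv p)^-1.
Proof.
exists (TGen (p, true)) => // v e v0 /=; split; last by rewrite subrK.
by move=> e' lte; rewrite v0 ?mulr0 // -ltrBrDr.
Qed.

(** On constant series the shifts disappear: this is the specialization z = 1, which recovers the
    value in [A]. *)
Lemma act_const s a e : act s (fun=> a) e = teval s * a.
Proof.
elim: s a e => [[p []]||| s IHs t IHt|s IHs t IHt|c t IHt] a e //=.
- by rewrite mul0r.
- by rewrite mul1r.
- by rewrite IHs IHt mulrDl.
- rewrite (_ : act t (fun=> a) = fun=> teval t * a); last by apply/funext => e'; exact: IHt.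
  by rewrite IHs mulrA.
- by rewrite IHt scalerAl.
Qed.

Lemma act_monomials s : exists l : seq (int * A),
  forall v e, act s v e = \sum_(x <- l) x.2 * v (e - x.1).
Proof.
elim: s => [[p []]|||s [ls sE] t [lt tE]|s [ls sE] t [lt tE]|c t [lt tE]].
- by exists [:: (- dg p, (fv p)^-1)] => v e; rewrite big_seq1 /= opprK.
- by exists [:: (dg p, fv p)] => v e; rewrite big_seq1.
- by exists [::] => v e; rewrite big_nil.
- by exists [:: (0, 1)] => v e; rewrite big_seq1 /= mul1r subr0.
- by exists (ls ++ lt) => v e /=; rewrite sE tE big_cat.
- exists [seq (p.1.1 + p.2.1, p.1.2 * p.2.2) | p <- [seq (x, y) | x <- ls, y <- lt]] => v e /=.
  rewrite sE big_map big_allpairs /=; apply: eq_bigr => x _; rewrite tE mulr_sumr.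
  by apply: eq_bigr => y _; rewrite /= mulrA opprD addrA.
exists [seq (x.1, c *: x.2) | x <- lt] => v e /=.
by rewrite tE big_map scaler_sumr; apply: eq_bigr => x _; rewrite /= scalerAl.
Qed.

(** Collect the monomials of least degree. If their coefficients cancel, delete them and recurse;
    the nonzero total survives the deletion, so some component is eventually nonzero. *)
Lemma monomials_low (l : seq (int * A)) : \sum_(x <- l) x.2 != 0 ->
  exists k c, c != 0 /\ forall v e, (forall e', e' < e -> v e' = 0) ->
    (forall e', e' < e + k -> \sum_(x <- l) x.2 * v (e' - x.1) = 0)
    /\ \sum_(x <- l) x.2 * v (e + k - x.1) = c * v e.
Proof.
have [N] := ubnP (size l); elim: N l => // N IH l lN l0.
have [k [kl kmin]] : exists k, has (fun x => x.1 == k) l /\ forall x, x \in l -> k <= x.1.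
  case: l l0 {lN IH} => [|x l _]; first by rewrite big_nil eqxx.
  elim: l x => [|y l IHl] x; first by exists x.1; rewrite /= eqxx; split=> // y; rewrite inE => /eqP ->.
  have [k [kl kmin]] := IHl y; exists (Num.min x.1 k); split.
    by rewrite minElt; case: ifP => _; rewrite /= ?eqxx //; move: kl => /= ->; rewrite orbT.
  by move=> z; rewrite inE => /predU1P[->|/kmin]; rewrite ge_min ?lexx // => ->; rewrite orbT.
have split_sum v e : \sum_(x <- l) x.2 * v (e - x.1) =
   (\sum_(x <- l | x.1 == k) x.2) * v (e - k) + \sum_(x <- [seq x <- l | x.1 != k]) x.2 * v (e - x.1).
  rewrite (bigID (fun x : int * A => x.1 == k)) /= big_filter mulr_suml; congr (_ + _).
  by apply: eq_bigr => x /eqP ->.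
have [c0|c0] := eqVneq (\sum_(x <- l | x.1 == k) x.2) 0.
  have [| |k' [c [cn H]]] := IH [seq x <- l | x.1 != k].
  - rewrite ltnS in lN; rewrite size_filter (leq_trans _ lN) // -(count_predC (fun x : int * A => x.1 == k) l).
    by rewrite -addn1 addnC leq_add2r -has_count.
  - have := split_sum (fun=> 1) 0; rewrite c0 mul0r add0r.
    have E (l' : seq (int * A)) : \sum_(x <- l') x.2 * 1 = \sum_(x <- l') x.2.
      by apply: eq_bigr => x _; rewrite mulr1.
    by rewrite !E => <-.
  exists k', c; split=> // v e v0; have [H1 H2] := H v e v0.
  by split=> [e' lte|]; rewrite split_sum c0 mul0r add0r; do ?[exact: H1 | exact: H2].
exists k, (\sum_(x <- l | x.1 == k) x.2); split=> // v e v0.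
split=> [e' lte|].
  rewrite big_seq big1 // => x /kmin kx; rewrite v0 ?mulr0 //.
  by rewrite ltrBlDr (lt_le_trans lte) // lerD2l.
rewrite split_sum addrK [X in _ + X]big_filter [X in _ + X]big_seq_cond [X in _ + X]big1 ?addr0 // => x /andP[/kmin kx xk].
by rewrite v0 ?mulr0 // ltrBlDr ltrD2l lt_neqAle eq_sym xk.
Qed.

Lemma lead_exists s : teval s != 0 -> exists k c, c != 0 /\ low s k c.
Proof.
have [l lE] := act_monomials s; have /eqP := act_const s 1 0; rewrite lE mulr1.
under eq_bigr do rewrite mulr1.
move=> /eqP <- /monomials_low[k [c [c0 H]]]; exists k, c; split=> // v e v0.
have [H1 H2] := H v e v0; split; last by rewrite lE.
by move=> e' lte; rewrite lE H1.
Qed.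

Hypothesis f0_indep : alg_independent q f0.

Lemma teval_rmorph (phi : {rmorphism LY m n q -> A}) : scalable phi ->
  (forall p : Pint m n, phi (LY_y q p) = fv p) ->
  forall s : term, phi (\pi_(palg (@LY_rel m n K q)) s) = teval s.
Proof.
move=> phiZ phiy; elim=> [[p []]|||s IHs t IHt|s IHs t IHt|c t IHt].
- rewrite /=; apply: (mulrI (f0_unit p)); rewrite mulrV // -phiy -rmorphM -(rmorph1 phi).
  congr (phi _); rewrite [LHS]pmulE; apply/palgP.
  by apply: acong_rel; apply: LY_mulV.
- exact: phiy.
- exact: rmorph0.
- exact: rmorph1.
- by rewrite -paddE [LHS]rmorphD IHs IHt.
- by rewrite -pmulE [LHS]rmorphM IHs IHt.
by rewrite -pscaleE [LHS]phiZ IHt.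
Qed.

(** Independence turns a vanishing value into a congruence of terms, which [act] respects; hence
    lowest components depend only on the value. *)
Lemma teval_eq0 s : teval s = 0 -> act s = act TZero.
Proof.
have [phi [phiZ phiy phiI _]] := f0_indep; move=> s0; apply: act_cong; apply/palgP.
by apply: phiI; rewrite !teval_rmorph.
Qed.

(** Apply the term to the series concentrated in degree 0 with value 1. *)
Lemma low_uniq0 s d u : teval s = 0 -> low s d u -> u = 0.
Proof.
move=> /teval_eq0 s0 ls; have [|_] := ls (fun e => (e == 0)%:R) 0.
  by move=> e' lte; rewrite (lt_eqF lte).
by rewrite s0 eqxx mulr1.
Qed.

Lemma subalgP a : subalg_f0 f0 a <-> exists s, teval s = a.
Proof.
have [phi [phiZ phiy phiI phiS]] := f0_indep; rewrite phiS; split=> [[u <-]|[s <-]].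
  by exists (repr u); rewrite -(teval_rmorph phiZ phiy) reprK.
by exists (\pi_(palg (@LY_rel m n K q)) s); rewrite teval_rmorph.
Qed.

Hypothesis f0_zerodiv : forall a : A, subalg_f0 f0 a ->
  zerodivisor_in (fun _ => True) a -> zerodivisor_in (subalg_f0 f0) a.

Lemma lead_regular d u a : u \is a GRing.unit -> lead d u a -> forall y, a * y = 0 -> y = 0.
Proof.
move=> uU [s sE ls] y ay; apply: contrapT => y0.
have aS : subalg_f0 f0 a by apply/subalgP; exists s.
have [_ [x [/subalgP[t tE] /eqP x0 axa]]] : zerodivisor_in (subalg_f0 f0) a.
  by apply: f0_zerodiv => //; split=> //; exists y; split=> //; left.
rewrite -tE in x0; have [k [c [/eqP c0 lc]]] := lead_exists x0.
(* The zero product has [u * c] or [c * u] as a component, so that component vanishes; the unit [u]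
   then forces c = 0. Both sides are treated because (ii) does not say on which side [a]
   annihilates. *)
apply: c0; case: axa => xa.
  apply: (mulrI uU); rewrite mulr0; apply: low_uniq0 (low_mul ls lc).
  by rewrite /= sE tE.
apply: (mulIr uU); rewrite mul0r; apply: low_uniq0 (low_mul lc ls).
by rewrite /= sE tE.
Qed.

End Grading.

(** * Monge degrees and leading terms of minors *)

Definition monge (phi : nat -> nat -> int) : Prop :=
  forall i r j b : nat, (r < i)%N -> (b < j)%N ->
    phi i j + phi r b < phi i b + phi r j.

Fixpoint diag_weight (phi : nat -> nat -> int) (s t : seq nat) : int :=
  match s, t with
  | i :: s', j :: t' => phi i j + diag_weight phi s' t'
  | _, _ => 0
  end.

(** Among the ways of matching rows with columns, the diagonal is the cheapest. *)
Lemma diag_weight_min phi i j c (s t1 t2 : seq nat) : monge phi ->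
  path ltn i s -> path ltn j (t1 ++ c :: t2) -> size s = (size t1 + size t2).+1 ->
  diag_weight phi (i :: s) (j :: t1 ++ c :: t2)
  < phi i c + diag_weight phi s (j :: t1 ++ t2).
Proof.
move=> M; elim: t1 i j s => [|j1 t1 IH] i j [|i1 s] //= /andP[ii1 si] /andP[jc tj] [sz].
  have := M i1 i c j ii1 jc; lia.
have jc' : (j < c)%N.
  have := order_path_min ltn_trans (x := j) (s := j1 :: t1 ++ c :: t2); rewrite /= jc tj => /(_ isT)/andP[_ /allP].
  by apply; rewrite mem_cat inE eqxx orbT.
have := IH i1 j1 s si tj; rewrite sz => /(_ erefl) /=.
by have := M i1 i c j ii1 jc'; lia.
Qed.

Section Leading.

Variables (m n : nat) (K : fieldType) (q : K) (A : unitAlgType K).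
Variable f0 : {set 'I_m} -> {set 'I_n} -> A.
Variable dg : Pint m n -> int.
Local Notation lead := (lead f0 dg).

(** The leading path follows row [i] to column [j] and then only vertical edges. Moving from b < j
    to [j] in row 0 gives degree phi(i,b) - phi(0,b) + phi(0,j), strictly above phi(i,j) by the
    Monge inequality. *)
Lemma lead_path_row phi (v : nat -> 'I_n -> A) i (j : 'I_n) : monge phi ->
  (forall r b, (r <= i)%N -> v r b \is a GRing.unit) ->
  (forall r (b : 'I_n), (r <= i)%N -> lead (phi r b) (v r b) (v r b)) ->
  (forall r (b : 'I_n), (r <= i)%N -> lead (- phi r b) (v r b)^-1 (v r b)^-1) ->
  lead (phi i j) (v i j) (path_row v i 0 j).
Proof.
elim: i phi v j => [|i IH] phi v j M U L LV; first by rewrite mxE; apply: L.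
have LX (b : 'I_n) : lead (phi i.+1 b) (v i.+1 b) (path_row (v \o S) i 0 b).
  apply: (IH (fun r => phi r.+1)) => [i' r' j' b' ri bj|r c ri|r c ri|r c ri].
  - exact: M.
  - exact: U.
  - exact: L.
  - exact: LV.
rewrite path_rowS (bigD1 j) //= mulVr ?U // mulr1 -[X in lead _ X _]addr0; apply: leadD => //.
apply: lead_sum0 => b /andP[bj bj']; have {bj bj'} bj : (b < j)%N by rewrite ltn_neqAle bj' bj.
have := leadM (LX b) (leadM (LV 0%N b (leq0n _)) (L 0%N j (leq0n _))).
by apply: lead_weak; have := M i.+1 0%N j b (ltn0Sn _) bj; lia.
Qed.

Lemma lead_wedges phi (X : 'M[A]_(m, n)) (u : 'I_m -> 'I_n -> A) (s : seq 'I_m) (J : {set 'I_n}) :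
  monge phi -> (forall i j, u i j \is a GRing.unit) ->
  (forall (i : 'I_m) (j : 'I_n), lead (phi i j) (u i j) (X i j)) ->
  sorted ltn (map val s) -> size s = #|J| ->
  exists2 c, c \is a GRing.unit
    & lead (diag_weight phi (map val s) (map val (enum J))) c (wedges q X s J).
Proof.
move=> M U L; elim: s J => [|i s IH] J /=.
  move=> _ /esym/eqP; rewrite cards_eq0 => /eqP ->; exists 1; first exact: unitr1.
  by rewrite /wedge0 eqxx; apply: lead1.
move=> si sz; have J0 : J != set0 by rewrite -card_gt0 -sz.
have [j jJ jmin] := setmin J0.
have srt : sorted ltn (map val (enum J)).
  rewrite enum_setE sorted_map; apply: sorted_filter; first by move=> ? ? ?; apply: ltn_trans.
  by rewrite -sorted_map val_enum_ord iota_ltn_sorted.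
have [s1 [t [eD eJ lt1 _ _]]] := enum_mem_split jJ.
have s10 : s1 = [::].
  case: s1 lt1 eD {eJ} => // a s1 /(_ a); rewrite inE eqxx => /(_ isT) aj eD.
  have : a \in enum (J :\ j) by rewrite eD inE eqxx.
  by rewrite mem_enum inE => /andP[_ /jmin]; rewrite leqNgt aj.
rewrite s10 /= in eD eJ.
have szD c : c \in J -> size s = #|J :\ c| by move=> cJ; apply/eqP; rewrite -eqSS sz (cardsD1 c J) cJ.
have [e eU eL] := IH _ (path_sorted si) (szD j jJ).
exists (u i j * e); first by rewrite unitrMl.
rewrite /wedgel (bigD1 j) //= nlt_below // expr0 scale1r -[X in lead _ X _]addr0; apply: leadD.
  by rewrite eJ -eD /=; apply: leadM.
(* Choosing any column but the smallest for the first row is strictly more expensive by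
   [diag_weight_min], so these terms do not reach the leading degree. *)
apply: lead_sum0 => c /andP[cJ cj];
suff H : lead (diag_weight phi (val i :: map val s) (map val (enum J))) 0 (X i c * wedges q X s (J :\ c)).
  by have := leadZ ((- q) ^+ nlt J c) H; rewrite scaler0.
have [e' _ eL'] := IH _ (path_sorted si) (szD c cJ).
have := leadM (L i c) eL'; apply: lead_weak.
have [r1 [r2 [eD' eJ' _ _ _]]] := enum_mem_split cJ.
case: r1 eD' eJ' => [|a r1] eD' eJ'; first by move: eJ'; rewrite eJ => -[/esym/eqP]; rewrite (negPf cj).
have ja : a = j by move: eJ'; rewrite eJ => -[].
rewrite eJ' eD' /= !map_cat /= ja; apply: diag_weight_min => //.
  by move: srt; rewrite eJ' /= map_cat /= ja.
rewrite !size_map; have := szD c cJ; rewrite cardE eD' /= size_cat; lia.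
Qed.

Lemma lead_minor phi (X : 'M[A]_(m, n)) (u : 'I_m -> 'I_n -> A) (I : {set 'I_m}) (J : {set 'I_n}) :
  monge phi -> (forall i j, u i j \is a GRing.unit) ->
  (forall (i : 'I_m) (j : 'I_n), lead (phi i j) (u i j) (X i j)) -> #|I| = #|J| ->
  exists d c, c \is a GRing.unit /\ lead d c (minor q X I J).
Proof.
move=> M U L cIJ; have [||c cU cL] := @lead_wedges phi X u (enum I) J M U L.
- rewrite enum_setE sorted_map; apply: sorted_filter; first by move=> ? ? ?; apply: ltn_trans.
  by rewrite -sorted_map val_enum_ord iota_ltn_sorted.
- by rewrite -cardE.
by exists (diag_weight phi (map val (enum I)) (map val (enum J))), c.
Qed.

End Leading.

(** Recovers the 1-based corner (i,j) from the two sets of pi(i,j), so that [pint_deg] is defined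
    directly on pairs. *)
Definition set_end p (I : {set 'I_p}) : nat := \max_(i in I) i.+1.

Lemma set_end_itv p a b : (a < b)%N -> (b <= p)%N -> set_end (itv p a b) = b.
Proof.
move=> ab bp; have bp1 : (b.-1 < p)%N by lia.
rewrite /set_end; apply/eqP; rewrite eqn_leq; apply/andP; split.
  by apply/bigmax_leqP => i; rewrite inE => /andP[].
have bI : Ordinal bp1 \in itv p a b by rewrite inE /=; lia.
rewrite (bigD1 _ bI) /= leq_max; apply/orP; left; lia.
Qed.

(** The degree of [f0] on [pi(i,j)], chosen so that [w(i,j)] has degree [(i-j)^2]. *)
Definition pi_deg (i j : nat) : int := (minn i j)%:Z * (i%:Z - j%:Z) ^+ 2.

Definition pint_deg m n (p : Pint m n) : int :=
  (#|rowset p|)%:Z * ((set_end (rowset p))%:Z - (set_end (colset p))%:Z) ^+ 2.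

Definition w_deg (i j : nat) : int := (i%:Z - j%:Z) ^+ 2.

(** Any strictly convex function of i - j is strictly Monge; for the square the gap is 2 (i - r) (j
    - b). *)
Lemma monge_w_deg : monge w_deg.
Proof.
move=> i r j b ri bj; rewrite /w_deg -subr_gt0.
have -> : (i%:Z - b%:Z) ^+ 2 + (r%:Z - j%:Z) ^+ 2 - ((i%:Z - j%:Z) ^+ 2 + (r%:Z - b%:Z) ^+ 2)
  = 2 * ((i%:Z - r%:Z) * (j%:Z - b%:Z)) by ring.
by rewrite !mulr_gt0 // subr_gt0 ltz_nat.
Qed.

Section PathRegular.

Variables (m n : nat) (K : fieldType) (q : K) (A : unitAlgType K).
Variable f0 : {set 'I_m} -> {set 'I_n} -> A.
Hypothesis n0 : (0 < n)%N.
Hypothesis f0_unit : forall p : Pint m n, f0 (rowset p) (colset p) \is a GRing.unit.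
Hypothesis f0_qc : quasi_commuting q f0.
Hypothesis f0_indep : alg_independent q f0.
Hypothesis f0_zerodiv : forall a : A, subalg_f0 f0 a ->
  zerodivisor_in (fun _ => True) a -> zerodivisor_in (subalg_f0 f0) a.

Local Notation lead := (lead f0 (@pint_deg m n)).

Lemma pint_deg_pi (p : Pint m n) i j : (0 < i <= m)%N -> (0 < j <= n)%N ->
  rowset p = pi_row m i j -> colset p = pi_col n i j -> pint_deg p = pi_deg i j.
Proof.
move=> /andP[i0 im] /andP[j0 jn] rp cp; rewrite /pint_deg rp cp pi_rowE pi_colE.
by rewrite card_itv // !set_end_itv // ?subKn ?geq_minl //; lia.
Qed.

Lemma lead_pi_val i j : (i <= m)%N -> (j <= n)%N ->
  lead (pi_deg i j) (pi_val f0 i j) (pi_val f0 i j) /\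
  lead (- pi_deg i j) (pi_val f0 i j)^-1 (pi_val f0 i j)^-1.
Proof.
move=> im jn; rewrite /pi_val; case: posnP => [ij|ij].
  by rewrite /pi_deg ij mul0r oppr0 invr1; split; apply: lead1.
have i0 : (0 < i <= m)%N by lia.
have j0 : (0 < j <= n)%N by lia.
have [p [rp cp]] := pi_pint i0 j0; rewrite -(pint_deg_pi i0 j0 rp cp) -rp -cp.
by split; [apply: lead_gen | apply: lead_genV].
Qed.

Lemma w_deg_pi i j : w_deg i j = - pi_deg i j + pi_deg i.+1 j.+1.
Proof. by rewrite /w_deg /pi_deg minnSS -addn1 -[j.+1]addn1 -[(minn i j).+1]addn1 !PoszD; ring. Qed.

Lemma lead_w i j : (i < m)%N -> (j < n)%N ->
  lead (w_deg i j) (w f0 i.+1 j.+1) (w f0 i.+1 j.+1) /\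
  lead (- w_deg i j) (w f0 i.+1 j.+1)^-1 (w f0 i.+1 j.+1)^-1.
Proof.
move=> im jn; have [l1 l1V] := lead_pi_val im jn.
have [l0 l0V] := lead_pi_val (ltnW im) (ltnW jn).
have u0 := pi_val_unit f0_unit (ltnW im) (ltnW jn).
have u1 := pi_val_unit f0_unit im jn.
rewrite w_deg_pi wE; split; first exact: leadM.
by rewrite invrM ?unitrV // invrK opprD opprK addrC; apply: leadM.
Qed.

Lemma minor_path_regular (I : {set 'I_m}) (J : {set 'I_n}) : #|I| = #|J| ->
  forall y, minor q (path_mx f0) I J * y = 0 -> y = 0.
Proof.
move=> cIJ; have wU := w_unit f0_unit.
have [||d [c [cU cL]]] := @lead_minor m n K q A f0 (@pint_deg m n) w_deg (path_mx f0)
  (fun i j => w f0 i.+1 j.+1) I J monge_w_deg _ _ cIJ.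
- by move=> i j; apply: wU => /=.
- move=> i j; rewrite path_mx_grid // path_gridE.
  apply: (@lead_path_row m n K A f0 (@pint_deg m n) w_deg (@colw K A n (fun r b => w f0 r.+1 b.+1)) i j monge_w_deg) => r b ri.
  + by apply: wU => //=; apply: leq_ltn_trans ri (ltn_ord i).
  + by have [] := @lead_w r b (leq_ltn_trans ri (ltn_ord i)) (ltn_ord b).
  + by have [] := @lead_w r b (leq_ltn_trans ri (ltn_ord i)) (ltn_ord b).
exact: (lead_regular f0_unit f0_qc f0_indep f0_zerodiv cU cL).
Qed.

End PathRegular.

(** * Uniqueness *)

(** Its cardinality is the spread of the induction; its fixed points are the intervals and the empty
    set. *)
Definition hull p (I : {set 'I_p}) : {set 'I_p} :=
  [set a : 'I_p | [exists i in I, (i <= a)%N] && [exists k in I, (a <= k)%N]].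

Lemma sub_hull p (I : {set 'I_p}) : I \subset hull I.
Proof.
apply/subsetP => a aI; rewrite inE; apply/andP.
by split; apply/exists_inP; exists a.
Qed.

Lemma hull_proper p (I B : {set 'I_p}) (x : 'I_p) : B \subset hull I -> x \in I ->
  (forall b, b \in B -> (b < x)%N) \/ (forall b, b \in B -> (x < b)%N) ->
  (#|hull B| < #|hull I|)%N.
Proof.
move=> BI xI xB; apply: proper_card; apply/properP; split; last first.
  exists x; first exact: (subsetP (sub_hull I)).
  rewrite inE; apply/negP => /andP[/exists_inP[i iB ix] /exists_inP[k kB xk]].
  by case: xB => [/(_ _ kB)|/(_ _ iB)]; lia.
apply/subsetP => a; rewrite inE => /andP[/exists_inP[i iB ia] /exists_inP[k kB ak]].
have := subsetP BI _ iB; rewrite inE => /andP[/exists_inP[i' iI ii] _].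
have := subsetP BI _ kB; rewrite inE => /andP[_ /exists_inP[k' kI kk]].
rewrite inE; apply/andP; split; apply/exists_inP; [exists i' | exists k'] => //; lia.
Qed.

Section Uniqueness.

Variables (K : fieldType) (A : algType K).

(** A weaker form of [RQI_P]: the row [j] fills a gap between the ends [i] and [k], as in the
    induction below. *)
Definition P_extreme m n (h : {set 'I_m} -> {set 'I_n} -> A) : Prop :=
  forall (S : {set 'I_m}) (J : {set 'I_n}) (i j k : 'I_m) (l : 'I_n),
  (forall a, a \in S -> (i < a < k)%N) -> j \notin S -> (i < j < k)%N -> l \notin J ->
  #|S|.+1 = #|J| ->
  h (j |: S) J * h (i |: (k |: S)) (l |: J)
  = h (i |: (j |: S)) (l |: J) * h (k |: S) J
  + h (j |: (k |: S)) (l |: J) * h (i |: S) J.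

Definition regular_fun m n (h : {set 'I_m} -> {set 'I_n} -> A) : Prop :=
  forall (I : {set 'I_m}) (J : {set 'I_n}), #|I| = #|J| -> forall y, h I J * y = 0 -> y = 0.

(** Take [i] and [k] to be the ends of [I] and [j] a gap. Replacing an end by [j] shrinks the hull,
    and the other three values have smaller size. Stated for rows only, it applies to columns after
    exchanging the arguments. *)
Lemma RQI_P_step m n (g h : {set 'I_m} -> {set 'I_n} -> A) (I : {set 'I_m}) (J : {set 'I_n}) :
  RQI_P g -> P_extreme h -> regular_fun h -> #|I| = #|J| -> hull I != I ->
  (forall (I' : {set 'I_m}) (J' : {set 'I_n}), #|I'| = #|J'| -> (#|I'| < #|I|)%N -> g I' J' = h I' J') ->
  (forall I' : {set 'I_m}, #|I'| = #|I| -> (#|hull I'| < #|hull I|)%N -> g I' J = h I' J) ->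
  g I J = h I J.
Proof.
move=> gP hP hR cIJ hI IH1 IH2.
have [j jh jI] : exists2 j, j \in hull I & j \notin I.
  have : ~~ (hull I \subset I) by apply: contra hI => H; rewrite eqEsubset H sub_hull.
  by case/subsetPn => j; exists j.
have I0 : I != set0.
  by apply: contraTneq jh => ->; rewrite inE; apply/negP => /andP[/exists_inP[x]]; rewrite inE.
have [i iI imin] := setmin I0; have [k kI kmax] := setmax I0.
move: (jh); rewrite inE => /andP[/exists_inP[x xI xj] /exists_inP[y yI jy]].
have neqj z : z \in I -> (z != j) by apply: contraTneq => ->.
have ij : (i < j)%N.
  by rewrite ltn_neqAle (leq_trans (imin _ xI) xj) andbT; apply: neqj.
have jk : (j < k)%N.
  by rewrite ltn_neqAle (leq_trans jy (kmax _ yI)) andbT eq_sym; apply: neqj.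
have ik := ltn_trans ij jk.
pose S := I :\ i :\ k.
have kIi : k \in I :\ i by rewrite !inE kI andbT; apply: contraTneq ik => ->; rewrite ltnn.
have SE : I = i |: (k |: S) by rewrite setD1K // setD1K.
have cS : #|I| = #|S|.+2 by rewrite (cardsD1 i I) iI (cardsD1 k) kIi.
have Sin a : a \in S -> (i < a < k)%N.
  rewrite !inE => /and3P[ak ai aI]; rewrite !ltn_neqAle imin ?kmax // !andbT ak andbT.
  by rewrite eq_sym.
have jS : j \notin S by rewrite !inE (negPf jI) !andbF.
have iS : i \notin S by apply/negP => /Sin; rewrite ltnn.
have kS : k \notin S by apply/negP => /Sin; rewrite ltnn andbF.
have J0 : J != set0 by rewrite -card_gt0 -cIJ cS.
have [l lJ] := set0Pn _ J0; pose L := J :\ l.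
have JE : J = l |: L by rewrite setD1K.
have lL : l \notin L by rewrite !inE eqxx.
have cL : #|S|.+1 = #|L| by apply/eqP; rewrite -eqSS -cS cIJ (cardsD1 l J) lJ.
have gE := gP S L i j k l iS jS kS lL ij jk cL.
have hE := hP S L i j k l Sin jS (introT andP (conj ij jk)) lL cL.
have SU x1 : S :|: [set x1] = x1 |: S by rewrite setUC.
have SU2 x1 x2 : S :|: [set x1; x2] = x1 |: (x2 |: S) by rewrite setUC -setUA.
have LU : L :|: [set l] = J by rewrite setUC -JE.
move: gE hE; rewrite !SU !SU2 LU -JE -SE => gE hE.
have inI z : z \in I -> z \in hull I by apply: (subsetP (sub_hull I)).
have SI z : z \in S -> z \in I by rewrite !inE => /and3P[].
have ne (z1 z2 : 'I_m) : (z1 < z2)%N -> (z1 == z2) = false by move=> lt; apply: contraTF lt => /eqP ->; rewrite ltnn.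
have small x1 : x1 \notin S -> g (x1 |: S) L = h (x1 |: S) L.
  by move=> x1S; apply: IH1; rewrite ?cardsU1 x1S ?cS.
have e1 : g (i |: (j |: S)) J = h (i |: (j |: S)) J.
  apply: IH2; first by rewrite !cardsU1 !in_setU1 (negPf iS) (ne i j) // jS cS.
  apply: (hull_proper _ kI).
    by apply/subsetP => z; rewrite !in_setU1 => /or3P[/eqP->|/eqP->|/SI/inI] //; apply: inI.
  by left => z; rewrite !in_setU1 => /or3P[/eqP->|/eqP->|/Sin/andP[]].
have e2 : g (j |: (k |: S)) J = h (j |: (k |: S)) J.
  apply: IH2; first by rewrite !cardsU1 !in_setU1 (negPf jS) (ne j k) // kS cS.
  apply: (hull_proper _ iI).
    by apply/subsetP => z; rewrite !in_setU1 => /or3P[/eqP->|/eqP->|/SI/inI] //; apply: inI.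
  by right => z; rewrite !in_setU1 => /or3P[/eqP->|/eqP->|/Sin/andP[]].
(* All values but the one at (I|J) now agree, and it stands to the right of the regular factor at (j
   |: S | L). *)
move: gE; rewrite e1 e2 !small // -hE => /eqP; rewrite -subr_eq0 -mulrBr => /eqP/hR.
by rewrite cardsU1 jS add1n cL => /(_ erefl) /eqP; rewrite subr_eq0 => /eqP.
Qed.

Lemma hull_itv p (I : {set 'I_p}) : hull I = I -> exists a b, (b <= p)%N /\ I = itv p a b.
Proof.
move=> hI; have [->|I0] := eqVneq I set0; first by exists 0%N, 0%N; rewrite itv_empty.
have [i iI imin] := setmin I0; have [k kI kmax] := setmax I0.
exists i, k.+1; split=> //; apply/setP => x; rewrite -{1}hI !inE ltnS.
apply/andP/andP => [[/exists_inP[y yI yx] /exists_inP[z zI xz]]|[ix xk]].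
  by rewrite (leq_trans (imin _ yI)) // (leq_trans xz) ?kmax.
by split; apply/exists_inP; [exists i | exists k].
Qed.

(** (D) expresses the value at the lower right block. The blocks of smaller starting sum are known
    by the outer induction, the shorter block with the same start by the inner one; a block touching
    a side is some pi(i,j). *)
Lemma RQI_D_itv m n (q : K) (g h : {set 'I_m} -> {set 'I_n} -> A) :
  RQI_D q g -> RQI_D q h -> regular_fun h -> g set0 set0 = h set0 set0 ->
  (forall i j, (0 < i <= m)%N -> (0 < j <= n)%N ->
     g (pi_row m i j) (pi_col n i j) = h (pi_row m i j) (pi_col n i j)) ->
  forall a b s, (a + s <= m)%N -> (b + s <= n)%N ->
    g (itv m a (a + s)) (itv n b (b + s)) = h (itv m a (a + s)) (itv n b (b + s)).
Proof.
move=> gD hD hR gh0 ghpi a b s.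
have [N] := ubnP (a + b); elim: N a b s => // N IH a b s abN.
elim: s => [|s IHs]; first by rewrite !addn0 !itv_empty.
move=> am bn; have [ab0|ab] := posnP (minn a b).
  have i0 : (0 < a + s.+1 <= m)%N by rewrite am addnS.
  have j0 : (0 < b + s.+1 <= n)%N by rewrite bn addnS.
  have := ghpi _ _ i0 j0; rewrite pi_rowE pi_colE -addn_minl ab0 add0n.
  by rewrite !addnK.
case: a b ab abN am bn IHs => [|a] [|b]; rewrite ?minn0 ?min0n // => _ abN am bn IHs.
have im : (a < m)%N by lia.
have km : (a + s.+1 < m)%N by lia.
have jn : (b < n)%N by lia.
have ln : (b + s.+1 < n)%N by lia.
pose i := Ordinal im; pose k := Ordinal km; pose j := Ordinal jn; pose l := Ordinal ln.
have ik : (i < k)%N by rewrite /= addnS ltnS leq_addr.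
have jl : (j < l)%N by rewrite /= addnS ltnS leq_addr.
have d : (k - i = l - j)%N by rewrite /= !addKn.
have XE p (x y : 'I_p) (c : nat) : x = c :> nat -> y = (c + s.+1)%N :> nat ->
   [/\ [set z : 'I_p | (x < z < y)%N] = itv p c.+1 (c.+1 + s),
       [set z : 'I_p | (x < z < y)%N] :|: [set x] = itv p c (c + s.+1),
       [set z : 'I_p | (x < z < y)%N] :|: [set y] = itv p c.+1 (c.+1 + s.+1)
     & [set z : 'I_p | (x < z < y)%N] :|: [set x; y] = itv p c (c + s.+2)].
  by move=> xc yc; split; apply/setP => z; rewrite !inE -?val_eqE /= ?xc ?yc; lia.
have [X1 X2 X3 X4] := XE m i k a erefl erefl.
have [Y1 Y2 Y3 Y4] := XE n j l b erefl erefl.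
have := gD i k j l ik jl d; rewrite /= X2 X3 X4 Y2 Y3 Y4 X1 Y1.
have := hD i k j l ik jl d; rewrite /= X2 X3 X4 Y2 Y3 Y4 X1 Y1 => hE gE.
move: gE; rewrite (IH a b s.+1) ?(IH a b s.+2) ?(IH a b.+1) ?(IH a.+1 b) ?IHs -?hE; try lia.
move=> /eqP; rewrite -subr_eq0 -mulrBr => /eqP/hR; rewrite !card_itv ?addKn; try lia.
by move=> /(_ erefl)/eqP; rewrite subr_eq0 => /eqP.
Qed.

Lemma RQI_unique m n (q : K) (g h : {set 'I_m} -> {set 'I_n} -> A) :
  RQI_function q g -> P_extreme h -> P_extreme (fun J I => h I J) -> RQI_D q h ->
  regular_fun h -> g set0 set0 = h set0 set0 ->
  (forall i j, (0 < i <= m)%N -> (0 < j <= n)%N ->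
     g (pi_row m i j) (pi_col n i j) = h (pi_row m i j) (pi_col n i j)) ->
  forall (I : {set 'I_m}) (J : {set 'I_n}), #|I| = #|J| -> g I J = h I J.
Proof.
move=> [gP gPs gD] hP hPs hD hR gh0 ghpi I J.
have [N] := ubnP #|I|; elim: N I J => // N IHN I J IN.
have [H] := ubnP (#|hull I| + #|hull J|); elim: H I J IN => // H IHH I J IN IJH cIJ.
have IH1 (I' : {set 'I_m}) (J' : {set 'I_n}) : #|I'| = #|J'| -> (#|I'| < #|I|)%N -> g I' J' = h I' J'.
  by move=> c' lt; apply: IHN => //; apply: leq_trans lt IN.
have [hI|hI] := eqVneq (hull I) I; last first.
  apply: (RQI_P_step gP hP hR cIJ hI) => // I' cI' lt.
  by apply: IHH; rewrite ?cI' //; rewrite -ltnS (leq_trans _ IJH) // ltnS ltn_add2r.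
(* The rows now form an interval or are empty; gaps among the columns are removed by the same step,
   transposed. *)
have [hJ|hJ] := eqVneq (hull J) J; last first.
  have gPt : RQI_P (fun J I => g I J).
    by move=> X Y i j k l iX jX kX lY ij jk c; apply: gPs.
  have hRt : regular_fun (fun J I => h I J) by move=> J' I' c; apply: hR.
  apply: (RQI_P_step gPt hPs hRt (esym cIJ) hJ) => [J' I' c lt|J' cJ' lt].
    by apply: IH1; rewrite // -c cIJ.
  by apply: IHH; rewrite ?cJ' //; rewrite -ltnS (leq_trans _ IJH) // ltnS ltn_add2l.
have [a [b [bm IE]]] := hull_itv hI; have [c [d [dn JE]]] := hull_itv hJ.
have cE : (b - a = d - c)%N by rewrite -(card_itv a bm) -(card_itv c dn) -IE -JE.
have [ab|ba] := ltnP a b; last first.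
  have I0 : I = set0 by apply/eqP; rewrite -cards_eq0 IE card_itv // subn_eq0.
  by move: cIJ; rewrite I0 cards0 => /esym/eqP; rewrite cards_eq0 => /eqP ->.
have := RQI_D_itv gD hD hR gh0 ghpi (a := a) (b := c) (s := (b - a)%N).
rewrite subnKC ?(ltnW ab) // cE subnKC ?IE ?JE; last by lia.
by apply.
Qed.

End Uniqueness.

Lemma minor_RQI_D m n (K : fieldType) (q : K) (A : algType K) (X : 'M[A]_(m, n)) :
  q != 0 -> fine_qmatrix q X -> RQI_D q (minor q X).
Proof.
move=> q0 Xf i k j l ik jl d S J.
have SU x : S :|: [set x] = x |: S by rewrite setUC.
have JU x : J :|: [set x] = x |: J by rewrite setUC.
have SU2 x y : S :|: [set x; y] = x |: (y |: S) by rewrite setUC -setUA.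
have JU2 x y : J :|: [set x; y] = x |: (y |: J) by rewrite setUC -setUA.
rewrite !SU !JU SU2 JU2; apply: minor_dodgson => // [a|b|]; rewrite ?inE //.
have cE p (x y : 'I_p) : #|[set a : 'I_p | (x < a < y)%N]| = (y - x.+1)%N.
  by rewrite -(card_itv _ (ltnW (ltn_ord y))).
by rewrite !cE; lia.
Qed.

Lemma qi_holds_eq m n (K : fieldType) (q : K) (A : algType K)
    (g h : {set 'I_m} -> {set 'I_n} -> A) (s : seq (qi_term m n)) :
  (forall (I : {set 'I_m}) (J : {set 'I_n}), #|I| = #|J| -> g I J = h I J) -> qi_homogeneous s ->
  qi_holds q h s -> qi_holds q g s.
Proof.
move=> gh [UI [MI [UJ [MJ sP]]]] hs; apply: etrans hs.
elim: s sP => [|t s IH] sP; first by rewrite !big_nil.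
rewrite !big_cons IH => [|t' t's]; last by apply: sP; right.
by have [c c' _ _] := sP t (or_introl erefl); rewrite !gh.
Qed.

Unset Implicit Arguments.

Theorem corollary5p1 (m n : nat) (m_gt0 : (0 < m)%N) (n_gt0 : (0 < n)%N)
    (K : fieldType) (q : K) (q_neq0 : q != 0) (A : unitAlgType K)
    (f0 : {set 'I_m} -> {set 'I_n} -> A)
    (f0_unit : forall p : Pint m n,
       f0 (rowset p) (colset p) \is a GRing.unit)
    (f0_qc : quasi_commuting q f0)
    (f0_indep : alg_independent q f0)
    (f0_zerodiv : forall a : A, subalg_f0 f0 a ->
       zerodivisor_in (fun _ => True) a -> zerodivisor_in (subalg_f0 f0) a)
    (g : {set 'I_m} -> {set 'I_n} -> A)
    (g_normalized : g set0 set0 = 1)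
    (g_RQI : RQI_function q g)
    (g_f0 : forall p : Pint m n,
       g (rowset p) (colset p) = f0 (rowset p) (colset p)) :
  QI_function q g /\
  (forall (I : {set 'I_m}) (J : {set 'I_n}), #|I| = #|J| ->
     g I J = qminor q (path_mx f0) I J).
Proof.
have Xf := path_mx_fine f0_unit q_neq0 f0_qc n_gt0.
have gE (I : {set 'I_m}) (J : {set 'I_n}) : #|I| = #|J| -> g I J = qminor q (path_mx f0) I J.
  move=> cIJ; rewrite qminorE //; move: I J cIJ; apply: RQI_unique g_RQI _ _ _ _ _ _.
  - by move=> S J i j k l Sin jS ijk lJ c; apply: minor_P.
  - by move=> S J i j k l Sin jS ijk lJ c; apply: minor_Pstar.
  - exact: minor_RQI_D.
  - by move=> I J cIJ; apply: (minor_path_regular n_gt0 f0_unit f0_qc f0_indep f0_zerodiv cIJ).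
  - by rewrite minor0 eqxx.
  - move=> i j i0 j0; have [p [<- <-]] := pi_pint i0 j0.
    by rewrite g_f0 -(qminor_pint f0_unit q_neq0 f0_qc) qminorE //; case: p => -[I J] /= /and4P[/eqP].
(* Homogeneity ensures that only values with #|I| = #|J| occur, where [g] and the minors agree; the
   path matrix is fine, so the identity holds for its minors. *)
split=> // s [hs us]; apply: (qi_holds_eq gE hs).
exact: us.
Qed.
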